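(* Let $\varphi:\mathbb{D}\to\mathbb{D}$ be a parabolic holomorphic self-map with Koenigs function $h_\varphi$ and Denjoy–Wolff point $\tau\in\partial\mathbb{D}$. Suppose $\psi\in\mathsf{Hol}_\tau(\mathbb{D})$ satisfies $h_\varphi\circ\psi=h_\varphi+c$ for some constant $c\in\mathbb{R}$. The following statements hold. (1) $c=0$ if and only if $\psi=\mathrm{id}_{\mathbb{D}}$. (2) If $c=\frac{m}{n}\in\mathbb{Q}$ with $m,n\in\mathbb{N}$, then $\psi^{\circ n}=\varphi^{\circ m}$. (3) If $c<0$, then $\varphi$ as well as $\psi$ are parabolic automorphisms of $\mathbb{D}$. Moreover, if $c=-\frac{m}{n}\in\mathbb{Q}$ with $m,n\in\mathbb{N}$, then $\psi^{\circ n}=\varphi^{\circ-m}$.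
   Context: $\mathbb{D}=\{z\in\mathbb{C}:|z|<1\}$, $\mathbb{H}=\{w\in\mathbb{C}:\operatorname{Im}w>0\}$, $\mathbb{N}=\{1,2,\dots\}$, and $\rho_{\mathbb{D}}$ denotes the hyperbolic distance in $\mathbb{D}$. $\varphi^{\circ n}$ is the $n$-th iterate of $\varphi$; if $\varphi$ is an automorphism, $\varphi^{\circ-n}$ is the $n$-th iterate of $\varphi^{-1}$. Denjoy–Wolff point: a holomorphic self-map $\varphi\neq\mathrm{id}_{\mathbb{D}}$ of $\mathbb{D}$ that is not an automorphism with a fixed point in $\mathbb{D}$ has iterates converging locally uniformly to a point $\tau\in\overline{\mathbb{D}}$, its Denjoy–Wolff point. It is parabolic if $\tau\in\partial\mathbb{D}$ and the angular derivative satisfies $\varphi'(\tau)=1$. For parabolic $\varphi$, the limit $\lim_{n\to\infty}\rho_{\mathbb{D}}(\varphi^{\circ n}(z),\varphi^{\circ(n+1)}(z))$ is either zero for all $z\in\mathbb{D}$ (zero hyperbolic step) or positive for all $z\in\mathbb{D}$ (positive hyperbolic step). $\mathsf{Hol}_\tau(\mathbb{D})$ is the family consisting of $\mathrm{id}_{\mathbb{D}}$ and all holomorphic self-maps $\psi\neq\mathrm{id}_{\mathbb{D}}$ of $\mathbb{D}$ whose Denjoy–Wolff point is $\tau$. Koenigs function of a parabolic $\varphi$: the function $h_\varphi$ is the unique holomorphic $h:\mathbb{D}\to S$ such that $h\circ\varphi=h+1$, $S=\bigcup_{n\ge0}(h(\mathbb{D})-n)$, and $h$ is injective on some $\varphi$-absorbing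 domain (a domain $W\subset\mathbb{D}$ with $\varphi(W)\subset W$ and $\mathbb{D}=\bigcup_{n\in\mathbb{N}}(\varphi^{\circ n})^{-1}(W)$), where: if $\varphi$ is of zero hyperbolic step, $S=\mathbb{C}$ and $h(0)=0$; if $\varphi$ is of positive hyperbolic step, $S=\mathbb{H}$ or $S=-\mathbb{H}$ (which of the two is determined by $\varphi$) and $\operatorname{Re}h(0)=0$. *)

(* Defs.v *)
(* Stdlib real numbers, with Coquelicot's complex numbers. *)
From Stdlib Require Import Reals Lra Lia ClassicalEpsilon.
From Coquelicot Require Import Coquelicot.

Open Scope R_scope.

(* Subsets of the plane are predicates, and maps defined on the disc are total
   functions C -> C of which only the restriction to the disc is considered. *)

Definition Disc (z : C) : Prop := Cmod z < 1.

Definition UpperHalfPlane (w : C) : Prop := 0 < Im w.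
Definition LowerHalfPlane (w : C) : Prop := Im w < 0.
Definition WholePlane (_ : C) : Prop := True.

Definition maps_into (A B : C -> Prop) (f : C -> C) : Prop :=
  forall z, A z -> B (f z).

Definition eq_on (A : C -> Prop) (f g : C -> C) : Prop :=
  forall z, A z -> f z = g z.

Definition inj_on (A : C -> Prop) (f : C -> C) : Prop :=
  forall z w, A z -> A w -> f z = f w -> z = w.

Definition surj_on (A B : C -> Prop) (f : C -> C) : Prop :=
  forall w, B w -> exists z, A z /\ f z = w.

Definition id_on_disc (f : C -> C) : Prop := eq_on Disc f (fun z => z).

Definition iterate (f : C -> C) (n : nat) : C -> C := Nat.iter n f.

(* Complex differentiability at every point of A. *)
Definition holomorphic_on (A : C -> Prop) (f : C -> C) : Prop :=
  forall z, A z -> ex_derive (K := C_AbsRing) (V := C_NormedModule) f z.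

Definition holo_selfmap (f : C -> C) : Prop :=
  holomorphic_on Disc f /\ maps_into Disc Disc f.

Definition disc_automorphism (f : C -> C) : Prop :=
  holo_selfmap f /\ inj_on Disc f /\ surj_on Disc Disc f.

(* The inverse of the restriction of f to the disc; the value at w is
   meaningful when w has a unique preimage in the disc. *)
Definition disc_inverse (f : C -> C) : C -> C :=
  fun w => epsilon (inhabits (RtoC 0)) (fun z => Disc z /\ f z = w).

Definition iterates_cv_loc_unif (f : C -> C) (tau : C) : Prop :=
  forall z, Disc z -> exists delta : R, 0 < delta /\
    forall eps : R, 0 < eps -> exists N : nat, forall (n : nat) (w : C),
      (N <= n)%nat -> Disc w -> Cmod (w - z)%C < delta ->
      Cmod (iterate f n w - tau)%C < eps.

Definition is_DW_point (f : C -> C) (tau : C) : Prop :=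
  holo_selfmap f /\
  ~ id_on_disc f /\
  ~ (disc_automorphism f /\ exists z, Disc z /\ f z = z) /\
  Cmod tau <= 1 /\
  iterates_cv_loc_unif f tau.

Definition Hol_tau (tau : C) (f : C -> C) : Prop :=
  holo_selfmap f /\ (id_on_disc f \/ is_DW_point f tau).

Definition stolz_region (tau : C) (M : R) (z : C) : Prop :=
  Disc z /\ Cmod (z - tau)%C < M * (1 - Cmod z).

Definition is_angular_limit (f : C -> C) (tau l : C) : Prop :=
  forall M : R, 1 < M ->
    filterlim f (within (stolz_region tau M) (locally tau)) (locally l).

(* f'(tau) = d, where f(tau) stands for the angular limit of f at tau. *)
Definition is_angular_derivative (f : C -> C) (tau d : C) : Prop :=
  exists l : C, is_angular_limit f tau l /\
    is_angular_limit (fun z => ((f z - l) / (z - tau))%C) tau d.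

Definition parabolic (f : C -> C) : Prop :=
  exists tau : C, is_DW_point f tau /\ Cmod tau = 1 /\
    is_angular_derivative f tau (RtoC 1).

Definition pseudo_hyp_dist (z w : C) : R :=
  Cmod ((z - w) / (RtoC 1 - Cconj w * z))%C.

(* Normalised by the density 1 / (1 - |z|^2); the other usual normalisation is
   twice this one and gives the same notions of hyperbolic step. *)
Definition hyp_dist (z w : C) : R :=
  / 2 * ln ((1 + pseudo_hyp_dist z w) / (1 - pseudo_hyp_dist z w)).

Definition hyp_step_seq (f : C -> C) (z : C) (n : nat) : R :=
  hyp_dist (iterate f n z) (iterate f (S n) z).

Definition zero_hyp_step (f : C -> C) : Prop :=
  forall z, Disc z -> is_lim_seq (hyp_step_seq f z) 0.

Definition positive_hyp_step (f : C -> C) : Prop :=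
  forall z, Disc z -> exists l : R, 0 < l /\ is_lim_seq (hyp_step_seq f z) l.

Definition connected_set (A : C -> Prop) : Prop :=
  forall U V : C -> Prop, open U -> open V ->
    (forall z, A z -> U z \/ V z) ->
    (exists z, A z /\ U z) -> (exists z, A z /\ V z) ->
    exists z, A z /\ U z /\ V z.

Definition domain (A : C -> Prop) : Prop :=
  open A /\ (exists z, A z) /\ connected_set A.

Definition absorbing_domain (f : C -> C) (W : C -> Prop) : Prop :=
  domain W /\
  (forall z, W z -> Disc z) /\
  maps_into W W f /\
  (forall z, Disc z -> exists n : nat, (1 <= n)%nat /\ W (iterate f n z)).

Definition koenigs_model (f h : C -> C) (S : C -> Prop) : Prop :=
  holomorphic_on Disc h /\
  maps_into Disc S h /\
  (forall z, Disc z -> h (f z) = (h z + RtoC 1)%C) /\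
  (forall w, S w <->
     exists (n : nat) (z : C), Disc z /\ w = (h z - RtoC (INR n))%C) /\
  (exists W, absorbing_domain f W /\ inj_on W h).

Definition is_koenigs_function (f h : C -> C) : Prop :=
  (zero_hyp_step f /\ koenigs_model f h WholePlane /\ h (RtoC 0) = RtoC 0) \/
  (positive_hyp_step f /\
   (koenigs_model f h UpperHalfPlane \/ koenigs_model f h LowerHalfPlane) /\
   Re (h (RtoC 0)) = 0).

(* Main.v *)
(* The relation [h (A z) = h (B z)] only gives [phi^N A = phi^N B]: both sides land
   in the absorbing domain [W] near [0] for large [N], and the identity theorem
   extends the equality to the disc. If [A] and [B] preserve the horodiscs at [tau]
   (Julia's lemma, which holds for maps with Denjoy-Wolff point [tau]), they keep
   the radius ending at [tau] in a Stolz region; as [phi] has angular derivative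
   [1], so does [phi^N], which is therefore injective on the part of that region
   close to [tau]. Hence [A = B], which gives (1) and (2).

   If [c < 0], then [w - n c] moves to the right and eventually enters [h(W)], where
   [psi] acts as translation by [c] on the inverse [k] of [h|W]. So
   [psi^n (k (w - n c))] is eventually constant in [n] and defines a holomorphic
   section of [h] on all of [S]. For [S = C] this contradicts Liouville's theorem;
   for a half-plane it forces equality in Schwarz's lemma, so that [h] is a Möbius
   bijection onto [S] conjugating [phi] and [psi] to translations.

   The function theory this needs comes from Goursat's theorem applied to
   [f (exp s)]: integrals of [f] over concentric circles agree, which yields
   Cauchy's formula on circles. *)
Require Import Defs.
From Stdlib Require Import Reals Lra Lia ClassicalEpsilon.
From Coquelicot Require Import Coquelicot.
Open Scope R_scope.

(** * Continuity and complex differentiability *)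

(** The obstacle is that neither [h] nor [phi] need be injective on the disc. So [phi^N A = phi^N B]
    cannot be cancelled at an interior point, where [A] and [B] may take values that [phi^N]
    identifies. Near [tau] this is possible, because on a Stolz region every iterate of [phi]
    differs from the identity by little compared with the distance to [tau]. Julia's inequality
    suits this purpose because it passes to compositions and iterates.

    Rigidity also gives [psi phi = phi psi]. This is essential for the negative case: [W] is
    invariant under [phi] only, and commutation lets [phi^N] carry both [z] and [psi z] into [W], so
    that far to the right [psi] respects the inverse branch [k].

    The branch is pulled back by [psi^n] because [h (psi^n v) = w] whenever [h v = w - n c]. The
    resulting section takes values in the disc, so it is bounded, which is what Liouville's theorem
    and Schwarz's lemma need. Its holomorphy rests on that of [k], where zeros of the derivative of
    [h] have to be ruled out; orders of zeros, obtained by repeated division by [z], take the place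
    of power series. *)

Definition ccont (f : C -> C) (a : C) : Prop :=
  forall eps, 0 < eps -> exists d, 0 < d /\
    forall z, Cmod (z - a)%C < d -> Cmod (f z - f a)%C < eps.

(* Carathéodory's form of complex differentiability: the difference quotient,
   completed by some value at [a], is continuous at [a]. *)
Definition cdiff (f : C -> C) (a : C) : Prop :=
  exists q, (forall z, f z = (f a + q z * (z - a))%C) /\ ccont q a.

Lemma Cmod_minus_sym (a b : C) : Cmod (a - b)%C = Cmod (b - a)%C.
Proof. rewrite <- Cmod_opp. f_equal. ring. Qed.

Lemma Cmod_tri_minus (a b c : C) :
  Cmod (a - c)%C <= Cmod (a - b)%C + Cmod (b - c)%C.
Proof.
  replace (a - c)%C with ((a - b) + (b - c))%C by ring. apply Cmod_triangle.
Qed.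

Lemma Cmod_rev_triangle (a b : C) : Cmod a - Cmod b <= Cmod (a - b)%C.
Proof.
  pose proof (Cmod_triangle (a - b) b) as H.
  replace (a - b + b)%C with a in H by ring. lra.
Qed.

Lemma Cminus_neq_0 (a b : C) : a <> b -> (a - b)%C <> 0.
Proof.
  intros H E. apply H. replace a with (a - b + b)%C by ring. rewrite E. ring.
Qed.

Lemma Cminus_eq_0 (a b : C) : (a - b)%C = 0 -> a = b.
Proof. intros E. replace a with (a - b + b)%C by ring. rewrite E. ring. Qed.

Lemma Cmod_self_minus (a : C) : Cmod (a - a)%C = 0.
Proof. replace (a - a)%C with (RtoC 0) by ring. apply Cmod_0. Qed.

Lemma im_le_Cmod (c : C) : Rabs (Im c) <= Cmod c.
Proof.
  apply Rle_trans with (2 := Rmax_Cmod c). apply Rmax_r.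
Qed.

Lemma Cmod_le_re_im (c : C) : Cmod c <= Rabs (Re c) + Rabs (Im c).
Proof.
  pose proof (Cmod2_alt c) as H. pose proof (Cmod_ge_0 c).
  pose proof (Rabs_pos (Re c)). pose proof (Rabs_pos (Im c)).
  rewrite <- (pow2_abs (Re c)), <- (pow2_abs (Im c)) in H. nra.
Qed.

Lemma ccont_const (c a : C) : ccont (fun _ => c) a.
Proof.
  intros e He. exists 1. split; [lra|]. intros. rewrite Cmod_self_minus. exact He.
Qed.

Lemma ccont_id (a : C) : ccont (fun z => z) a.
Proof. intros e He. exists e. auto. Qed.

Lemma ccont_local (f g : C -> C) (a : C) (r : R) :
  0 < r -> (forall z, Cmod (z - a)%C < r -> f z = g z) -> ccont f a -> ccont g a.
Proof.
  intros Hr E Hf e He. destruct (Hf e He) as [d [Hd H]].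
  exists (Rmin r d). split; [now apply Rmin_pos|]. intros z Hz.
  assert (Cmod (z - a)%C < r) by (eapply Rlt_le_trans; [exact Hz|apply Rmin_l]).
  assert (Cmod (z - a)%C < d) by (eapply Rlt_le_trans; [exact Hz|apply Rmin_r]).
  rewrite <- !E; auto. rewrite Cmod_self_minus; lra.
Qed.

Lemma ccont_plus (f g : C -> C) (a : C) :
  ccont f a -> ccont g a -> ccont (fun z => f z + g z)%C a.
Proof.
  intros Hf Hg e He.
  destruct (Hf (e / 2)) as [d1 [Hd1 H1]]; [lra|].
  destruct (Hg (e / 2)) as [d2 [Hd2 H2]]; [lra|].
  exists (Rmin d1 d2). split; [now apply Rmin_pos|]. intros z Hz.
  specialize (H1 z (Rlt_le_trans _ _ _ Hz (Rmin_l _ _))).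
  specialize (H2 z (Rlt_le_trans _ _ _ Hz (Rmin_r _ _))).
  replace (f z + g z - (f a + g a))%C with ((f z - f a) + (g z - g a))%C by ring.
  eapply Rle_lt_trans; [apply Cmod_triangle|]. lra.
Qed.

Lemma ccont_mult (f g : C -> C) (a : C) :
  ccont f a -> ccont g a -> ccont (fun z => f z * g z)%C a.
Proof.
  intros Hf Hg e He.
  pose proof (Cmod_ge_0 (f a)) as Pf. pose proof (Cmod_ge_0 (g a)) as Pg.
  set (ef := e / (2 * (Cmod (g a) + 1))). set (eg := e / (2 * (Cmod (f a) + 1))).
  assert (0 < ef) by (apply Rdiv_lt_0_compat; lra).
  assert (0 < eg) by (apply Rdiv_lt_0_compat; lra).
  destruct (Hf ef) as [d1 [Hd1 H1]]; [lra|].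
  destruct (Hg (Rmin 1 eg)) as [d2 [Hd2 H2]]; [apply Rmin_pos; lra|].
  exists (Rmin d1 d2). split; [now apply Rmin_pos|]. intros z Hz.
  specialize (H1 z (Rlt_le_trans _ _ _ Hz (Rmin_l _ _))).
  specialize (H2 z (Rlt_le_trans _ _ _ Hz (Rmin_r _ _))).
  assert (H3 := Rlt_le_trans _ _ _ H2 (Rmin_l _ _)).
  assert (H4 := Rlt_le_trans _ _ _ H2 (Rmin_r _ _)).
  replace (f z * g z - f a * g a)%C with ((f z - f a) * g z + f a * (g z - g a))%C by ring.
  eapply Rle_lt_trans; [apply Cmod_triangle|]. rewrite !Cmod_mult.
  assert (Cmod (g z) <= Cmod (g a) + 1).
  { pose proof (Cmod_rev_triangle (g z) (g a)). lra. }
  assert (Cmod (f z - f a)%C * Cmod (g z) <= ef * (Cmod (g a) + 1)).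
  { apply Rmult_le_compat; try apply Cmod_ge_0; lra. }
  assert (Cmod (f a) * Cmod (g z - g a)%C < (Cmod (f a) + 1) * eg).
  { pose proof (Cmod_ge_0 (g z - g a)%C). nra. }
  assert (ef * (Cmod (g a) + 1) = e / 2) by (unfold ef; field; lra).
  assert ((Cmod (f a) + 1) * eg = e / 2) by (unfold eg; field; lra).
  lra.
Qed.

Lemma ccont_inv (f : C -> C) (a : C) :
  f a <> 0 -> ccont f a -> ccont (fun z => / f z)%C a.
Proof.
  intros N Hf e He. pose proof (proj1 (Cmod_gt_0 _) N) as P.
  set (m := Cmod (f a)) in *.
  destruct (Hf (Rmin (m / 2) (e * (m * m) / 2))) as [d [Hd H]].
  { apply Rmin_pos; [lra|]. apply Rdiv_lt_0_compat; [|lra].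
    apply Rmult_lt_0_compat; nra. }
  exists d. split; [exact Hd|]. intros z Hz. specialize (H z Hz).
  assert (H3 := Rlt_le_trans _ _ _ H (Rmin_l _ _)).
  assert (H4 := Rlt_le_trans _ _ _ H (Rmin_r _ _)).
  assert (P2 : m / 2 <= Cmod (f z)).
  { pose proof (Cmod_rev_triangle (f a) (f z)). rewrite Cmod_minus_sym in H3.
    fold m in H0. lra. }
  assert (Nz : f z <> 0) by (apply Cmod_gt_0; lra).
  replace (/ f z - / f a)%C with ((f a - f z) / (f z * f a))%C by (field; auto).
  rewrite Cmod_div by (now apply Cmult_neq_0). rewrite Cmod_mult, Cmod_minus_sym.
  fold m. apply Rmult_lt_reg_r with (Cmod (f z) * m).
  { apply Rmult_lt_0_compat; lra. }
  unfold Rdiv. rewrite Rmult_assoc, Rinv_l, Rmult_1_r.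
  2:{ apply Rgt_not_eq. apply Rmult_lt_0_compat; lra. }
  eapply Rlt_le_trans; [exact H4|].
  assert (m * m / 2 <= Cmod (f z) * m) by nra. nra.
Qed.

Lemma ccont_comp (f g : C -> C) (a : C) :
  ccont f a -> ccont g (f a) -> ccont (fun z => g (f z)) a.
Proof.
  intros Hf Hg e He. destruct (Hg e He) as [d [Hd H]].
  destruct (Hf d Hd) as [d' [Hd' H']]. exists d'. split; auto.
Qed.

Lemma ccont_opp (f : C -> C) (a : C) : ccont f a -> ccont (fun z => - f z)%C a.
Proof.
  intros Hf. apply ccont_local with (f := fun z => (-(1) * f z)%C) (r := 1); [lra| |].
  - intros; ring.
  - apply ccont_mult; [apply ccont_const|exact Hf].
Qed.

Lemma ccont_minus (f g : C -> C) (a : C) :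
  ccont f a -> ccont g a -> ccont (fun z => f z - g z)%C a.
Proof. intros. apply ccont_plus; [|apply ccont_opp]; auto. Qed.

Lemma ccont_div (f g : C -> C) (a : C) :
  g a <> 0 -> ccont f a -> ccont g a -> ccont (fun z => f z / g z)%C a.
Proof. intros. apply ccont_mult; [|apply ccont_inv]; auto. Qed.

Lemma cdiff_ccont (f : C -> C) (a : C) : cdiff f a -> ccont f a.
Proof.
  intros [q [E Hq]].
  apply ccont_local with (f := fun z => (f a + q z * (z - a))%C) (r := 1); [lra| |].
  - intros z _. now rewrite <- E.
  - apply ccont_plus; [apply ccont_const|]. apply ccont_mult; [exact Hq|].
    apply ccont_minus; [apply ccont_id|apply ccont_const].
Qed.

Lemma cdiff_const (c a : C) : cdiff (fun _ => c) a.
Proof. exists (fun _ => 0). split; [intros; ring|apply ccont_const]. Qed.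

Lemma cdiff_id (a : C) : cdiff (fun z => z) a.
Proof. exists (fun _ => 1). split; [intros; ring|apply ccont_const]. Qed.

(** [cdiff] asks for the factorisation on the whole plane; away from [a] the true difference
    quotient supplies it, and continuity at [a] does not notice the change. *)
Lemma cdiff_of_quotient (f q : C -> C) (a : C) (r : R) :
  0 < r -> ccont q a ->
  (forall z, Cmod (z - a)%C < r -> f z = f a + q z * (z - a))%C -> cdiff f a.
Proof.
  intros Hr Hq E.
  exists (fun z => if excluded_middle_informative (Cmod (z - a)%C < r) then q z
           else ((f z - f a) / (z - a))%C). split.
  - intros z. destruct excluded_middle_informative as [H|H]; [now apply E|].
    assert (z <> a) by (intros ->; rewrite Cmod_self_minus in H; lra).
    field. now apply Cminus_neq_0.
  - apply ccont_local with (f := q) (r := r); [exact Hr| |exact Hq].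
    intros z Hz. destruct excluded_middle_informative; [reflexivity|contradiction].
Qed.

Lemma cdiff_local (f g : C -> C) (a : C) (r : R) :
  0 < r -> (forall z, Cmod (z - a)%C < r -> f z = g z) -> cdiff f a -> cdiff g a.
Proof.
  intros Hr E [q [Eq Hq]]. apply cdiff_of_quotient with (q := q) (r := r); auto.
  intros z Hz. rewrite <- !E; auto. rewrite Cmod_self_minus; lra.
Qed.

Lemma cdiff_plus (f g : C -> C) (a : C) :
  cdiff f a -> cdiff g a -> cdiff (fun z => f z + g z)%C a.
Proof.
  intros [p [Ep Hp]] [q [Eq Hq]]. exists (fun z => p z + q z)%C.
  split; [|now apply ccont_plus]. intros z. rewrite (Ep z), (Eq z). ring.
Qed.

Lemma cdiff_mult (f g : C -> C) (a : C) :
  cdiff f a -> cdiff g a -> cdiff (fun z => f z * g z)%C a.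
Proof.
  intros Hf Hg. pose proof (cdiff_ccont _ _ Hg) as Cg.
  destruct Hf as [p [Ep Hp]]. destruct Hg as [q [Eq Hq]].
  exists (fun z => p z * g z + f a * q z)%C. split.
  - intros z. rewrite (Ep z) at 1. rewrite (Eq z). ring.
  - apply ccont_plus; apply ccont_mult; auto using ccont_const.
Qed.

Lemma cdiff_comp (f g : C -> C) (a : C) :
  cdiff f a -> cdiff g (f a) -> cdiff (fun z => g (f z)) a.
Proof.
  intros Hf. pose proof (cdiff_ccont _ _ Hf) as Cf.
  destruct Hf as [p [Ep Hp]]. intros [q [Eq Hq]].
  exists (fun z => q (f z) * p z)%C. split.
  - intros z. rewrite (Eq (f z)). rewrite (Ep z) at 2. ring.
  - apply ccont_mult; auto. now apply ccont_comp with (g := q).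
Qed.

Lemma cdiff_inv_id (a : C) : a <> 0 -> cdiff (fun z => / z)%C a.
Proof.
  intros N. pose proof (proj1 (Cmod_gt_0 _) N).
  apply cdiff_of_quotient with (q := fun z => (- / (z * a))%C) (r := Cmod a); auto.
  - apply ccont_opp, ccont_inv; [now apply Cmult_neq_0|].
    apply ccont_mult; [apply ccont_id|apply ccont_const].
  - intros z Hz. assert (z <> 0).
    { intros ->. replace (0 - a)%C with (- a)%C in Hz by ring.
      rewrite Cmod_opp in Hz. lra. }
    field; auto.
Qed.

Lemma cdiff_inv (f : C -> C) (a : C) :
  f a <> 0 -> cdiff f a -> cdiff (fun z => / f z)%C a.
Proof.
  intros N Hf. apply cdiff_comp with (g := fun z => (/ z)%C); auto.
  now apply cdiff_inv_id.
Qed.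

Lemma cdiff_opp (f : C -> C) (a : C) : cdiff f a -> cdiff (fun z => - f z)%C a.
Proof.
  intros Hf. apply cdiff_local with (f := fun z => (-(1) * f z)%C) (r := 1); [lra| |].
  - intros; ring.
  - apply cdiff_mult; [apply cdiff_const|exact Hf].
Qed.

Lemma cdiff_minus (f g : C -> C) (a : C) :
  cdiff f a -> cdiff g a -> cdiff (fun z => f z - g z)%C a.
Proof. intros. apply cdiff_plus; [|apply cdiff_opp]; auto. Qed.

Lemma cdiff_div (f g : C -> C) (a : C) :
  g a <> 0 -> cdiff f a -> cdiff g a -> cdiff (fun z => f z / g z)%C a.
Proof. intros. apply cdiff_mult; [|apply cdiff_inv]; auto. Qed.

Lemma cdiff_pow (f : C -> C) (n : nat) (a : C) :
  cdiff f a -> cdiff (fun z => f z ^ n)%C a.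
Proof.
  intros Hf. induction n as [|n IH]; simpl; [apply cdiff_const|].
  now apply cdiff_mult.
Qed.

Lemma locally_Cmod (a : C) (P : C -> Prop) :
  locally (T := C_UniformSpace) a P <->
  exists d, 0 < d /\ forall z, Cmod (z - a)%C < d -> P z.
Proof.
  rewrite locally_C. split.
  - intros [d H]. exists d. split; [apply cond_pos|]. intros z Hz. apply H. exact Hz.
  - intros [d [Hd H]]. exists (mkposreal d Hd). intros z Hz. apply H. exact Hz.
Qed.

Lemma cdiff_of_approx (f : C -> C) (a D : C) :
  (forall eps, 0 < eps -> exists d, 0 < d /\ forall z, Cmod (z - a)%C < d ->
     Cmod (f z - f a - D * (z - a))%C <= eps * Cmod (z - a)%C) ->
  cdiff f a.
Proof.
  intros H.
  exists (fun z => if excluded_middle_informative (z = a) then D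
                   else ((f z - f a) / (z - a))%C).
  split.
  - intros z. destruct excluded_middle_informative as [->|N]; [ring|].
    field. now apply Cminus_neq_0.
  - intros e He. destruct (H (e / 2)) as [d [Hd Hz]]; [lra|].
    exists d. split; [exact Hd|]. intros z Hza.
    destruct (excluded_middle_informative (a = a)) as [_|?]; [|easy].
    destruct excluded_middle_informative as [->|N].
    { rewrite Cmod_self_minus. exact He. }
    specialize (Hz z Hza).
    assert (Nz : (z - a)%C <> 0) by now apply Cminus_neq_0.
    replace ((f z - f a) / (z - a) - D)%C
      with ((f z - f a - D * (z - a)) / (z - a))%C by (field; auto).
    rewrite Cmod_div by auto. pose proof (proj1 (Cmod_gt_0 _) Nz) as P.
    apply Rle_lt_trans with (e / 2); [|lra].
    apply Rmult_le_reg_r with (Cmod (z - a)%C); [exact P|].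
    unfold Rdiv. rewrite (Rmult_assoc (Cmod _) (/ _)), Rinv_l by lra. lra.
Qed.

Lemma ex_derive_cdiff (f : C -> C) (a : C) :
  ex_derive (K := C_AbsRing) (V := C_NormedModule) f a -> cdiff f a.
Proof.
  intros [D [_ HD]]. apply cdiff_of_approx with (D := D). intros e He.
  assert (HF : is_filter_lim (locally (T := AbsRing_UniformSpace C_AbsRing) a) a)
    by (intros P HP; exact HP).
  destruct (HD a HF (mkposreal e He)) as [d H].
  exists d. split; [apply cond_pos|]. intros z Hz. rewrite Cmult_comm. exact (H z Hz).
Qed.

(** * Goursat's theorem *)

Definition rcont (g : R -> C) (t : R) : Prop :=
  forall eps, 0 < eps -> exists d, 0 < d /\
    forall u, Rabs (u - t) < d -> Cmod (g u - g t)%C < eps.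

Definition CInt (g : R -> C) (a b : R) : C :=
  (RInt (fun t => Re (g t)) a b, RInt (fun t => Im (g t)) a b).

Definition ex_CInt (g : R -> C) (a b : R) : Prop :=
  ex_RInt (fun t => Re (g t)) a b /\ ex_RInt (fun t => Im (g t)) a b.

Lemma rcont_continuous (g : R -> C) (t : R) :
  rcont g t -> continuous (fun u => Re (g u)) t /\ continuous (fun u => Im (g u)) t.
Proof.
  intros H. split; apply filterlim_locally; intros e;
    destruct (H e (cond_pos e)) as [d [Hd H']]; exists (mkposreal d Hd);
    intros u Hu; specialize (H' u Hu).
  - change (Rabs (Re (g u) - Re (g t)) < e).
    pose proof (re_le_Cmod (g u - g t)) as H1. unfold Cminus in H1.
    rewrite re_plus, re_opp in H1. unfold Cminus in H'. unfold Rminus. lra.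
  - change (Rabs (Im (g u) - Im (g t)) < e).
    pose proof (im_le_Cmod (g u - g t)) as H1. unfold Cminus in H1.
    rewrite im_plus, im_opp in H1. unfold Cminus in H'. unfold Rminus. lra.
Qed.

Lemma rcont_comp (s : R -> C) (f : C -> C) (t : R) :
  rcont s t -> ccont f (s t) -> rcont (fun u => f (s u)) t.
Proof.
  intros Hs Hf e He. destruct (Hf e He) as [d [Hd H]].
  destruct (Hs d Hd) as [d' [Hd' H']]. exists d'. auto.
Qed.

Lemma rcont_horizontal (c x : R) : rcont (fun u => (u, c) : C) x.
Proof.
  intros e He. exists e. split; [exact He|]. intros u Hu.
  replace ((u, c) - (x, c))%C with (RtoC (u - x)).
  - now rewrite Cmod_R.
  - unfold RtoC, Cminus, Cplus, Copp; simpl. f_equal; ring.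
Qed.

Lemma rcont_vertical (c x : R) : rcont (fun u => (c, u) : C) x.
Proof.
  intros e He. exists e. split; [exact He|]. intros u Hu.
  replace ((c, u) - (c, x))%C with (Ci * RtoC (u - x))%C.
  - rewrite Cmod_mult, Cmod_Ci, Rmult_1_l. now rewrite Cmod_R.
  - unfold RtoC, Ci, Cmult, Cminus, Cplus, Copp; simpl. f_equal; ring.
Qed.

Lemma ex_CInt_rcont (g : R -> C) (a b : R) :
  a <= b -> (forall t, a <= t <= b -> rcont g t) -> ex_CInt g a b.
Proof.
  intros Hab H. split; apply (ex_RInt_continuous (V := R_CompleteNormedModule));
    intros t Ht; rewrite Rmin_left, Rmax_right in Ht by exact Hab;
    apply (rcont_continuous g t (H t Ht)).
Qed.

Lemma CInt_Chasles (g : R -> C) (a b c : R) :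
  ex_CInt g a b -> ex_CInt g b c -> (CInt g a b + CInt g b c)%C = CInt g a c.
Proof.
  intros [H1 H2] [H3 H4]. unfold CInt, Cplus; simpl. f_equal.
  - apply (RInt_Chasles (fun t => Re (g t)) a b c H1 H3).
  - apply (RInt_Chasles (fun t => Im (g t)) a b c H2 H4).
Qed.

Lemma CInt_ext (f g : R -> C) (a b : R) :
  a <= b -> (forall t, a <= t <= b -> f t = g t) -> CInt f a b = CInt g a b.
Proof.
  intros Hab E. unfold CInt. f_equal; apply RInt_ext; intros t Ht;
    rewrite Rmin_left, Rmax_right in Ht by exact Hab; rewrite E; lra.
Qed.

Lemma CInt_plus (f g : R -> C) (a b : R) :
  ex_CInt f a b -> ex_CInt g a b ->
  CInt (fun t => f t + g t)%C a b = (CInt f a b + CInt g a b)%C.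
Proof.
  intros [H1 H2] [H3 H4]. unfold CInt, Cplus; simpl. f_equal.
  - apply (RInt_plus (fun t => Re (f t)) (fun t => Re (g t))); auto.
  - apply (RInt_plus (fun t => Im (f t)) (fun t => Im (g t))); auto.
Qed.

Lemma is_CInt_scal (k : C) (f : R -> C) (a b : R) :
  ex_CInt f a b ->
  ex_CInt (fun t => k * f t)%C a b /\
  CInt (fun t => k * f t)%C a b = (k * CInt f a b)%C.
Proof.
  intros [H1 H2]. apply (RInt_correct (V := R_CompleteNormedModule)) in H1.
  apply (RInt_correct (V := R_CompleteNormedModule)) in H2.
  assert (I1 : is_RInt (fun t => Re (k * f t)%C) a b (Re (k * CInt f a b)%C)).
  { rewrite re_mult.
    apply is_RInt_ext with (f := fun t => minus (scal (Re k) (Re (f t))) (scal (Im k) (Im (f t)))).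
    - intros t _. now rewrite re_mult.
    - apply (is_RInt_minus (V := R_NormedModule)); apply (is_RInt_scal (V := R_NormedModule)); assumption. }
  assert (I2 : is_RInt (fun t => Im (k * f t)%C) a b (Im (k * CInt f a b)%C)).
  { rewrite im_mult.
    apply is_RInt_ext with (f := fun t => plus (scal (Re k) (Im (f t))) (scal (Im k) (Re (f t)))).
    - intros t _. now rewrite im_mult.
    - apply (is_RInt_plus (V := R_NormedModule)); apply (is_RInt_scal (V := R_NormedModule)); assumption. }
  split.
  - split; eexists; eassumption.
  - apply injective_projections;
      [exact (is_RInt_unique _ _ _ _ I1)|exact (is_RInt_unique _ _ _ _ I2)].
Qed.

Lemma CInt_scal (k : C) (f : R -> C) (a b : R) :
  ex_CInt f a b -> CInt (fun t => k * f t)%C a b = (k * CInt f a b)%C.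
Proof. intros H. apply (is_CInt_scal k f a b H). Qed.

Lemma CInt_const (k : C) (a b : R) : CInt (fun _ => k) a b = (k * (b - a))%C.
Proof.
  unfold CInt. rewrite !RInt_const. unfold scal; simpl. unfold mult; simpl.
  destruct k as [x y]. unfold Cmult, Cminus, Cplus, Copp, RtoC; simpl.
  f_equal; ring.
Qed.

(** The factor [2] comes from estimating real and imaginary parts separately. It does no harm: the
    later estimates either tend to [0] or are freed of constants by passing to high powers. *)
Lemma CInt_bound (g : R -> C) (a b M : R) :
  a <= b -> ex_CInt g a b -> (forall t, a <= t <= b -> Cmod (g t) <= M) ->
  Cmod (CInt g a b) <= 2 * M * (b - a).
Proof.
  intros Hab [H1 H2] HM.
  eapply Rle_trans; [apply Cmod_le_re_im|]. unfold CInt, Re, Im; simpl.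
  assert (B1 : Rabs (RInt (fun t => Re (g t)) a b) <= (b - a) * M).
  { apply abs_RInt_le_const; auto. intros t Ht.
    eapply Rle_trans; [apply re_le_Cmod|auto]. }
  assert (B2 : Rabs (RInt (fun t => Im (g t)) a b) <= (b - a) * M).
  { apply abs_RInt_le_const; auto. intros t Ht.
    eapply Rle_trans; [apply im_le_Cmod|auto]. }
  unfold Re, Im in B1, B2. lra.
Qed.

Lemma CInt_affine (u v : C) (a b : R) :
  CInt (fun t => u + v * t)%C a b
  = (u * (b - a) + v * ((b * b - a * a) / 2))%C.
Proof.
  assert (A : forall p q : R,
    RInt (fun t => p + q * t) a b = p * (b - a) + q * ((b * b - a * a) / 2)).
  { intros p q. apply is_RInt_unique.
    evar_last.
    - apply (is_RInt_derive (fun t => p * t + q * (t * t) / 2) (fun t => p + q * t)).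
      + intros x _. auto_derive; [trivial|field].
      + intros x _. apply (ex_derive_continuous (K := R_AbsRing) (V := R_NormedModule)).
        auto_derive. trivial.
    - unfold minus, plus, opp; simpl. field. }
  unfold CInt. destruct u as [u1 u2]. destruct v as [v1 v2].
  rewrite (RInt_ext (fun t => Re ((u1, u2) + (v1, v2) * t)%C) (fun t => u1 + v1 * t)).
  2:{ intros. simpl. ring. }
  rewrite (RInt_ext (fun t => Im ((u1, u2) + (v1, v2) * t)%C) (fun t => u2 + v2 * t)).
  2:{ intros. simpl. ring. }
  rewrite !A. unfold Cplus, Cmult, Cminus, Cdiv, Cinv, Copp, RtoC; simpl.
  f_equal; field.
Qed.

(** The counterclockwise boundary integral: [dz] is [dx] on the horizontal sides and [i dy] on the
    vertical ones. *)
Definition rect_int (F : C -> C) (a b c d : R) : C :=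
  (CInt (fun x => F (x, c)) a b - CInt (fun x => F (x, d)) a b
   + Ci * (CInt (fun y => F (b, y)) c d - CInt (fun y => F (a, y)) c d))%C.

Definition cont_rect (F : C -> C) (a b c d : R) : Prop :=
  forall x y, a <= x <= b -> c <= y <= d -> ccont F (x, y).

Lemma ex_CInt_h (F : C -> C) (a b c d x1 x2 y : R) :
  cont_rect F a b c d -> a <= x1 <= x2 -> x2 <= b -> c <= y <= d ->
  ex_CInt (fun x => F (x, y)) x1 x2.
Proof.
  intros H H1 H2 H3. apply ex_CInt_rcont; [lra|]. intros t Ht.
  apply (rcont_comp (fun x => (x, y))); [apply rcont_horizontal|]. apply H; lra.
Qed.

Lemma ex_CInt_v (F : C -> C) (a b c d y1 y2 x : R) :
  cont_rect F a b c d -> c <= y1 <= y2 -> y2 <= d -> a <= x <= b ->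
  ex_CInt (fun y => F (x, y)) y1 y2.
Proof.
  intros H H1 H2 H3. apply ex_CInt_rcont; [lra|]. intros t Ht.
  apply (rcont_comp (fun y => (x, y))); [apply rcont_vertical|]. apply H; lra.
Qed.

Lemma rect_int_split_v (F : C -> C) (a m b c d : R) :
  ex_CInt (fun x => F (x, c)) a m -> ex_CInt (fun x => F (x, c)) m b ->
  ex_CInt (fun x => F (x, d)) a m -> ex_CInt (fun x => F (x, d)) m b ->
  rect_int F a b c d = (rect_int F a m c d + rect_int F m b c d)%C.
Proof.
  intros H1 H2 H3 H4. unfold rect_int.
  rewrite <- (CInt_Chasles (fun x => F (x, c)) a m b) by auto.
  rewrite <- (CInt_Chasles (fun x => F (x, d)) a m b) by auto. ring.
Qed.

Lemma rect_int_split_h (F : C -> C) (a b c m d : R) :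
  ex_CInt (fun y => F (a, y)) c m -> ex_CInt (fun y => F (a, y)) m d ->
  ex_CInt (fun y => F (b, y)) c m -> ex_CInt (fun y => F (b, y)) m d ->
  rect_int F a b c d = (rect_int F a b c m + rect_int F a b m d)%C.
Proof.
  intros H1 H2 H3 H4. unfold rect_int.
  rewrite <- (CInt_Chasles (fun y => F (a, y)) c m d) by auto.
  rewrite <- (CInt_Chasles (fun y => F (b, y)) c m d) by auto. ring.
Qed.

Lemma rect_int_bound (F : C -> C) (a b c d M : R) :
  a <= b -> c <= d ->
  ex_CInt (fun x => F (x, c)) a b -> ex_CInt (fun x => F (x, d)) a b ->
  ex_CInt (fun y => F (a, y)) c d -> ex_CInt (fun y => F (b, y)) c d ->
  (forall x, a <= x <= b -> Cmod (F (x, c)) <= M /\ Cmod (F (x, d)) <= M) ->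
  (forall y, c <= y <= d -> Cmod (F (a, y)) <= M /\ Cmod (F (b, y)) <= M) ->
  Cmod (rect_int F a b c d) <= 4 * M * ((b - a) + (d - c)).
Proof.
  intros Hab Hcd E1 E2 E3 E4 Hh Hv. unfold rect_int, Cminus.
  eapply Rle_trans; [apply Cmod_triangle|]. rewrite Cmod_mult, Cmod_Ci, Rmult_1_l.
  eapply Rle_trans; [apply Rplus_le_compat; apply Cmod_triangle|].
  rewrite !Cmod_opp.
  pose proof (CInt_bound _ a b M Hab E1 (fun x Hx => proj1 (Hh x Hx))).
  pose proof (CInt_bound _ a b M Hab E2 (fun x Hx => proj2 (Hh x Hx))).
  pose proof (CInt_bound _ c d M Hcd E3 (fun x Hx => proj1 (Hv x Hx))).
  pose proof (CInt_bound _ c d M Hcd E4 (fun x Hx => proj2 (Hv x Hx))).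
  cbv beta in *. lra.
Qed.

Lemma rect_int_plus (F G : C -> C) (a b c d : R) :
  a <= b -> c <= d -> cont_rect F a b c d -> cont_rect G a b c d ->
  rect_int (fun s => F s + G s)%C a b c d = (rect_int F a b c d + rect_int G a b c d)%C.
Proof.
  intros Hab Hcd HF HG. unfold rect_int.
  rewrite (CInt_plus (fun x => F (x, c)) (fun x => G (x, c)));
    [|apply (ex_CInt_h F a b c d); auto; lra|apply (ex_CInt_h G a b c d); auto; lra].
  rewrite (CInt_plus (fun x => F (x, d)) (fun x => G (x, d)));
    [|apply (ex_CInt_h F a b c d); auto; lra|apply (ex_CInt_h G a b c d); auto; lra].
  rewrite (CInt_plus (fun y => F (a, y)) (fun y => G (a, y)));
    [|apply (ex_CInt_v F a b c d); auto; lra|apply (ex_CInt_v G a b c d); auto; lra].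
  rewrite (CInt_plus (fun y => F (b, y)) (fun y => G (b, y)));
    [|apply (ex_CInt_v F a b c d); auto; lra|apply (ex_CInt_v G a b c d); auto; lra].
  ring.
Qed.

Lemma rect_int_ext (F G : C -> C) (a b c d : R) :
  a <= b -> c <= d ->
  (forall x y, a <= x <= b -> c <= y <= d -> F (x, y) = G (x, y)) ->
  rect_int F a b c d = rect_int G a b c d.
Proof.
  intros Hab Hcd E. unfold rect_int.
  rewrite (CInt_ext (fun x => F (x, c)) (fun x => G (x, c))),
    (CInt_ext (fun x => F (x, d)) (fun x => G (x, d))),
    (CInt_ext (fun y => F (a, y)) (fun y => G (a, y))),
    (CInt_ext (fun y => F (b, y)) (fun y => G (b, y)));
    auto; intros; apply E; lra.
Qed.

(** Here the sides can be integrated explicitly, so that no theory of primitives along paths is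
    involved. *)
Lemma rect_int_affine (u v : C) (a b c d : R) :
  a <= b -> c <= d -> rect_int (fun s => u + v * s)%C a b c d = 0.
Proof.
  intros Hab Hcd. unfold rect_int.
  assert (H : forall y, CInt (fun x => u + v * (x, y))%C a b
                        = ((u + v * Ci * y) * (b - a) + v * ((b * b - a * a) / 2))%C).
  { intros y. rewrite <- CInt_affine. apply CInt_ext; [exact Hab|]. intros x _.
    replace ((x, y) : C) with (x + Ci * y)%C; [ring|].
    unfold Cplus, Cmult, Ci, RtoC; simpl. f_equal; ring. }
  assert (V : forall x, CInt (fun y => u + v * (x, y))%C c d
                        = ((u + v * x) * (d - c) + v * Ci * ((d * d - c * c) / 2))%C).
  { intros x. rewrite <- CInt_affine. apply CInt_ext; [exact Hcd|]. intros y _.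
    replace ((x, y) : C) with (x + Ci * y)%C; [ring|].
    unfold Cplus, Cmult, Ci, RtoC; simpl. f_equal; ring. }
  rewrite !H, !V.
  ring.
Qed.

(* Goursat's nested rectangles, for an arbitrary subadditive functional [K] of
   rectangles. *)
Lemma bisection (K : R -> R -> R -> R -> R) (a b c d : R) :
  a <= b -> c <= d ->
  (forall x h y k, 0 <= h -> 0 <= k -> a <= x -> x + 2 * h <= b -> c <= y -> y + 2 * k <= d ->
     K x (x + 2 * h) y (y + 2 * k) <=
       K x (x + h) y (y + k) + K (x + h) (x + 2 * h) y (y + k)
       + K x (x + h) (y + k) (y + 2 * k) + K (x + h) (x + 2 * h) (y + k) (y + 2 * k)) ->
  (forall p q, a <= p <= b -> c <= q <= d -> forall eps, 0 < eps -> exists delta, 0 < delta /\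
     forall x h y k, a <= x <= p -> p <= x + h <= b -> c <= y <= q -> q <= y + k <= d ->
       h + k < delta -> K x (x + h) y (y + k) <= eps * ((h + k) * (h + k))) ->
  K a b c d <= 0.
Proof.
  intros Hab Hcd Hsplit Hloc. apply Rnot_lt_le. intros HK.
  set (w := b - a). set (v := d - c). set (K0 := K a b c d) in *.
  set (hh := fun n : nat => w / 2 ^ n). set (kk := fun n : nat => v / 2 ^ n).
  assert (P2 : forall n : nat, 0 < 2 ^ n) by (intros; apply pow_lt; lra).
  assert (P4 : forall n : nat, 0 < 4 ^ n) by (intros; apply pow_lt; lra).
  assert (Hh : forall n, 0 <= hh n).
  { intros n. apply Rmult_le_pos; [unfold w; lra|]. apply Rlt_le, Rinv_0_lt_compat, P2. }
  assert (Hk : forall n, 0 <= kk n).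
  { intros n. apply Rmult_le_pos; [unfold v; lra|]. apply Rlt_le, Rinv_0_lt_compat, P2. }
  assert (Hh2 : forall n, hh n = 2 * hh (S n)).
  { intros n. unfold hh. simpl. field. apply Rgt_not_eq, P2. }
  assert (Hk2 : forall n, kk n = 2 * kk (S n)).
  { intros n. unfold kk. simpl. field. apply Rgt_not_eq, P2. }
  set (good := fun (n : nat) (s : R * R) =>
    a <= fst s /\ fst s + hh n <= b /\ c <= snd s /\ snd s + kk n <= d /\
    K0 / 4 ^ n <= K (fst s) (fst s + hh n) (snd s) (snd s + kk n)).
  (* By subadditivity one of the four quarters carries at least a quarter of the value. *)
  assert (Hstep : forall n s, good n s -> exists s', good (S n) s' /\
    fst s <= fst s' /\ fst s' + hh (S n) <= fst s + hh n /\
    snd s <= snd s' /\ snd s' + kk (S n) <= snd s + kk n).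
  { intros n [x y] (G1 & G2 & G3 & G4 & G5). simpl in *.
    pose proof (Hh (S n)) as h0. pose proof (Hk (S n)) as k0.
    pose proof (Hh2 n) as Eh. pose proof (Hk2 n) as Ek.
    rewrite Eh in G2, G5. rewrite Ek in G4, G5.
    pose proof (Hsplit x (hh (S n)) y (kk (S n)) h0 k0 G1 G2 G3 G4) as S4.
    assert (E4 : K0 / 4 ^ n = 4 * (K0 / 4 ^ S n)).
    { simpl. field. apply Rgt_not_eq, P4. }
    set (t := K0 / 4 ^ S n) in *. set (h := hh (S n)) in *. set (k := kk (S n)) in *.
    replace (x + 2 * h) with (x + h + h) in S4 by ring.
    replace (y + 2 * k) with (y + k + k) in S4 by ring.
    replace (x + 2 * h) with (x + h + h) in G5 by ring.
    replace (y + 2 * k) with (y + k + k) in G5 by ring.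
    destruct (Rle_dec t (K x (x + h) y (y + k))) as [?|N1].
    { exists (x, y). unfold good; cbn [fst snd]. fold t h k. repeat split; lra. }
    destruct (Rle_dec t (K (x + h) (x + h + h) y (y + k))) as [?|N2].
    { exists (x + h, y). unfold good; cbn [fst snd]. fold t h k. repeat split; lra. }
    destruct (Rle_dec t (K x (x + h) (y + k) (y + k + k))) as [?|N3].
    { exists (x, y + k). unfold good; cbn [fst snd]. fold t h k. repeat split; lra. }
    exists (x + h, y + k). unfold good; cbn [fst snd]. fold t h k. repeat split; lra. }
  set (next := fun n s => epsilon (inhabits (0, 0)) (fun s' => good (S n) s' /\
    fst s <= fst s' /\ fst s' + hh (S n) <= fst s + hh n /\
    snd s <= snd s' /\ snd s' + kk (S n) <= snd s + kk n)).
  set (seq := fix seq n := match n with O => (a, c) | S m => next m (seq m) end).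
  assert (Hgood : forall n, good n (seq n)).
  { induction n as [|n IH].
    - unfold good, hh, kk; simpl. fold K0.
      replace (a + w / 1) with b by (unfold w; field).
      replace (c + v / 1) with d by (unfold v; field). fold K0. lra.
    - simpl. apply (epsilon_spec (inhabits (0, 0)) _ (Hstep n (seq n) IH)). }
  assert (Hmono : forall n,
    fst (seq n) <= fst (seq (S n)) /\ fst (seq (S n)) + hh (S n) <= fst (seq n) + hh n /\
    snd (seq n) <= snd (seq (S n)) /\ snd (seq (S n)) + kk (S n) <= snd (seq n) + kk n).
  { intros n. simpl. apply (epsilon_spec (inhabits (0, 0)) _ (Hstep n (seq n) (Hgood n))). }
  assert (nested : forall (u e : nat -> R), (forall n, 0 <= e n) ->
    (forall n, u n <= u (S n)) -> (forall n, u (S n) + e (S n) <= u n + e n) ->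
    exists l, forall n, u n <= l <= u n + e n).
  { intros u e He Hu Hd.
    assert (U : forall n m, u n <= u (n + m)%nat).
    { intros n m. induction m as [|m IH]; [rewrite Nat.add_0_r; lra|].
      rewrite Nat.add_succ_r. specialize (Hu (n + m)%nat). lra. }
    assert (D : forall n m, u (n + m)%nat + e (n + m)%nat <= u n + e n).
    { intros n m. induction m as [|m IH]; [rewrite Nat.add_0_r; lra|].
      rewrite Nat.add_succ_r. specialize (Hd (n + m)%nat). lra. }
    assert (UD : forall n m, u n <= u m + e m).
    { intros n m. destruct (Nat.le_ge_cases n m) as [L|L].
      - replace m with (n + (m - n))%nat by lia. specialize (U n (m - n)%nat).
        specialize (He (n + (m - n))%nat). lra.
      - replace n with (m + (n - m))%nat by lia. specialize (D m (n - m)%nat).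
        specialize (He (m + (n - m))%nat). lra. }
    destruct (completeness (fun r => exists n, r = u n)) as [l [L1 L2]].
    - exists (u O + e O). intros r [n ->]. apply UD.
    - exists (u O). now exists O.
    - exists l. intros n. split; [apply L1; now exists n|].
      apply L2. intros r [m ->]. apply UD. }
  destruct (nested (fun n => fst (seq n)) hh) as [p Hp]; auto; try (intros; apply Hmono).
  destruct (nested (fun n => snd (seq n)) kk) as [q Hq]; auto; try (intros; apply Hmono).
  assert (Hpab : a <= p <= b).
  { destruct (Hgood O) as (G1 & G2 & _). specialize (Hp O). lra. }
  assert (Hqcd : c <= q <= d).
  { destruct (Hgood O) as (_ & _ & G3 & G4 & _). specialize (Hq O). lra. }
  set (L := w + v). assert (HL : 0 <= L) by (unfold L, w, v; lra).
  (* With [i = / 2 ^ n], the rectangle of stage [n] has value at least [K0 * i^2] and side lengths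
     adding up to [L * i]; this tolerance bounds its value by half of [K0 * i^2]. The [+ 1] covers
     [L = 0]. *)
  destruct (Hloc p q Hpab Hqcd (K0 / (2 * (L * L + 1)))) as [delta [Hdelta Hsmall]].
  { apply Rdiv_lt_0_compat; nra. }
  destruct (pow_lt_1_zero (/ 2)) with (y := delta / (L + 1)) as [n Hn].
  { rewrite Rabs_pos_eq; lra. }
  { apply Rdiv_lt_0_compat; lra. }
  specialize (Hn n (le_n n)). rewrite Rabs_pos_eq in Hn by (apply pow_le; lra).
  rewrite pow_inv in Hn.
  destruct (Hgood n) as (G1 & G2 & G3 & G4 & G5).
  assert (Elen : hh n + kk n = L * / 2 ^ n) by (unfold hh, kk, L; field; apply Rgt_not_eq, P2).
  assert (I2 : 0 < / 2 ^ n) by (apply Rinv_0_lt_compat, P2).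
  assert (Hlen : hh n + kk n < delta).
  { rewrite Elen. apply Rle_lt_trans with ((L + 1) * / 2 ^ n); [nra|].
    apply Rmult_lt_compat_l with (r := L + 1) in Hn; [|lra].
    replace ((L + 1) * (delta / (L + 1))) with delta in Hn by (field; lra).
    exact Hn. }
  assert (A := Hsmall (fst (seq n)) (hh n) (snd (seq n)) (kk n)).
  specialize (Hp n). specialize (Hq n). cbv beta in Hp, Hq.
  assert (A' := A (conj G1 (proj1 Hp)) (conj (proj2 Hp) G2) (conj G3 (proj1 Hq)) (conj (proj2 Hq) G4) Hlen).
  assert (E4 : / 4 ^ n = / 2 ^ n * / 2 ^ n).
  { replace 4 with (2 * 2) by ring. rewrite Rpow_mult_distr, Rinv_mult. ring. }
  rewrite Elen in A'. unfold Rdiv in G5. rewrite E4 in G5.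
  set (i := / 2 ^ n) in *.
  assert (B : K0 * (i * i) <= K0 / (2 * (L * L + 1)) * (L * i * (L * i))) by lra.
  replace (K0 / (2 * (L * L + 1)) * (L * i * (L * i)))
    with (K0 * (i * i) * ((L * L) / (2 * (L * L + 1)))) in B by (field; nra).
  assert (Q : (L * L) / (2 * (L * L + 1)) <= / 2).
  { apply Rmult_le_reg_r with (2 * (L * L + 1)); [nra|].
    unfold Rdiv. rewrite Rmult_assoc, Rinv_l by nra. nra. }
  assert (0 < K0 * (i * i)) by (apply Rmult_lt_0_compat; nra).
  nra.
Qed.

Lemma Goursat (F : C -> C) (a b c d : R) :
  a <= b -> c <= d ->
  (forall x y, a <= x <= b -> c <= y <= d -> cdiff F (x, y)) ->
  rect_int F a b c d = 0.
Proof.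
  intros Hab Hcd HF.
  assert (HC : cont_rect F a b c d) by (intros x y Hx Hy; apply cdiff_ccont, HF; auto).
  apply Cmod_eq_0. apply Rle_antisym; [|apply Cmod_ge_0].
  apply (bisection (fun a b c d => Cmod (rect_int F a b c d)) a b c d Hab Hcd).
  - intros x h y k Hh Hk H1 H2 H3 H4.
    rewrite (rect_int_split_h F x (x + 2 * h) y (y + k) (y + 2 * k)).
    2-5: apply (ex_CInt_v F a b c d); auto; lra.
    rewrite (rect_int_split_v F x (x + h) (x + 2 * h) y (y + k)).
    2-5: apply (ex_CInt_h F a b c d); auto; lra.
    rewrite (rect_int_split_v F x (x + h) (x + 2 * h) (y + k) (y + 2 * k)).
    2-5: apply (ex_CInt_h F a b c d); auto; lra.
    pose proof (Cmod_triangle (rect_int F x (x + h) y (y + k) + rect_int F (x + h) (x + 2 * h) y (y + k))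
      (rect_int F x (x + h) (y + k) (y + 2 * k) + rect_int F (x + h) (x + 2 * h) (y + k) (y + 2 * k))).
    pose proof (Cmod_triangle (rect_int F x (x + h) y (y + k)) (rect_int F (x + h) (x + 2 * h) y (y + k))).
    pose proof (Cmod_triangle (rect_int F x (x + h) (y + k) (y + 2 * k)) (rect_int F (x + h) (x + 2 * h) (y + k) (y + 2 * k))).
    lra.
  - intros p q Hp Hq eps Heps.
    destruct (HF p q Hp Hq) as [Q [EQ HQ]]. set (P := (p, q) : C) in *.
    destruct (HQ (eps / 4)) as [delta [Hdelta H]]; [lra|].
    exists delta. split; [exact Hdelta|]. intros x h y k Hx Hxh Hy Hyk Hlen.
    (* [A] is the tangent map at [P], with vanishing boundary integral. The remainder [G] is at most
       [eps / 4 * (h + k)] on the rectangle, and [rect_int_bound] contributes the factor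
       [4 * (h + k)]. *)
    set (A := fun s => ((F P - Q P * P) + Q P * s)%C).
    set (G := fun s => ((Q s - Q P) * (s - P))%C).
    assert (CA : forall s, ccont A s).
    { intros s. apply ccont_plus; [apply ccont_const|].
      apply ccont_mult; [apply ccont_const|apply ccont_id]. }
    assert (CG : cont_rect G x (x + h) y (y + k)).
    { intros x' y' Hx' Hy'. apply ccont_local with (f := fun s => (F s + - A s)%C) (r := 1); [lra| |].
      - intros s _. unfold A, G. rewrite (EQ s). ring.
      - apply ccont_plus; [apply HC; lra|]. apply ccont_opp, CA. }
    rewrite (rect_int_ext F (fun s => A s + G s)%C); [|lra|lra|].
    2:{ intros x' y' _ _. unfold A, G. rewrite (EQ (x', y')). ring. }
    rewrite rect_int_plus; [|lra|lra|intros ? ? _ _; apply CA|exact CG].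
    unfold A at 1. rewrite rect_int_affine by lra. rewrite Cplus_0_l.
    assert (BG : forall x' y', x <= x' <= x + h -> y <= y' <= y + k ->
      Cmod (G (x', y')) <= eps / 4 * (h + k)).
    { intros x' y' Hx' Hy'. unfold G. rewrite Cmod_mult.
      assert (D : Cmod ((x', y') - P)%C <= h + k).
      { eapply Rle_trans; [apply Cmod_le_re_im|].
        change (Rabs (x' - p) + Rabs (y' - q) <= h + k).
        assert (Rabs (x' - p) <= h) by (apply Rabs_le; lra).
        assert (Rabs (y' - q) <= k) by (apply Rabs_le; lra). lra. }
      apply Rmult_le_compat; try apply Cmod_ge_0; [|exact D].
      apply Rlt_le, H. lra. }
    eapply Rle_trans; [apply rect_int_bound with (M := eps / 4 * (h + k))|]; try lra.
    1-2: apply (ex_CInt_h G x (x + h) y (y + k)); auto; lra.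
    1-2: apply (ex_CInt_v G x (x + h) y (y + k)); auto; lra.
    + intros x' Hx'. split; apply BG; lra.
    + intros y' Hy'. split; apply BG; lra.
Qed.

(** * Integrals over circles *)

Lemma le_small (x y K e0 : R) :
  0 < e0 -> (forall e, 0 < e < e0 -> x <= y + K * e) -> x <= y.
Proof.
  intros H0 H. apply Rnot_lt_le. intros L.
  set (e := Rmin (e0 / 2) ((x - y) / (2 * (Rabs K + 1)))).
  pose proof (Rabs_pos K). pose proof (Rle_abs K).
  assert (He : 0 < e).
  { apply Rmin_pos; [lra|]. apply Rdiv_lt_0_compat; lra. }
  assert (e <= e0 / 2) by apply Rmin_l.
  assert (Hexy : e <= (x - y) / (2 * (Rabs K + 1))) by apply Rmin_r.
  specialize (H e). assert (A : x <= y + K * e) by (apply H; lra).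
  assert (B : K * e <= (Rabs K + 1) * e) by nra.
  assert (D : (Rabs K + 1) * e <= (x - y) / 2).
  { apply Rle_trans with ((Rabs K + 1) * ((x - y) / (2 * (Rabs K + 1)))); [nra|].
    apply Req_le. field. lra. }
  lra.
Qed.

Lemma small_eq_0 (z : C) (K e0 : R) :
  0 < e0 -> (forall e, 0 < e < e0 -> Cmod z <= K * e) -> z = 0.
Proof.
  intros H0 H. apply Cmod_eq_0. apply Rle_antisym; [|apply Cmod_ge_0].
  apply le_small with (K := K) (e0 := e0); [exact H0|].
  intros e He. rewrite Rplus_0_l. auto.
Qed.

(** Four rectangles around a square of side [2 e] centred at the puncture contribute [0] by
    [Goursat]; the boundary of the square avoids the puncture and contributes at most [16 M e]. *)
Lemma Goursat_punctured (F : C -> C) (a b c d px py delta M : R) :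
  a < px < b -> c < py < d -> 0 < delta ->
  (forall x y, a <= x <= b -> c <= y <= d -> (x, y) <> (px, py) -> cdiff F (x, y)) ->
  (forall x y, a <= x <= b -> c <= y <= d -> (x, y) <> (px, py) ->
     Rabs (x - px) + Rabs (y - py) < delta -> Cmod (F (x, y)) <= M) ->
  rect_int F a b c d = 0.
Proof.
  intros Hp Hq Hdelta HF HM.
  set (e0 := Rmin (Rmin (px - a) (b - px)) (Rmin (Rmin (py - c) (d - py)) (delta / 2))).
  assert (He0 : 0 < e0) by (unfold e0; repeat apply Rmin_pos; lra).
  assert (He1 : e0 <= px - a /\ e0 <= b - px /\ e0 <= py - c /\ e0 <= d - py /\ e0 <= delta / 2).
  { unfold e0. repeat split.
    - eapply Rle_trans; apply Rmin_l.
    - eapply Rle_trans; [apply Rmin_l|apply Rmin_r].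
    - eapply Rle_trans; [apply Rmin_r|]. eapply Rle_trans; apply Rmin_l.
    - eapply Rle_trans; [apply Rmin_r|]. eapply Rle_trans; [apply Rmin_l|apply Rmin_r].
    - eapply Rle_trans; [apply Rmin_r|apply Rmin_r]. }
  apply small_eq_0 with (K := 16 * M) (e0 := e0); [exact He0|]. intros e He.
  assert (Ex : forall y x1 x2, y <> py -> c <= y <= d -> a <= x1 <= x2 -> x2 <= b ->
            ex_CInt (fun x => F (x, y)) x1 x2).
  { intros y x1 x2 Hy Hy' H1 H2. apply ex_CInt_rcont; [lra|]. intros t Ht.
    apply (rcont_comp (fun x => (x, y))); [apply rcont_horizontal|].
    apply cdiff_ccont, HF; try lra. intros E. now inversion E. }
  assert (Ey : forall x y1 y2, x <> px -> a <= x <= b -> c <= y1 <= y2 -> y2 <= d ->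
            ex_CInt (fun y => F (x, y)) y1 y2).
  { intros x y1 y2 Hx Hx' H1 H2. apply ex_CInt_rcont; [lra|]. intros t Ht.
    apply (rcont_comp (fun y => (x, y))); [apply rcont_vertical|].
    apply cdiff_ccont, HF; try lra. intros E. now inversion E. }
  rewrite (rect_int_split_v F a (px - e) b c d) by (apply Ex; lra).
  rewrite (rect_int_split_v F (px - e) (px + e) b c d) by (apply Ex; lra).
  rewrite (rect_int_split_h F (px - e) (px + e) c (py - e) d) by (apply Ey; lra).
  rewrite (rect_int_split_h F (px - e) (px + e) (py - e) (py + e) d) by (apply Ey; lra).
  assert (Z : forall x y, x <> px \/ y <> py -> (x, y) <> (px, py)).
  { intros x y H E. inversion E. tauto. }
  rewrite (Goursat F a (px - e)) by (try lra; intros; apply HF; try lra; apply Z; lra).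
  rewrite (Goursat F (px + e) b) by (try lra; intros; apply HF; try lra; apply Z; lra).
  rewrite (Goursat F (px - e) (px + e) c (py - e)) by (try lra; intros; apply HF; try lra; apply Z; lra).
  rewrite (Goursat F (px - e) (px + e) (py + e) d) by (try lra; intros; apply HF; try lra; apply Z; lra).
  rewrite !Cplus_0_l, !Cplus_0_r.
  eapply Rle_trans.
  - apply rect_int_bound with (M := M); [lra|lra|apply Ex; lra|apply Ex; lra
                                        |apply Ey; lra|apply Ey; lra| |].
    + intros x Hx. split; apply HM; try lra; try (apply Z; lra);
        assert (Rabs (x - px) <= e) by (apply Rabs_le; lra);
        (assert (Rabs (py - e - py) <= e) by (apply Rabs_le; lra));
        (assert (Rabs (py + e - py) <= e) by (apply Rabs_le; lra)); lra.
    + intros y Hy. split; apply HM; try lra; try (apply Z; lra);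
        assert (Rabs (y - py) <= e) by (apply Rabs_le; lra);
        (assert (Rabs (px - e - px) <= e) by (apply Rabs_le; lra));
        (assert (Rabs (px + e - px) <= e) by (apply Rabs_le; lra)); lra.
  - apply Req_le. ring.
Qed.

(** * The complex exponential and polar coordinates *)

Definition cexp (s : C) : C := (exp (Re s) * cos (Im s), exp (Re s) * sin (Im s)).

Lemma cexp_plus (s p : C) : cexp (s + p)%C = (cexp s * cexp p)%C.
Proof.
  unfold cexp. rewrite re_plus, im_plus, exp_plus, cos_plus, sin_plus.
  unfold Cmult; simpl. f_equal; ring.
Qed.

Lemma derivable_at_0 (f : R -> R) (l : R) :
  derivable_pt_lim f 0 l -> forall eps, 0 < eps -> exists d, 0 < d /\
    forall h, Rabs h < d -> Rabs (f h - f 0 - l * h) <= eps * Rabs h.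
Proof.
  intros H eps He. destruct (H eps He) as [d Hd]. exists d. split; [apply cond_pos|].
  intros h Hh. destruct (Req_dec h 0) as [->|N].
  - replace (f 0 - f 0 - l * 0) with 0 by ring. rewrite Rabs_R0. lra.
  - specialize (Hd h N Hh). rewrite Rplus_0_l in Hd.
    replace (f h - f 0 - l * h) with (((f h - f 0) / h - l) * h) by (field; auto).
    rewrite Rabs_mult. apply Rmult_le_compat_r; [apply Rabs_pos|lra].
Qed.

Lemma cdiff_cexp_0 : cdiff cexp 0.
Proof.
  apply cdiff_of_approx with (D := RtoC 1). intros eps Heps.
  (* The error is at most [4 e |z|] in the real part and [5 e |z|] in the imaginary part. *)
  set (e := Rmin 1 (eps / 9)). assert (He : 0 < e) by (apply Rmin_pos; lra).
  assert (He1 : e <= 1) by apply Rmin_l. assert (He9 : e <= eps / 9) by apply Rmin_r.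
  destruct (derivable_at_0 exp 1) with (eps := e) as [d1 [Hd1 H1]]; [|exact He|].
  { rewrite <- exp_0. apply derivable_pt_lim_exp. }
  destruct (derivable_at_0 sin 1) with (eps := e) as [d2 [Hd2 H2]]; [|exact He|].
  { rewrite <- cos_0. apply derivable_pt_lim_sin. }
  destruct (derivable_at_0 cos 0) with (eps := e) as [d3 [Hd3 H3]]; [|exact He|].
  { replace 0 with (- sin 0) at 2 by (rewrite sin_0; ring). apply derivable_pt_lim_cos. }
  exists (Rmin (Rmin d1 d2) (Rmin d3 (Rmin e 1))).
  split; [repeat apply Rmin_pos; lra|].
  intros z Hz. replace (z - 0)%C with z in * by ring. destruct z as [x t].
  assert (Hx : Rabs x <= Cmod (x, t)) by apply (re_le_Cmod (x, t)).
  assert (Ht : Rabs t <= Cmod (x, t)) by apply (im_le_Cmod (x, t)).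
  set (m := Cmod (x, t)) in *.
  assert (B : m < d1 /\ m < d2 /\ m < d3 /\ m < e /\ m < 1).
  { repeat split; eapply Rlt_le_trans; try exact Hz.
    - eapply Rle_trans; apply Rmin_l.
    - eapply Rle_trans; [apply Rmin_l|apply Rmin_r].
    - eapply Rle_trans; [apply Rmin_r|apply Rmin_l].
    - eapply Rle_trans; [apply Rmin_r|]. eapply Rle_trans; [apply Rmin_r|apply Rmin_l].
    - eapply Rle_trans; [apply Rmin_r|]. eapply Rle_trans; [apply Rmin_r|apply Rmin_r]. }
  specialize (H1 x). specialize (H2 t). specialize (H3 t).
  rewrite exp_0 in H1. rewrite sin_0 in H2. rewrite cos_0 in H3.
  assert (A1 : Rabs (exp x - 1 - 1 * x) <= e * Rabs x) by (apply H1; lra).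
  assert (A2 : Rabs (sin t - 0 - 1 * t) <= e * Rabs t) by (apply H2; lra).
  assert (A3 : Rabs (cos t - 1 - 0 * t) <= e * Rabs t) by (apply H3; lra).
  assert (E3 : 0 < exp x <= 3).
  { split; [apply exp_pos|]. apply Rle_trans with (exp 1); [|apply exp_le_3].
    destruct (Rle_lt_or_eq_dec x 1) as [L|L].
    - apply Rle_trans with (Rabs x); [apply Rle_abs|lra].
    - now apply Rlt_le, exp_increasing.
    - rewrite L; lra. }
  eapply Rle_trans; [apply Cmod_le_re_im|].
  replace (Re (cexp (x, t) - cexp 0 - 1 * (x, t))%C)
    with ((exp x - 1 - 1 * x) + exp x * (cos t - 1 - 0 * t)).
  2:{ unfold cexp, Cminus, Cplus, Copp, Cmult, RtoC; simpl. rewrite exp_0, cos_0. ring. }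
  replace (Im (cexp (x, t) - cexp 0 - 1 * (x, t))%C)
    with (exp x * (sin t - 0 - 1 * t) + ((exp x - 1 - 1 * x) + x) * t).
  2:{ unfold cexp, Cminus, Cplus, Copp, Cmult, RtoC; simpl. rewrite exp_0, sin_0. ring. }
  pose proof (Rabs_pos x). pose proof (Rabs_pos t).
  assert (D1 : Rabs ((exp x - 1 - 1 * x) + exp x * (cos t - 1 - 0 * t)) <= e * m + 3 * (e * m)).
  { eapply Rle_trans; [apply Rabs_triang|]. rewrite Rabs_mult, (Rabs_pos_eq (exp x)) by lra.
    pose proof (Rabs_pos (cos t - 1 - 0 * t)). apply Rplus_le_compat; [nra|].
    apply Rmult_le_compat; try lra. nra. }
  assert (D2 : Rabs (exp x * (sin t - 0 - 1 * t) + ((exp x - 1 - 1 * x) + x) * t)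
               <= 3 * (e * m) + 2 * e * m).
  { eapply Rle_trans; [apply Rabs_triang|]. rewrite !Rabs_mult, (Rabs_pos_eq (exp x)) by lra.
    pose proof (Rabs_pos (sin t - 0 - 1 * t)). apply Rplus_le_compat.
    - apply Rmult_le_compat; try lra. nra.
    - apply Rmult_le_compat; try apply Rabs_pos; [|lra].
      eapply Rle_trans; [apply Rabs_triang|]. nra. }
  assert (0 <= m) by apply Cmod_ge_0. nra.
Qed.

Lemma cdiff_cexp (p : C) : cdiff cexp p.
Proof.
  apply cdiff_local with (f := fun s => (cexp p * cexp (s - p))%C) (r := 1); [lra| |].
  - intros s _. rewrite <- cexp_plus. f_equal. ring.
  - apply cdiff_mult; [apply cdiff_const|].
    apply cdiff_comp with (f := fun s => (s - p)%C).
    + apply cdiff_minus; [apply cdiff_id|apply cdiff_const].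
    + replace (p - p)%C with (RtoC 0) by ring. apply cdiff_cexp_0.
Qed.

Definition circ (r t : R) : C := (r * cos t, r * sin t).

Lemma circ_cexp (r t : R) : 0 < r -> circ r t = cexp (ln r, t).
Proof. intros H. unfold circ, cexp; simpl. now rewrite exp_ln. Qed.

Lemma Cmod_circ (r t : R) : 0 <= r -> Cmod (circ r t) = r.
Proof.
  intros H. unfold Cmod, circ; simpl.
  pose proof (sin2_cos2 t) as E. unfold Rsqr in E.
  replace (r * cos t * (r * cos t * 1) + r * sin t * (r * sin t * 1))
    with ((r * r) * (sin t * sin t + cos t * cos t)) by ring.
  rewrite E, Rmult_1_r. now apply sqrt_square.
Qed.

Lemma circ_periodic (r t : R) : circ r (t + 2 * PI) = circ r t.
Proof.
  unfold circ. rewrite (cos_plus t), (sin_plus t), cos_2PI, sin_2PI. f_equal; ring.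
Qed.

Lemma rcont_circ (r t : R) : 0 < r -> rcont (circ r) t.
Proof.
  intros Hr.
  assert (H : rcont (fun u => cexp (ln r, u)) t).
  { apply (rcont_comp (fun u => (ln r, u))); [apply rcont_vertical|].
    apply cdiff_ccont, cdiff_cexp. }
  intros e He. destruct (H e He) as [d [Hd H']]. exists d. split; [exact Hd|].
  intros u Hu. rewrite !circ_cexp by exact Hr. auto.
Qed.

Lemma polar (z : C) : exists a, - PI <= a <= PI /\ z = circ (Cmod z) a.
Proof.
  destruct (Req_dec (Cmod z) 0) as [E|N].
  { exists 0. pose proof PI_RGT_0. split; [lra|].
    rewrite E, (Cmod_eq_0 z E). unfold circ, RtoC. f_equal; ring. }
  assert (P : 0 < Cmod z) by (pose proof (Cmod_ge_0 z); lra).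
  pose proof (Cmod2_alt z) as E2. set (m := Cmod z) in *. destruct z as [x y]; simpl in E2.
  assert (X : -1 <= x / m <= 1).
  { assert (- m <= x <= m) by nra. split.
    - apply Rmult_le_reg_r with m; [exact P|]. unfold Rdiv. rewrite Rmult_assoc, Rinv_l; lra.
    - apply Rmult_le_reg_r with m; [exact P|]. unfold Rdiv. rewrite Rmult_assoc, Rinv_l; lra. }
  assert (S : 1 - Rsqr (x / m) = Rsqr (y / m)).
  { unfold Rsqr. apply Rmult_eq_reg_r with (m * m); [|nra].
    replace ((1 - x / m * (x / m)) * (m * m)) with (m * m - x * x) by (field; lra).
    replace (y / m * (y / m) * (m * m)) with (y * y) by (field; lra). lra. }
  destruct (Rle_dec 0 y) as [Y|Y].
  - exists (acos (x / m)). pose proof (acos_bound (x / m)). split; [lra|]. unfold circ. rewrite cos_acos, sin_acos, S by exact X.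
    rewrite sqrt_Rsqr. 2:{ apply Rmult_le_pos; [exact Y|]. now apply Rlt_le, Rinv_0_lt_compat. }
    f_equal; field; lra.
  - exists (- acos (x / m)). pose proof (acos_bound (x / m)). split; [lra|]. unfold circ. rewrite cos_neg, sin_neg, cos_acos, sin_acos, S by exact X.
    rewrite Rsqr_neg, sqrt_Rsqr.
    2:{ replace (- (y / m)) with ((- y) * / m) by (unfold Rdiv; ring).
        apply Rmult_le_pos; [lra|]. now apply Rlt_le, Rinv_0_lt_compat. }
    f_equal; field; lra.
Qed.

Lemma cos_eq_1_small (u : R) : - PI <= u <= PI -> cos u = 1 -> u = 0.
Proof.
  intros Hu E. pose proof PI_RGT_0.
  replace u with (2 * (u / 2)) in E by field. rewrite cos_2a_sin in E.
  assert (S : sin (u / 2) = 0) by nra.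
  destruct (Rtotal_order u 0) as [L|[L|L]]; [|exact L|].
  - assert (0 < sin (- (u / 2))) by (apply sin_gt_0; lra). rewrite sin_neg in *. lra.
  - assert (0 < sin (u / 2)) by (apply sin_gt_0; lra). lra.
Qed.

(** The closed range of angles matters: in the logarithmic rectangle around a puncture both
    horizontal sides have angle exactly [PI] away from it. *)
Lemma circ_inj (r t r' a : R) :
  0 < r -> 0 < r' -> - PI <= t - a <= PI -> circ r t = circ r' a -> r = r' /\ t = a.
Proof.
  intros Hr Hr' Ha E.
  assert (Er : r = r').
  { rewrite <- (Cmod_circ r t), <- (Cmod_circ r' a) by lra. now rewrite E. }
  split; [exact Er|]. subst r'. unfold circ in E. inversion E as [[E1 E2]].
  apply Rmult_eq_reg_l in E1; [|lra]. apply Rmult_eq_reg_l in E2; [|lra].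
  assert (t - a = 0); [|lra]. apply cos_eq_1_small; [exact Ha|].
  rewrite cos_minus, E1, E2. pose proof (sin2_cos2 a) as S. unfold Rsqr in S. lra.
Qed.

(** The integral with respect to the angle, that is, the contour integral of [f w / (i w)]. In this
    normalisation Cauchy's kernel becomes [w / (w - z)]. *)
Definition circ_int (f : C -> C) (r : R) : C := CInt (fun t => f (circ r t)) 0 (2 * PI).

Definition cont_circ (f : C -> C) (r : R) : Prop := forall z, Cmod z = r -> ccont f z.

Lemma rcont_on_circ (f : C -> C) (r t : R) :
  0 < r -> cont_circ f r -> rcont (fun t => f (circ r t)) t.
Proof.
  intros Hr Hf. apply rcont_comp with (s := circ r); [now apply rcont_circ|].
  apply Hf, Cmod_circ. lra.
Qed.

Lemma ex_CInt_circ (f : C -> C) (r a b : R) :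
  0 < r -> cont_circ f r -> ex_CInt (fun t => f (circ r t)) a b.
Proof.
  intros Hr Hf. split; apply (ex_RInt_continuous (V := R_CompleteNormedModule));
    intros t _; apply (rcont_continuous _ t (rcont_on_circ f r t Hr Hf)).
Qed.

Lemma RInt_shift (g : R -> R) (a b u : R) :
  ex_RInt g (a + u) (b + u) -> RInt (fun t => g (t + u)) a b = RInt g (a + u) (b + u).
Proof.
  intros H. apply is_RInt_unique.
  apply is_RInt_ext with (f := fun y => scal 1 (g (1 * y + u))).
  - intros x _. unfold scal; simpl; unfold mult; simpl. now rewrite !Rmult_1_l.
  - apply (is_RInt_comp_lin (V := R_NormedModule)). rewrite !Rmult_1_l.
    now apply (RInt_correct (V := R_CompleteNormedModule)).
Qed.

Lemma CInt_shift (g : R -> C) (a b u : R) :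
  ex_CInt g (a + u) (b + u) -> CInt (fun t => g (t + u)) a b = CInt g (a + u) (b + u).
Proof.
  intros [H1 H2]. unfold CInt. f_equal.
  - now apply (RInt_shift (fun t => Re (g t))).
  - now apply (RInt_shift (fun t => Im (g t))).
Qed.

Lemma circ_int_shift (f : C -> C) (r a : R) :
  0 < r -> cont_circ f r ->
  CInt (fun t => f (circ r t)) a (a + 2 * PI) = circ_int f r.
Proof.
  intros Hr Hf. assert (E := fun u v => ex_CInt_circ f r u v Hr Hf). unfold circ_int.
  set (g := fun t => f (circ r t)) in *.
  rewrite <- (CInt_Chasles g a 0 (a + 2 * PI)) by apply E.
  rewrite <- (CInt_Chasles g 0 (2 * PI) (a + 2 * PI)) by apply E.
  replace (CInt g (2 * PI) (a + 2 * PI)) with (CInt g 0 a).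
  - replace (CInt g a 0 + (CInt g 0 (2 * PI) + CInt g 0 a))%C
      with ((CInt g a 0 + CInt g 0 a) + CInt g 0 (2 * PI))%C by ring.
    rewrite (CInt_Chasles g a 0 a) by apply E.
    unfold CInt at 1. rewrite !RInt_point. apply Cplus_0_l.
  - replace (2 * PI) with (0 + 2 * PI) at 1 by ring. rewrite <- CInt_shift by apply E.
    unfold CInt, g. f_equal; apply RInt_ext; intros t _; now rewrite circ_periodic.
Qed.

Lemma circ_int_bound (f : C -> C) (r M : R) :
  0 < r -> cont_circ f r -> (forall z, Cmod z = r -> Cmod (f z) <= M) ->
  Cmod (circ_int f r) <= 4 * PI * M.
Proof.
  intros Hr Hf HM. pose proof PI_RGT_0.
  eapply Rle_trans; [apply CInt_bound with (M := M)|].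
  - lra.
  - now apply ex_CInt_circ.
  - intros t _. apply HM, Cmod_circ. lra.
  - apply Req_le. ring.
Qed.

Lemma circ_int_ext (f g : C -> C) (r : R) :
  0 < r -> (forall z, Cmod z = r -> f z = g z) -> circ_int f r = circ_int g r.
Proof.
  intros Hr E. pose proof PI_RGT_0. apply CInt_ext; [lra|]. intros t _.
  apply E, Cmod_circ. lra.
Qed.

Lemma circ_int_plus (f g : C -> C) (r : R) :
  0 < r -> cont_circ f r -> cont_circ g r ->
  circ_int (fun z => f z + g z)%C r = (circ_int f r + circ_int g r)%C.
Proof.
  intros Hr Hf Hg. unfold circ_int.
  apply (CInt_plus (fun t => f (circ r t)) (fun t => g (circ r t)));
    now apply ex_CInt_circ.
Qed.

Lemma circ_int_scal (k : C) (f : C -> C) (r : R) :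
  0 < r -> cont_circ f r -> circ_int (fun z => k * f z)%C r = (k * circ_int f r)%C.
Proof.
  intros Hr Hf. unfold circ_int.
  apply (CInt_scal k (fun t => f (circ r t))). now apply ex_CInt_circ.
Qed.

Lemma circ_int_const (k : C) (r : R) : circ_int (fun _ => k) r = (k * (2 * PI))%C.
Proof.
  unfold circ_int. rewrite CInt_const. rewrite <- RtoC_mult. ring.
Qed.

Lemma ln_le (x y : R) : 0 < x -> x <= y -> ln x <= ln y.
Proof. intros H [L| ->]; [left; now apply ln_increasing|right; reflexivity]. Qed.

(* [f] is pulled back by [exp] to a rectangle of width [2 PI], whose horizontal
   sides contribute opposite amounts. *)
Lemma circ_int_of_rect (f : C -> C) (r1 r2 a : R) :
  0 < r1 -> 0 < r2 ->
  rect_int (fun s => f (cexp s)) (ln r1) (ln r2) a (a + 2 * PI) = 0 ->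
  CInt (fun t => f (circ r1 t)) a (a + 2 * PI) = CInt (fun t => f (circ r2 t)) a (a + 2 * PI).
Proof.
  intros H1 H2 E. pose proof PI_RGT_0. unfold rect_int in E.
  assert (Eh : forall x, cexp (x, a + 2 * PI) = cexp (x, a)).
  { intros x. rewrite <- (ln_exp x), <- !circ_cexp by apply exp_pos. apply circ_periodic. }
  rewrite (CInt_ext (fun y => f (cexp (ln r1, y))) (fun t => f (circ r1 t))) in E.
  2: lra. 2:{ intros; now rewrite circ_cexp. }
  rewrite (CInt_ext (fun y => f (cexp (ln r2, y))) (fun t => f (circ r2 t))) in E.
  2: lra. 2:{ intros; now rewrite circ_cexp. }
  assert (Eh2 : CInt (fun x => f (cexp (x, a + 2 * PI))) (ln r1) (ln r2)
              = CInt (fun x => f (cexp (x, a))) (ln r1) (ln r2)).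
  { unfold CInt. f_equal; apply RInt_ext; intros t _; now rewrite Eh. }
  rewrite Eh2 in E. symmetry. apply Cminus_eq_0.
  set (d := (CInt (fun t => f (circ r2 t)) a (a + 2 * PI)
             - CInt (fun t => f (circ r1 t)) a (a + 2 * PI))%C) in *.
  replace d with (- Ci * (Ci * d))%C.
  - replace (Ci * d)%C with (RtoC 0); [ring|]. rewrite <- E. ring.
  - destruct d as [x y]. unfold Ci, Cmult, Copp; simpl. f_equal; ring.
Qed.

Lemma circ_int_annulus (f : C -> C) (r1 r2 : R) :
  0 < r1 <= r2 -> (forall z, r1 <= Cmod z <= r2 -> cdiff f z) ->
  circ_int f r1 = circ_int f r2.
Proof.
  intros Hr Hf. pose proof PI_RGT_0. unfold circ_int.
  rewrite <- (Rplus_0_l (2 * PI)). apply circ_int_of_rect; [lra|lra|].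
  apply Goursat; [apply ln_le; lra|lra|]. intros x y Hx Hy.
  apply cdiff_comp; [apply cdiff_cexp|]. apply Hf.
  rewrite <- (ln_exp x), <- circ_cexp, Cmod_circ by (try apply Rlt_le; apply exp_pos).
  split.
  - rewrite <- (exp_ln r1) by lra.
    destruct (proj1 Hx) as [L| <-]; [left; now apply exp_increasing|lra].
  - rewrite <- (exp_ln r2) by lra.
    destruct (proj2 Hx) as [L| ->]; [left; now apply exp_increasing|lra].
Qed.

(** In logarithmic coordinates [p] has a single preimage in a suitably placed rectangle of height
    [2 PI], to which [Goursat_punctured] applies. *)
Lemma circ_int_annulus_punctured (f : C -> C) (r1 r2 delta M : R) (p : C) :
  0 < r1 < Cmod p -> Cmod p < r2 -> 0 < delta ->
  (forall z, r1 <= Cmod z <= r2 -> z <> p -> cdiff f z) ->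
  (forall z, z <> p -> Cmod (z - p)%C < delta -> Cmod (f z) <= M) ->
  circ_int f r1 = circ_int f r2.
Proof.
  intros Hr1 Hr2 Hdelta Hf HM. pose proof PI_RGT_0.
  destruct (polar p) as [al [_ Ep]]. set (rho := Cmod p) in *.
  assert (Cf : forall r, r1 <= r <= r2 -> r <> rho -> cont_circ f r).
  { intros r Hr N z Hz. apply cdiff_ccont, Hf; [lra|]. intros ->. now apply N. }
  (* Starting the angle at [al - PI] puts the preimage of [p] halfway up the rectangle, away from
     the seam. *)
  rewrite <- (circ_int_shift f r1 (al - PI)), <- (circ_int_shift f r2 (al - PI)).
  2,4: lra. 2,3: apply Cf; lra.
  apply circ_int_of_rect; [lra|lra|].
  assert (Hneq : forall x y, al - PI <= y <= al - PI + 2 * PI ->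
            (x, y) <> (ln rho, al) -> cexp (x, y) <> p).
  { intros x y Hy N E. apply N. rewrite Ep in E.
    rewrite <- (ln_exp x), <- circ_cexp in E by apply exp_pos.
    apply circ_inj in E; [|apply exp_pos|lra|lra].
    destruct E as [E ->]. now rewrite <- E, ln_exp. }
  destruct (cdiff_ccont _ _ (cdiff_cexp (ln rho, al)) delta Hdelta) as [d [Hd Hc]].
  rewrite <- circ_cexp, <- Ep in Hc by lra.
  apply Goursat_punctured with (px := ln rho) (py := al) (delta := d) (M := M).
  - split; apply ln_increasing; lra.
  - lra.
  - exact Hd.
  - intros x y Hx Hy N. apply cdiff_comp; [apply cdiff_cexp|]. apply Hf; [|now apply Hneq].
    rewrite <- (ln_exp x), <- circ_cexp, Cmod_circ by (try apply Rlt_le; apply exp_pos).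
    split.
    + rewrite <- (exp_ln r1) by lra.
      destruct (proj1 Hx) as [L| <-]; [left; now apply exp_increasing|lra].
    + rewrite <- (exp_ln r2) by lra.
      destruct (proj2 Hx) as [L| ->]; [left; now apply exp_increasing|lra].
  - intros x y Hx Hy N Hs. apply HM; [now apply Hneq|]. apply Hc.
    eapply Rle_lt_trans; [apply Cmod_le_re_im|]. exact Hs.
Qed.

(** * Cauchy's formula and Schwarz's lemma *)

Lemma bounded_quotient (f : C -> C) (a : C) :
  cdiff f a -> exists d K, 0 < d /\ forall z, z <> a -> Cmod (z - a)%C < d ->
    Cmod ((f z - f a) / (z - a))%C <= K.
Proof.
  intros [q [E Hq]]. destruct (Hq 1 Rlt_0_1) as [d [Hd H]].
  exists d, (Cmod (q a) + 1). split; [exact Hd|]. intros z N Hz.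
  rewrite (E z). replace ((f a + q z * (z - a) - f a) / (z - a))%C with (q z).
  - specialize (H z Hz). pose proof (Cmod_rev_triangle (q z) (q a)). lra.
  - field. now apply Cminus_neq_0.
Qed.

Lemma ccont_bounded (f : C -> C) (a : C) :
  ccont f a -> exists d, 0 < d /\ forall z, Cmod (z - a)%C < d -> Cmod (f z) <= Cmod (f a) + 1.
Proof.
  intros H. destruct (H 1 Rlt_0_1) as [d [Hd H']]. exists d. split; [exact Hd|].
  intros z Hz. specialize (H' z Hz). pose proof (Cmod_rev_triangle (f z) (f a)). lra.
Qed.

Lemma Cmod_lt_neq (w z : C) : Cmod z < Cmod w -> (w - z)%C <> 0.
Proof. intros H. apply Cminus_neq_0. intros ->. lra. Qed.

Lemma Cmod_pos_neq (w : C) : 0 < Cmod w -> w <> 0.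
Proof. intros H. now apply Cmod_gt_0. Qed.

(** The kernel is [1 + z / (w - z)]; the integral of the second term does not depend on the radius
    and decays as the radius grows. *)
Lemma cauchy_kernel_integral (r : R) (z : C) :
  Cmod z < r -> circ_int (fun w => w / (w - z))%C r = (2 * PI)%C.
Proof.
  intros Hz. pose proof (Cmod_ge_0 z). pose proof PI_RGT_0.
  assert (D : forall w, Cmod z < Cmod w -> cdiff (fun w => z / (w - z))%C w).
  { intros w Hw. apply cdiff_div.
    - now apply Cmod_lt_neq.
    - apply cdiff_const.
    - apply cdiff_minus; [apply cdiff_id|apply cdiff_const]. }
  rewrite (circ_int_ext _ (fun w => 1 + z / (w - z))%C); [|lra|].
  2:{ intros w Hw. field. apply Cmod_lt_neq. lra. }
  rewrite circ_int_plus; [|lra|intros ? _; apply ccont_const|].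
  2:{ intros w Hw. apply cdiff_ccont, D. lra. }
  rewrite circ_int_const.
  replace (circ_int (fun w => z / (w - z))%C r) with (RtoC 0); [ring|].
  symmetry. apply small_eq_0 with (K := 4 * PI * Cmod z) (e0 := / (r - Cmod z)).
  { apply Rinv_0_lt_compat. lra. }
  intros e He. set (s := Cmod z + / e).
  assert (Is : r - Cmod z < / e).
  { rewrite <- (Rinv_inv (r - Cmod z)). apply Rinv_lt_contravar; [|lra].
    apply Rmult_lt_0_compat; [lra|]. apply Rinv_0_lt_compat; lra. }
  rewrite (circ_int_annulus _ r s).
  - replace (4 * PI * Cmod z * e) with (4 * PI * (Cmod z * e)) by ring.
    apply circ_int_bound.
    + unfold s; lra.
    + intros w Hw. apply cdiff_ccont, D. unfold s in Hw; lra.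
    + intros w Hw. rewrite Cmod_div by (apply Cmod_lt_neq; unfold s in Hw; lra).
      pose proof (Cmod_rev_triangle w z) as T. rewrite Hw in T. unfold s in T.
      apply Rmult_le_compat_l; [lra|]. rewrite <- (Rinv_inv e).
      apply Rinv_le_contravar; lra.
  - unfold s; lra.
  - intros w Hw. apply D. lra.
Qed.

(* The integrals of [w (f w - f z) / (w - z)] over concentric circles agree and
   tend to [0] with the radius. *)
Lemma cauchy_formula (f : C -> C) (r0 r : R) (z : C) :
  (forall w, Cmod w < r0 -> cdiff f w) -> Cmod z < r -> r < r0 ->
  circ_int (fun w => f w * (w / (w - z)))%C r = (f z * (2 * PI))%C.
Proof.
  intros Hf Hz Hr. pose proof (Cmod_ge_0 z). pose proof PI_RGT_0.
  set (Q := fun w => ((f w - f z) / (w - z))%C).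
  assert (DQ : forall w, Cmod w < r0 -> w <> z -> cdiff Q w).
  { intros w Hw N. apply cdiff_div; [now apply Cminus_neq_0| |].
    - apply cdiff_minus; [now apply Hf|apply cdiff_const].
    - apply cdiff_minus; [apply cdiff_id|apply cdiff_const]. }
  set (P := fun w => (w * Q w)%C).
  assert (DP : forall w, Cmod w < r0 -> w <> z -> cdiff P w).
  { intros w Hw N. apply cdiff_mult; [apply cdiff_id|now apply DQ]. }
  assert (CP : forall s, s < r0 -> s <> Cmod z -> cont_circ P s).
  { intros s Hs N w Hw. apply cdiff_ccont, DP; [lra|]. intros ->. now apply N. }
  destruct (bounded_quotient f z (Hf z ltac:(lra))) as (dz & Kz & Hdz & HKz).
  change (forall w, w <> z -> Cmod (w - z)%C < dz -> Cmod (Q w) <= Kz) in HKz.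
  assert (Z : circ_int P r = 0).
  (* For [z = 0] the singularity of [Q] is the common centre and lies in no annulus. Otherwise the
     circle shrinks to [0] across [z], where [Q] is bounded. *)
  { destruct (Req_dec (Cmod z) 0) as [E0|N0].
    - assert (Ez : z = 0) by now apply Cmod_eq_0.
      apply small_eq_0 with (K := 4 * PI * Kz) (e0 := Rmin r dz).
      { apply Rmin_pos; lra. }
      intros e He. pose proof (Rmin_l r dz). pose proof (Rmin_r r dz).
      rewrite <- (circ_int_annulus P e r); [|lra|].
      2:{ intros w Hw. apply DP; [lra|]. intros ->. lra. }
      replace (4 * PI * Kz * e) with (4 * PI * (e * Kz)) by ring.
      apply circ_int_bound; [lra|apply CP; lra|].
      intros w Hw. unfold P. rewrite Cmod_mult, Hw. apply Rmult_le_compat_l; [lra|].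
      apply HKz. { intros ->. lra. }
      rewrite Ez. replace (w - 0)%C with w by ring. lra.
    - assert (P0 : ccont Q 0).
      { apply cdiff_ccont, DQ; [rewrite Cmod_0; lra|]. intros <-. apply N0, Cmod_0. }
      destruct (ccont_bounded Q 0 P0) as [d [Hd HK]].
      set (K := Cmod (Q 0) + 1) in *.
      apply small_eq_0 with (K := 4 * PI * K) (e0 := Rmin (Cmod z) d).
      { apply Rmin_pos; lra. }
      intros e He. pose proof (Rmin_l (Cmod z) d). pose proof (Rmin_r (Cmod z) d).
      rewrite <- (circ_int_annulus_punctured P e r (Rmin dz (r - Cmod z)) (r * Kz) z).
      + replace (4 * PI * K * e) with (4 * PI * (e * K)) by ring.
        apply circ_int_bound; [lra|apply CP; lra|].
        intros w Hw. unfold P. rewrite Cmod_mult, Hw. apply Rmult_le_compat_l; [lra|].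
        apply HK. replace (w - 0)%C with w by ring. lra.
      + lra.
      + lra.
      + apply Rmin_pos; lra.
      + intros w Hw N. apply DP; [lra|exact N].
      + intros w N Hw. unfold P. rewrite Cmod_mult.
        pose proof (Rmin_l dz (r - Cmod z)). pose proof (Rmin_r dz (r - Cmod z)).
        pose proof (Cmod_rev_triangle w z).
        apply Rmult_le_compat; try apply Cmod_ge_0; [lra|]. apply HKz; [exact N|lra]. }
  assert (CK : cont_circ (fun w => w / (w - z))%C r).
  { intros w Hw. apply ccont_div.
    - apply Cmod_lt_neq. lra.
    - apply ccont_id.
    - apply ccont_minus; [apply ccont_id|apply ccont_const]. }
  rewrite (circ_int_ext _ (fun w => P w + f z * (w / (w - z)))%C); [|lra|].
  2:{ intros w Hw. unfold P, Q. field. apply Cmod_lt_neq. lra. }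
  rewrite circ_int_plus; [|lra|apply CP; lra|].
  2:{ intros w Hw. apply ccont_mult; [apply ccont_const|now apply CK]. }
  rewrite Z, circ_int_scal, cauchy_kernel_integral by (auto; lra). ring.
Qed.

(** The Carathéodory quotient of [f] at [0] is clearly differentiable elsewhere. Its
    differentiability at [0] is the regularity gain of complex analysis: expanding Cauchy's kernel
    to second order gives [f] a second-order Taylor expansion. *)
Lemma divide_zero (f : C -> C) (r0 : R) :
  0 < r0 -> (forall w, Cmod w < r0 -> cdiff f w) ->
  exists q, (forall z, f z = f 0 + q z * z)%C /\ forall z, Cmod z < r0 -> cdiff q z.
Proof.
  intros Hr0 Hf. pose proof PI_RGT_0 as HPI.
  assert (F0 : cdiff f 0) by (apply Hf; rewrite Cmod_0; exact Hr0).
  destruct F0 as [q [E Hq]]. exists q.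
  assert (E' : forall z, (f z = f 0 + q z * z)%C).
  { intros z. rewrite (E z). ring. }
  split; [exact E'|]. intros z Hz.
  destruct (excluded_middle_informative (z = 0)) as [->|N].
  2:{ pose proof (proj1 (Cmod_gt_0 _) N) as Pz.
      apply cdiff_local with (f := fun w => ((f w - f 0) / w)%C) (r := Cmod z); [exact Pz| |].
      - intros w Hw. assert (Nw : w <> 0).
        { intros ->. replace (0 - z)%C with (- z)%C in Hw by ring. rewrite Cmod_opp in Hw. lra. }
        rewrite (E' w). field. exact Nw.
      - apply cdiff_div; [exact N| |apply cdiff_id].
        apply cdiff_minus; [now apply Hf|apply cdiff_const]. }
  clear Hz.
  assert (F0 : ccont f 0) by (apply cdiff_ccont, Hf; rewrite Cmod_0; exact Hr0).
  destruct (ccont_bounded f 0 F0) as [d [Hd HM]]. set (M := Cmod (f 0) + 1) in *.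
  set (r := Rmin d r0 / 2).
  assert (Hr : 0 < r) by (unfold r; pose proof (Rmin_pos d r0); lra).
  assert (Hrd : r < d /\ r < r0).
  { unfold r in *. pose proof (Rmin_l d r0). pose proof (Rmin_r d r0). lra. }
  assert (HMr : forall w, Cmod w = r -> Cmod (f w) <= M).
  { intros w Hw. apply HM. replace (w - 0)%C with w by ring. lra. }
  assert (Cf : cont_circ f r).
  { intros w Hw. apply cdiff_ccont, Hf. lra. }
  assert (M0 : 0 <= M) by (unfold M; pose proof (Cmod_ge_0 (f 0)); lra).
  (* Up to the factor [2 PI], [A] and [B] are the Taylor coefficients of [f] of orders one and
     two. *)
  set (A := circ_int (fun w => f w / w)%C r).
  set (B := circ_int (fun w => f w / (w * w))%C r).
  assert (C1 : cont_circ (fun w => f w / w)%C r).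
  { intros w Hw. apply ccont_div; [apply Cmod_pos_neq; lra|now apply Cf|apply ccont_id]. }
  assert (C2 : cont_circ (fun w => f w / (w * w))%C r).
  { intros w Hw. assert (w <> 0) by (apply Cmod_pos_neq; lra).
    apply ccont_div; [now apply Cmult_neq_0|now apply Cf|apply ccont_mult; apply ccont_id]. }
  (* The remainder [G] below is at most [|z| * M / (r * r * (r / 2))], since [|w - z| >= r / 2];
     integration contributes [4 PI]. *)
  set (K := 8 * PI * M / (r * r * r)).
  (* Second-order expansion at [z = 0] of the Cauchy kernel. *)
  assert (Exp : forall z : C, z <> 0 -> Cmod z < r / 2 -> exists e,
            (q z * (2 * PI) = A + z * B + z * e)%C /\ Cmod e <= K * Cmod z).
  { intros z Nz Hz. pose proof (Cmod_ge_0 z).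
    set (G := fun w => (z * f w / (w * w * (w - z)))%C).
    assert (CG : cont_circ G r).
    { intros w Hw. assert (w <> 0) by (apply Cmod_pos_neq; lra).
      assert ((w - z)%C <> 0) by (apply Cmod_lt_neq; lra).
      apply ccont_div.
      - apply Cmult_neq_0; [now apply Cmult_neq_0|assumption].
      - apply ccont_mult; [apply ccont_const|now apply Cf].
      - apply ccont_mult; [apply ccont_mult; apply ccont_id|].
        apply ccont_minus; [apply ccont_id|apply ccont_const]. }
    exists (circ_int G r). split.
    - pose proof (cauchy_formula f r0 r z Hf ltac:(lra) (proj2 Hrd)) as Fz.
      pose proof (cauchy_formula f r0 r 0 Hf ltac:(rewrite Cmod_0; lra) (proj2 Hrd)) as F00.
      assert (Ck : cont_circ (fun w => f w * (w / (w - 0)))%C r).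
      { intros w Hw. apply ccont_mult; [now apply Cf|]. apply ccont_div.
        - apply Cmod_lt_neq. rewrite Cmod_0. lra.
        - apply ccont_id.
        - apply ccont_minus; [apply ccont_id|apply ccont_const]. }
      rewrite (circ_int_ext _ (fun w => (f w * (w / (w - 0)) + z * (f w / w))
                 + ((z * z) * (f w / (w * w)) + (z * z) * G w))%C) in Fz; [|lra|].
      2:{ intros w Hw. unfold G. field. repeat split;
          first [apply Cmod_pos_neq; lra | apply Cmod_lt_neq; lra
                | apply Cmod_lt_neq; rewrite Cmod_0; lra]. }
      rewrite circ_int_plus in Fz; [|lra| |].
      2:{ intros w Hw. apply ccont_plus; [now apply Ck|].
          apply ccont_mult; [apply ccont_const|now apply C1]. }
      2:{ intros w Hw. apply ccont_plus; (apply ccont_mult; [apply ccont_const|]).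
          - now apply C2.
          - now apply CG. }
      rewrite circ_int_plus in Fz; [|lra|exact Ck|].
      2:{ intros w Hw. apply ccont_mult; [apply ccont_const|now apply C1]. }
      rewrite (circ_int_plus (fun w => z * z * (f w / (w * w)))%C) in Fz; [|lra| |].
      2:{ intros w Hw. apply ccont_mult; [apply ccont_const|now apply C2]. }
      2:{ intros w Hw. apply ccont_mult; [apply ccont_const|now apply CG]. }
      rewrite !circ_int_scal in Fz by (auto; lra).
      fold A B in Fz. rewrite F00 in Fz. rewrite (E' z) in Fz.
      assert (Fz' : (z * (q z * (2 * PI)))%C = (z * (A + z * B + z * circ_int G r))%C).
      { replace (z * (q z * (2 * PI)))%C
          with ((f 0 + q z * z) * (2 * PI) - f 0 * (2 * PI))%C by ring.
        rewrite <- Fz. ring. }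
      replace (q z * (2 * PI))%C with (/ z * (z * (q z * (2 * PI))))%C by (field; exact Nz).
      rewrite Fz'. field. exact Nz.
    - replace (K * Cmod z) with (4 * PI * (Cmod z * M / (r * r * (r / 2)))).
      2:{ unfold K. field. lra. }
      apply circ_int_bound; [lra|exact CG|]. intros w Hw. unfold G.
      assert (Nw : w <> 0) by (apply Cmod_pos_neq; lra).
      assert (Nwz : (w - z)%C <> 0) by (apply Cmod_lt_neq; lra).
      rewrite Cmod_div by (apply Cmult_neq_0; [now apply Cmult_neq_0|assumption]).
      rewrite !Cmod_mult, Hw. pose proof (Cmod_rev_triangle w z). specialize (HMr w Hw).
      pose proof (Cmod_ge_0 (f w)).
      apply Rmult_le_compat.
      + now apply Rmult_le_pos.
      + apply Rlt_le, Rinv_0_lt_compat. apply Rmult_lt_0_compat; [nra|]. lra.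
      + apply Rmult_le_compat_l; lra.
      + apply Rinv_le_contravar.
        * apply Rmult_lt_0_compat; [nra|lra].
        * apply Rmult_le_compat_l; [nra|lra]. }
  assert (K0 : 0 <= K).
  { unfold K. apply Rmult_le_pos; [nra|]. apply Rlt_le, Rinv_0_lt_compat.
    apply Rmult_lt_0_compat; [apply Rmult_lt_0_compat|]; exact Hr. }
  assert (NPI : RtoC (2 * PI) <> 0).
  { intros H. apply RtoC_inj in H. lra. }
  rewrite RtoC_mult in NPI.
  (* [Exp] says nothing at [z = 0]; the value there follows by continuity of [q] along real [z]
     tending to [0]. *)
  assert (Q0 : (q 0 * (2 * PI))%C = A).
  { apply Cminus_eq_0.
    apply small_eq_0 with (K := Cmod B + K + 2 * PI) (e0 := Rmin 1 (r / 2)).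
    { apply Rmin_pos; lra. }
    intros e He. pose proof (Rmin_l 1 (r / 2)). pose proof (Rmin_r 1 (r / 2)).
    destruct (Hq e (proj1 He)) as [d' [Hd' Hq']].
    set (z := RtoC (Rmin e d' / 2)).
    assert (Pz : 0 < Rmin e d') by (apply Rmin_pos; lra).
    pose proof (Rmin_l e d'). pose proof (Rmin_r e d').
    assert (Cz : Cmod z = Rmin e d' / 2) by (unfold z; rewrite Cmod_R, Rabs_pos_eq; lra).
    destruct (Exp z) as [eps [Ez Heps]].
    { apply Cmod_pos_neq. lra. } { lra. }
    assert (Hqz : Cmod (q z - q 0)%C < e).
    { apply Hq'. replace (z - 0)%C with z by ring. lra. }
    replace (q 0 * (2 * PI) - A)%C with (z * B + (z * eps + - ((2 * PI) * (q z - q 0))))%C.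
    2:{ replace A with (q z * (2 * PI) - z * B - z * eps)%C by (rewrite Ez; ring). ring. }
    eapply Rle_trans; [apply Cmod_triangle|].
    eapply Rle_trans; [apply Rplus_le_compat_l, Cmod_triangle|].
    rewrite Cmod_opp, !Cmod_mult, !Cmod_R, (Rabs_pos_eq 2), (Rabs_pos_eq PI) by lra.
    rewrite Cz in *. pose proof (Cmod_ge_0 B). pose proof (Cmod_ge_0 eps).
    set (m := Rmin e d' / 2) in *. assert (0 < m <= e) by (unfold m; lra).
    assert (m * Cmod B <= e * Cmod B) by nra.
    assert (m * Cmod eps <= e * K).
    { apply Rmult_le_compat; try lra. eapply Rle_trans; [exact Heps|]. nra. }
    nra. }
  apply cdiff_of_approx with (D := (B / (2 * PI))%C). intros eps Heps.
  set (dd := Rmin (r / 2) (eps * (2 * PI) / (K + 1))).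
  assert (Hdd : 0 < dd).
  { apply Rmin_pos; [lra|]. apply Rdiv_lt_0_compat; nra. }
  exists dd. split; [exact Hdd|]. intros z Hz. replace (z - 0)%C with z in * by ring.
  destruct (excluded_middle_informative (z = 0)) as [->|Nz].
  { replace (q 0 - q 0 - B / (2 * PI) * 0)%C with (RtoC 0) by ring. rewrite Cmod_0. lra. }
  assert (Hz1 : Cmod z < r / 2) by (eapply Rlt_le_trans; [exact Hz|apply Rmin_l]).
  assert (Hz2 : Cmod z < eps * (2 * PI) / (K + 1)) by (eapply Rlt_le_trans; [exact Hz|apply Rmin_r]).
  destruct (Exp z Nz Hz1) as [e [Ez He]].
  replace (q z - q 0 - B / (2 * PI) * z)%C with (z * e / (2 * PI))%C.
  2:{ replace (z * e)%C with (q z * (2 * PI) - q 0 * (2 * PI) - z * B)%C.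
      - field. intros H0. apply NPI. rewrite H0. ring.
      - rewrite Ez, Q0. ring. }
  rewrite Cmod_div by exact NPI. rewrite !Cmod_mult, !Cmod_R, (Rabs_pos_eq 2), (Rabs_pos_eq PI) by lra.
  pose proof (Cmod_ge_0 z). pose proof (Cmod_ge_0 e).
  apply Rmult_le_reg_r with (2 * PI); [lra|].
  unfold Rdiv. rewrite Rmult_assoc, Rinv_l by lra. rewrite Rmult_1_r.
  assert (Ke : (K + 1) * Cmod z <= eps * (2 * PI)).
  { apply Rmult_lt_compat_l with (r := K + 1) in Hz2; [|lra].
    replace ((K + 1) * (eps * (2 * PI) / (K + 1))) with (eps * (2 * PI)) in Hz2 by (field; lra). lra. }
  replace (eps * Cmod z * (2 * PI)) with (Cmod z * (eps * (2 * PI))) by ring.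
  apply Rmult_le_compat_l; lra.
Qed.

Lemma le_of_pow_le (x y K : R) :
  0 <= x -> 0 <= y -> (forall n : nat, x ^ n <= K * y ^ n) -> x <= y.
Proof.
  intros Hx Hy H. apply Rnot_lt_le. intros L.
  destruct (Req_dec y 0) as [->|Ny].
  { specialize (H 1%nat). simpl in H. lra. }
  assert (Py : 0 < y) by lra. set (u := x / y).
  assert (Hu : 1 < u).
  { apply Rmult_lt_reg_r with y; [exact Py|]. unfold u, Rdiv. rewrite Rmult_assoc, Rinv_l; lra. }
  destruct (Pow_x_infinity u) with (b := K + 1) as [N HN].
  { rewrite Rabs_pos_eq; lra. }
  specialize (HN N (le_n N)). rewrite Rabs_pos_eq in HN by (apply pow_le; lra).
  specialize (H N). replace x with (u * y) in H by (unfold u; field; lra).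
  rewrite Rpow_mult_distr in H. assert (0 < y ^ N) by now apply pow_lt. nra.
Qed.

(* Cauchy's formula for [f ^ n] bounds [|f z| ^ n] by a constant independent of
   [n] times [M ^ n]. *)
Lemma max_principle (f : C -> C) (r0 r M : R) (z : C) :
  (forall w, Cmod w < r0 -> cdiff f w) -> Cmod z < r -> r < r0 ->
  (forall w, Cmod w = r -> Cmod (f w) <= M) -> Cmod (f z) <= M.
Proof.
  intros Hf Hz Hr HM. pose proof (Cmod_ge_0 z). pose proof PI_RGT_0.
  assert (M0 : 0 <= M).
  { eapply Rle_trans; [apply Cmod_ge_0|]. apply HM. apply (Cmod_circ r 0). lra. }
  apply le_of_pow_le with (K := 2 * (r / (r - Cmod z))); [apply Cmod_ge_0|exact M0|].
  intros n.
  assert (Hfn : forall w, Cmod w < r0 -> cdiff (fun w => f w ^ n)%C w).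
  { intros w Hw. apply cdiff_pow. auto. }
  pose proof (cauchy_formula (fun w => f w ^ n)%C r0 r z Hfn Hz Hr) as E. cbv beta in E.
  apply Rmult_le_reg_r with (2 * PI); [lra|].
  rewrite <- Cmod_pow.
  replace (Cmod (f z ^ n)%C * (2 * PI)) with (Cmod (f z ^ n * (2 * PI))%C).
  2:{ rewrite !Cmod_mult, !Cmod_R, (Rabs_pos_eq 2), (Rabs_pos_eq PI) by lra. reflexivity. }
  rewrite <- E.
  replace (2 * (r / (r - Cmod z)) * M ^ n * (2 * PI))
    with (4 * PI * (M ^ n * (r / (r - Cmod z)))) by ring.
  apply circ_int_bound; [lra| |].
  - intros w Hw. apply ccont_mult.
    + apply cdiff_ccont, Hfn. lra.
    + apply ccont_div.
      * apply Cmod_lt_neq; lra.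
      * apply ccont_id.
      * apply ccont_minus; [apply ccont_id|apply ccont_const].
  - intros w Hw. rewrite Cmod_mult, Cmod_pow, Cmod_div by (apply Cmod_lt_neq; lra).
    pose proof (Cmod_rev_triangle w z). rewrite Hw in *.
    apply Rmult_le_compat.
    + apply pow_le, Cmod_ge_0.
    + apply Rmult_le_pos; [lra|]. apply Rlt_le, Rinv_0_lt_compat; lra.
    + apply pow_incr. split; [apply Cmod_ge_0|auto].
    + apply Rmult_le_compat_l; [lra|]. apply Rinv_le_contravar; lra.
Qed.

Lemma Schwarz_lemma (f : C -> C) (r0 M : R) (z : C) :
  (forall w, Cmod w < r0 -> cdiff f w) -> (forall w, Cmod w < r0 -> Cmod (f w) <= M) ->
  f 0 = 0 -> Cmod z < r0 -> Cmod (f z) * r0 <= M * Cmod z.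
Proof.
  intros Hf HM F0 Hz. pose proof (Cmod_ge_0 z).
  destruct (divide_zero f r0) as [q [E Hq]]; [lra|exact Hf|].
  apply le_small with (K := Cmod (f z)) (e0 := r0 - Cmod z); [lra|]. intros e He.
  assert (B : Cmod (q z) <= M / (r0 - e)).
  { apply (max_principle q r0 (r0 - e)); [exact Hq|lra|lra|].
    intros w Hw. apply Rmult_le_reg_r with (r0 - e); [lra|].
    unfold Rdiv. rewrite Rmult_assoc, Rinv_l by lra. rewrite Rmult_1_r.
    rewrite <- Hw at 1. rewrite <- Cmod_mult.
    replace (q w * w)%C with (f w) by (rewrite (E w), F0; ring). apply HM. lra. }
  assert (Cmod (q z) * (r0 - e) <= M).
  { apply Rmult_le_compat_r with (r := r0 - e) in B; [|lra].
    replace (M / (r0 - e) * (r0 - e)) with M in B by (field; lra). exact B. }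
  replace (f z) with (q z * z)%C by (rewrite (E z), F0; ring).
  rewrite Cmod_mult. nra.
Qed.

Lemma cdiff_translate (f : C -> C) (a z : C) :
  cdiff f (a + z)%C -> cdiff (fun w => f (a + w)%C) z.
Proof.
  intros H. apply cdiff_comp with (f := fun w => (a + w)%C); [|exact H].
  apply cdiff_plus; [apply cdiff_const|apply cdiff_id].
Qed.

(** Schwarz's lemma for [f (a + w) - f a], which is bounded by [2 M]. It takes the place of Cauchy's
    estimate for the derivative. *)
Lemma Schwarz_lipschitz (f : C -> C) (a z : C) (r M : R) :
  (forall w, Cmod (w - a)%C < r -> cdiff f w /\ Cmod (f w) <= M) ->
  Cmod (z - a)%C < r -> Cmod (f z - f a)%C * r <= 2 * M * Cmod (z - a)%C.
Proof.
  intros Hf Hz.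
  assert (Hw : forall w, Cmod w < r -> Cmod (a + w - a)%C < r).
  { intros w Hw. replace (a + w - a)%C with w by ring. exact Hw. }
  pose proof (Schwarz_lemma (fun w : C => (f (a + w) - f a)%C) r (2 * M) (z - a)%C) as S.
  cbv beta in S. replace (a + (z - a))%C with z in S by ring. apply S; [| | |exact Hz].
  - intros w H. apply cdiff_minus; [|apply cdiff_const].
    apply cdiff_translate, Hf, Hw, H.
  - intros w H. unfold Cminus. eapply Rle_trans; [apply Cmod_triangle|]. rewrite Cmod_opp.
    pose proof (proj2 (Hf _ (Hw w H))).
    assert (Cmod (f a) <= M).
    { apply Hf. rewrite Cmod_self_minus. pose proof (Cmod_ge_0 (z - a)%C). lra. }
    lra.
  - replace (a + 0)%C with a by ring. ring.
Qed.

Lemma ccont_unique_limit (f g : C -> C) (a : C) (r : R) :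
  0 < r -> ccont f a -> ccont g a ->
  (forall z, z <> a -> Cmod (z - a)%C < r -> f z = g z) -> f a = g a.
Proof.
  intros Hr Hf Hg E. apply Cminus_eq_0.
  apply small_eq_0 with (K := 2) (e0 := 1); [lra|]. intros e He.
  destruct (Hf e (proj1 He)) as [d1 [Hd1 H1]]. destruct (Hg e (proj1 He)) as [d2 [Hd2 H2]].
  set (m := Rmin r (Rmin d1 d2)).
  assert (Hm : 0 < m) by (unfold m; repeat apply Rmin_pos; lra).
  assert (m <= r) by apply Rmin_l.
  assert (m <= d1) by (eapply Rle_trans; [apply Rmin_r|apply Rmin_l]).
  assert (m <= d2) by (eapply Rle_trans; [apply Rmin_r|apply Rmin_r]).
  set (z := (a + m / 2)%C).
  assert (Hz : Cmod (z - a)%C = m / 2).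
  { replace (z - a)%C with (RtoC (m / 2)).
    - rewrite Cmod_R, Rabs_pos_eq; lra.
    - unfold z. rewrite RtoC_div by lra. ring. }
  assert (Nz : z <> a).
  { intros Ez. rewrite Ez, Cmod_self_minus in Hz. lra. }
  specialize (H1 z ltac:(lra)). specialize (H2 z ltac:(lra)).
  rewrite (E z Nz ltac:(lra)) in H1. rewrite Cmod_minus_sym in H1.
  pose proof (Cmod_tri_minus (f a) (g z) (g a)). lra.
Qed.

(** The function [z * f (a + z)] is differentiable at [0] too, with continuous quotient [f (a + z)];
    dividing it by [z] recovers [f] as a holomorphic function. *)
Lemma removable_singularity (f : C -> C) (a : C) (r : R) :
  0 < r -> ccont f a -> (forall z, z <> a -> Cmod (z - a)%C < r -> cdiff f z) -> cdiff f a.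
Proof.
  intros Hr Ca Hf.
  assert (C0 : ccont (fun z => f (a + z)%C) 0).
  { apply ccont_comp with (f := fun w => (a + w)%C).
    - apply ccont_plus; [apply ccont_const|apply ccont_id].
    - now rewrite Cplus_0_r. }
  set (g := fun z => (f (a + z) * z)%C).
  assert (Dg : forall z, Cmod z < r -> cdiff g z).
  { intros z Hz. destruct (excluded_middle_informative (z = 0)) as [->|N].
    - exists (fun z => f (a + z)%C). split; [|exact C0]. intros z. unfold g. ring.
    - apply cdiff_mult; [|apply cdiff_id]. apply cdiff_translate, Hf.
      + intros E. apply N. replace z with (a + z - a)%C by ring. rewrite E. ring.
      + now replace (a + z - a)%C with z by ring. }
  destruct (divide_zero g r Hr Dg) as [q [Eq Hq]].
  assert (Q0 : cdiff q 0) by (apply Hq; now rewrite Cmod_0).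
  assert (E : forall z : C, z <> 0 -> q z = f (a + z)%C).
  { intros z N. specialize (Eq z). unfold g in Eq.
    replace (q z) with ((f (a + 0) * 0 + q z * z) / z)%C by (field; exact N).
    rewrite <- Eq. field. exact N. }
  assert (E0 : q 0 = f a).
  { rewrite <- (Cplus_0_r a). apply (ccont_unique_limit q (fun z => f (a + z)%C) 0 1).
    - lra.
    - now apply cdiff_ccont.
    - exact C0.
    - intros z N _. now apply E. }
  apply cdiff_local with (f := fun z => q (- a + z)%C) (r := 1); [lra| |].
  - intros z _. destruct (excluded_middle_informative (z = a)) as [->|N].
    + replace (- a + a)%C with (RtoC 0) by ring. exact E0.
    + rewrite E.
      * f_equal. ring.
      * intros Ez. apply N. replace z with (a + (- a + z))%C by ring. rewrite Ez. ring.
  - apply cdiff_translate. now replace (- a + a)%C with (RtoC 0) by ring.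
Qed.

Lemma Cmod_pos_le_0 (z : C) : (forall e, 0 < e -> Cmod z <= e) -> z = 0.
Proof.
  intros H. apply small_eq_0 with (K := 1) (e0 := 1); [lra|].
  intros e He. rewrite Rmult_1_l. now apply H.
Qed.

(** If division by [z] never stops, the maximum principle for [f z / z ^ n] on a circle of radius
    [r] gives [|f z| <= M * (|z| / r) ^ n] for every [n]. *)
Lemma order_of_zero (f : C -> C) (r0 M : R) :
  0 < r0 -> (forall w, Cmod w < r0 -> cdiff f w) -> (forall w, Cmod w < r0 -> Cmod (f w) <= M) ->
  (exists n q, (forall z, f z = z ^ n * q z)%C /\ (forall z, Cmod z < r0 -> cdiff q z) /\ q 0 <> 0)
  \/ (forall z, Cmod z < r0 -> f z = 0).
Proof.
  intros Hr0 Hf HM.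
  destruct (excluded_middle_informative
    (exists n q, (forall z, f z = z ^ n * q z)%C /\ (forall z, Cmod z < r0 -> cdiff q z) /\ q 0 <> 0))
    as [H|H]; [now left|right].
  assert (D : forall n, exists q, (forall z, f z = z ^ n * q z)%C /\
                          (forall z, Cmod z < r0 -> cdiff q z)).
  { induction n as [|n [q [E Hq]]].
    - exists f. split; [|exact Hf]. intros z. simpl. ring.
    - destruct (excluded_middle_informative (q 0 = 0)) as [Q0|N].
      + destruct (divide_zero q r0 Hr0 Hq) as [p [Ep Hp]]. exists p. split; [|exact Hp].
        intros z. rewrite (E z), (Ep z), Q0. simpl. ring.
      + exfalso. apply H. now exists n, q. }
  intros z Hz. pose proof (Cmod_ge_0 z). set (r := (Cmod z + r0) / 2).
  assert (Hr : 0 < r) by (unfold r; lra).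
  assert (M0 : 0 <= M).
  { eapply Rle_trans; [apply Cmod_ge_0|apply (HM z Hz)]. }
  assert (Hu : 0 <= Cmod z / r < 1).
  { split.
    - apply Rmult_le_pos; [lra|]. now apply Rlt_le, Rinv_0_lt_compat.
    - apply Rmult_lt_reg_r with r; [exact Hr|]. unfold Rdiv.
      rewrite Rmult_assoc, Rinv_l; unfold r; lra. }
  assert (B : forall n : nat, Cmod (f z) <= M * (Cmod z / r) ^ n).
  { intros n. destruct (D n) as [q [E Hq]].
    assert (Pr : 0 < r ^ n) by now apply pow_lt.
    assert (Q : Cmod (q z) <= M / r ^ n).
    { apply (max_principle q r0 r); [exact Hq|unfold r; lra|unfold r; lra|].
      intros w Hw. apply Rmult_le_reg_r with (r ^ n); [exact Pr|].
      unfold Rdiv. rewrite Rmult_assoc, Rinv_l, Rmult_1_r by lra.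
      rewrite <- Hw at 1. rewrite <- Cmod_pow, Rmult_comm, <- Cmod_mult, <- E.
      apply HM. unfold r in Hw; lra. }
    rewrite (E z), Cmod_mult, Cmod_pow. unfold Rdiv. rewrite Rpow_mult_distr, pow_inv.
    replace (M * (Cmod z ^ n * / r ^ n)) with (Cmod z ^ n * (M / r ^ n)) by (unfold Rdiv; ring).
    apply Rmult_le_compat_l; [apply pow_le; lra|exact Q]. }
  apply Cmod_pos_le_0. intros e He.
  destruct (pow_lt_1_zero (Cmod z / r)) with (y := e / (M + 1)) as [N HN].
  { rewrite Rabs_pos_eq; lra. } { apply Rdiv_lt_0_compat; lra. }
  specialize (HN N (le_n N)). rewrite Rabs_pos_eq in HN by (apply pow_le; lra).
  specialize (B N).
  assert ((M + 1) * (Cmod z / r) ^ N < e).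
  { apply Rmult_lt_compat_l with (r := M + 1) in HN; [|lra].
    replace ((M + 1) * (e / (M + 1))) with e in HN by (field; lra). exact HN. }
  assert (0 <= (Cmod z / r) ^ N) by (apply pow_le; lra). lra.
Qed.

Lemma ccont_neq_0 (f : C -> C) (a : C) :
  ccont f a -> f a <> 0 -> exists d, 0 < d /\ forall z, Cmod (z - a)%C < d -> f z <> 0.
Proof.
  intros Hf N. pose proof (proj1 (Cmod_gt_0 _) N) as P.
  destruct (Hf (Cmod (f a)) P) as [d [Hd H]]. exists d. split; [exact Hd|].
  intros z Hz E. specialize (H z Hz). rewrite E in H.
  replace (0 - f a)%C with (- f a)%C in H by ring. rewrite Cmod_opp in H. lra.
Qed.

(** * Self-maps of the disc, Möbius transformations and the Schwarz-Pick inequality *)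

Definition self_map (f : C -> C) : Prop :=
  (forall z, Cmod z < 1 -> cdiff f z) /\ (forall z, Cmod z < 1 -> Cmod (f z) < 1).

Lemma self_map_comp (f g : C -> C) :
  self_map f -> self_map g -> self_map (fun z => f (g z)).
Proof.
  intros [F1 F2] [G1 G2]. split; intros z Hz; [apply cdiff_comp|]; auto.
Qed.

Lemma self_map_id : self_map (fun z => z).
Proof. split; auto using cdiff_id. Qed.

Definition mobius (p z : C) : C := ((z + p) / (1 + Cconj p * z))%C.

Lemma mobius_denom (p z : C) : Cmod p < 1 -> Cmod z < 1 -> (1 + Cconj p * z)%C <> 0.
Proof.
  intros Hp Hz E. assert (H : (Cconj p * z)%C = (- (1))%C).
  { replace (Cconj p * z)%C with (1 + Cconj p * z - 1)%C by ring. rewrite E. ring. }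
  apply (f_equal Cmod) in H. rewrite Cmod_mult, Cmod_conj, Cmod_m1 in H.
  pose proof (Cmod_ge_0 p). pose proof (Cmod_ge_0 z). nra.
Qed.

Lemma Cmod2_identity (p z : C) :
  Cmod (1 + Cconj p * z)%C ^ 2 - Cmod (z + p)%C ^ 2 = (1 - Cmod p ^ 2) * (1 - Cmod z ^ 2).
Proof. rewrite !Cmod2_alt. destruct p, z. simpl. ring. Qed.

Lemma Cmod_lt_1_pow (z : C) : Cmod z < 1 -> 0 < 1 - Cmod z ^ 2.
Proof. intros H. pose proof (Cmod_ge_0 z). nra. Qed.

Lemma self_map_mobius (p : C) : Cmod p < 1 -> self_map (mobius p).
Proof.
  intros Hp. split; intros z Hz; pose proof (mobius_denom p z Hp Hz) as N.
  - apply cdiff_div; [exact N| |].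
    + apply cdiff_plus; [apply cdiff_id|apply cdiff_const].
    + apply cdiff_plus; [apply cdiff_const|].
      apply cdiff_mult; [apply cdiff_const|apply cdiff_id].
  - unfold mobius. rewrite Cmod_div by exact N.
    pose proof (proj1 (Cmod_gt_0 _) N) as P. pose proof (Cmod2_identity p z) as E.
    pose proof (Cmod_lt_1_pow p Hp). pose proof (Cmod_lt_1_pow z Hz).
    assert (0 < (1 - Cmod p ^ 2) * (1 - Cmod z ^ 2)) by now apply Rmult_lt_0_compat.
    pose proof (Cmod_ge_0 (z + p)%C).
    apply Rmult_lt_reg_r with (Cmod (1 + Cconj p * z)%C); [exact P|].
    unfold Rdiv. rewrite Rmult_assoc, Rinv_l by lra. nra.
Qed.

Lemma mobius_opp_r (p z : C) : Cmod p < 1 -> Cmod z < 1 -> mobius (- p) (mobius p z) = z.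
Proof.
  intros Hp Hz. unfold mobius. rewrite Copp_conj.
  pose proof (mobius_denom p z Hp Hz) as N.
  assert (N2 : (1 - Cconj p * p)%C <> 0).
  { replace (1 - Cconj p * p)%C with (1 + Cconj p * (- p))%C by ring.
    apply mobius_denom; [exact Hp|now rewrite Cmod_opp]. }
  field. split; [exact N|].
  replace (1 + Cconj p * z + - Cconj p * (z + p))%C with (1 - Cconj p * p)%C by ring.
  exact N2.
Qed.

Lemma mobius_opp_l (p z : C) : Cmod p < 1 -> Cmod z < 1 -> mobius p (mobius (- p) z) = z.
Proof.
  intros Hp Hz. pose proof (mobius_opp_r (- p) z) as H. rewrite Cmod_opp in H.
  replace (- - p)%C with p in H by ring. auto.
Qed.

Lemma mobius_0 (p : C) : mobius p 0 = p.
Proof.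
  unfold mobius. replace (1 + Cconj p * 0)%C with (RtoC 1) by ring. field.
Qed.

Lemma mobius_opp_self (p : C) : Cmod p < 1 -> mobius (- p) p = 0.
Proof.
  intros Hp. rewrite <- (mobius_0 p) at 2. apply mobius_opp_r; [exact Hp|].
  rewrite Cmod_0. lra.
Qed.

Lemma Schwarz_Pick (f : C -> C) (a z : C) :
  self_map f -> Cmod a < 1 -> Cmod z < 1 ->
  Cmod (f z - f a)%C * Cmod (1 - Cconj a * z)%C <= Cmod (z - a)%C * Cmod (1 - Cconj (f a) * f z)%C.
Proof.
  intros Hf Ha Hz. pose proof (proj2 Hf a Ha) as Hfa. pose proof (proj2 Hf z Hz) as Hfz.
  assert (Oa : Cmod (- a)%C < 1) by now rewrite Cmod_opp.
  assert (Ofa : Cmod (- f a)%C < 1) by now rewrite Cmod_opp.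
  set (F := fun u => mobius (- f a) (f (mobius a u))).
  assert (HF : self_map F).
  { apply (self_map_comp (mobius (- f a)) (fun u => f (mobius a u))).
    - now apply self_map_mobius.
    - apply (self_map_comp f (mobius a)); [exact Hf|now apply self_map_mobius]. }
  assert (Hu : Cmod (mobius (- a) z) < 1) by now apply self_map_mobius.
  pose proof (Schwarz_lemma F 1 1 (mobius (- a) z) (proj1 HF)) as S.
  rewrite Rmult_1_r, Rmult_1_l in S. unfold F at 3 in S.
  rewrite mobius_opp_l in S by assumption.
  assert (S' : Cmod (mobius (- f a) (f z)) <= Cmod (mobius (- a) z)).
  { apply S; [|unfold F; rewrite mobius_0; now apply mobius_opp_self|exact Hu].
    intros w Hw. now apply Rlt_le, HF. }
  pose proof (mobius_denom (- a) z Oa Hz) as N1.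
  pose proof (mobius_denom (- f a) (f z) Ofa Hfz) as N2.
  unfold mobius in S'. rewrite !Cmod_div in S' by assumption.
  apply Cmod_gt_0 in N1. apply Cmod_gt_0 in N2.
  replace (1 + Cconj (- a) * z)%C with (1 - Cconj a * z)%C in * by (rewrite Copp_conj; ring).
  replace (1 + Cconj (- f a) * f z)%C with (1 - Cconj (f a) * f z)%C in * by (rewrite Copp_conj; ring).
  apply Rmult_le_compat_r with (r := Cmod (1 - Cconj a * z)%C * Cmod (1 - Cconj (f a) * f z)%C) in S'.
  2:{ apply Rmult_le_pos; apply Cmod_ge_0. }
  change (f z + - f a)%C with (f z - f a)%C in S'. change (z + - a)%C with (z - a)%C in S'.
  set (A := Cmod (f z - f a)%C) in *. set (B := Cmod (1 - Cconj a * z)%C) in *.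
  set (D := Cmod (z - a)%C) in *. set (G := Cmod (1 - Cconj (f a) * f z)%C) in *.
  replace (A / G * (B * G)) with (A * B) in S' by (field; lra).
  replace (D / B * (B * G)) with (D * G) in S' by (field; lra). exact S'.
Qed.

(** The form in which the base point [a] can tend to the boundary: after comparing [1 - |a|^2] with
    [1 - |f a|^2], the limit is Julia's inequality. *)
Lemma Schwarz_Pick_square (f : C -> C) (a z : C) :
  self_map f -> Cmod a < 1 -> Cmod z < 1 ->
  (1 - Cmod a ^ 2) * (1 - Cmod z ^ 2) * Cmod (1 - Cconj (f a) * f z)%C ^ 2
  <= (1 - Cmod (f a) ^ 2) * (1 - Cmod (f z) ^ 2) * Cmod (1 - Cconj a * z)%C ^ 2.
Proof.
  intros Hf Ha Hz. pose proof (Schwarz_Pick f a z Hf Ha Hz) as S.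
  assert (I : forall p w, Cmod (1 - Cconj p * w)%C ^ 2 - Cmod (w - p)%C ^ 2
                          = (1 - Cmod p ^ 2) * (1 - Cmod w ^ 2)).
  { intros p w. pose proof (Cmod2_identity (- p) w) as E.
    rewrite Cmod_opp, Copp_conj in E. rewrite <- E.
    replace (1 + - Cconj p * w)%C with (1 - Cconj p * w)%C by ring. reflexivity. }
  pose proof (I a z) as I1. pose proof (I (f a) (f z)) as I2.
  assert (S2 : (Cmod (f z - f a)%C * Cmod (1 - Cconj a * z)%C) ^ 2
               <= (Cmod (z - a)%C * Cmod (1 - Cconj (f a) * f z)%C) ^ 2).
  { apply pow_incr. split; [|exact S]. apply Rmult_le_pos; apply Cmod_ge_0. }
  rewrite !Rpow_mult_distr in S2. rewrite <- I1, <- I2. lra.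
Qed.

(** * Identity theorem and inverse functions *)

(** A Möbius transformation moves [p] to [0], where a finite order would isolate the zero. The bound
    [M] is the one that [order_of_zero] asks for. *)
Lemma identity_theorem (f : C -> C) (M : R) (p : C) :
  (forall z, Cmod z < 1 -> cdiff f z) -> (forall z, Cmod z < 1 -> Cmod (f z) <= M) ->
  Cmod p < 1 ->
  (forall e, 0 < e -> exists z, z <> p /\ Cmod (z - p)%C < e /\ Cmod z < 1 /\ f z = 0) ->
  forall z, Cmod z < 1 -> f z = 0.
Proof.
  intros Hf HM Hp Hacc.
  pose proof (self_map_mobius p Hp) as [Tp1 Tp2].
  assert (Op : Cmod (- p)%C < 1) by now rewrite Cmod_opp.
  pose proof (self_map_mobius (- p) Op) as [To1 To2].
  set (g := fun u => f (mobius p u)).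
  assert (Eg : forall z, Cmod z < 1 -> g (mobius (- p) z) = f z).
  { intros z Hz. unfold g. now rewrite mobius_opp_l. }
  destruct (order_of_zero g 1 M) as [(n & q & E & Dq & Nq)|Z].
  - lra.
  - intros w Hw. apply (cdiff_comp (mobius p) f); auto.
  - intros w Hw. apply HM. auto.
  - exfalso.
    destruct (ccont_neq_0 q 0) as [d [Hd Hq]]; [|exact Nq|].
    { apply cdiff_ccont, Dq. rewrite Cmod_0. lra. }
    destruct (cdiff_ccont _ _ (To1 p Hp) d Hd) as [d' [Hd' Hc]].
    destruct (Hacc d' Hd') as (z & Nz & Hzp & Hz & Fz).
    specialize (Hc z Hzp). rewrite mobius_opp_self in Hc by exact Hp.
    rewrite <- (Eg z Hz), E in Fz. revert Fz. apply Cmult_neq_0.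
    + apply Cpow_nz. intros E0. apply Nz. rewrite <- (mobius_opp_l p z Hp Hz), E0.
      apply mobius_0.
    + now apply Hq.
  - intros z Hz. rewrite <- Eg by exact Hz. apply Z. now apply To2.
Qed.

(** For [rho = 1 - e] the map [rho * Q] is a self-map of the disc. Since
    [|1 - Cconj (Q 0) * Q z| = |Q z - Q 0|] for unimodular values, Schwarz-Pick at [0] gives
    [(1 - e) d <= |z| (d + 2 e)] for [d = |Q z - Q 0|], which forces [d = 0] as [e] tends to [0]. *)
Lemma unimodular_constant (Q : C -> C) (z : C) :
  (forall z, Cmod z < 1 -> cdiff Q z) -> (forall z, Cmod z < 1 -> Cmod (Q z) = 1) ->
  Cmod z < 1 -> Q z = Q 0.
Proof.
  intros HQ H1 Hz. assert (H0 : Cmod 0 < 1) by (rewrite Cmod_0; lra).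
  apply Cminus_eq_0.
  pose proof (Cmod_ge_0 z). pose proof (Cmod_ge_0 (Q z - Q 0)%C).
  apply small_eq_0 with (K := 5 / (1 - Cmod z)) (e0 := 1); [lra|]. intros e He.
  set (rho := RtoC (1 - e)).
  assert (Crho : Cmod rho = 1 - e) by (unfold rho; rewrite Cmod_R, Rabs_pos_eq; lra).
  pose proof (Schwarz_Pick (fun w => rho * Q w)%C 0 z) as S. cbv beta in S.
  assert (SM : self_map (fun w => rho * Q w)%C).
  { split; intros w Hw.
    - apply cdiff_mult; [apply cdiff_const|auto].
    - rewrite Cmod_mult, H1, Crho by exact Hw. lra. }
  specialize (S SM H0 Hz).
  replace (rho * Q z - rho * Q 0)%C with (rho * (Q z - Q 0))%C in S by ring.
  replace (1 - Cconj 0 * z)%C with (RtoC 1) in S.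
  2:{ replace (Cconj 0) with (RtoC 0); [ring|]. unfold Cconj, RtoC; simpl. f_equal; ring. }
  replace (z - 0)%C with z in S by ring.
  rewrite Cmod_mult, Crho, Cmod_1, Rmult_1_r in S.
  assert (B : Cmod (1 - Cconj (rho * Q 0) * (rho * Q z))%C <= Cmod (Q z - Q 0)%C + 2 * e).
  { assert (U : (Cconj (Q 0) * Q 0)%C = 1).
    { rewrite Cmult_comm, <- Cmod2_conj, H1 by exact H0.
      unfold RtoC; simpl. f_equal. ring. }
    replace (1 - Cconj (rho * Q 0) * (rho * Q z))%C
      with (Cconj (Q 0) * (Q 0 - Q z) + RtoC (1 - (1 - e) * (1 - e)) * (Cconj (Q 0) * Q z))%C.
    2:{ rewrite Cmult_conj. replace (Cconj rho) with rho.
        - replace (Cconj (Q 0) * (Q 0 - Q z))%C with (Cconj (Q 0) * Q 0 - Cconj (Q 0) * Q z)%C by ring.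
          rewrite U, RtoC_minus, RtoC_mult. unfold rho. ring.
        - unfold rho, Cconj, RtoC; simpl. f_equal. ring. }
    eapply Rle_trans; [apply Cmod_triangle|].
    rewrite !Cmod_mult, Cmod_conj, !H1, Cmod_R, Rabs_pos_eq by (auto; nra).
    rewrite Cmod_minus_sym. nra. }
  set (d := Cmod (Q z - Q 0)%C) in *.
  assert (D2 : d <= 2).
  { unfold d, Cminus. eapply Rle_trans; [apply Cmod_triangle|]. rewrite Cmod_opp, !H1 by auto. lra. }
  assert (A : d * (1 - Cmod z) <= 5 * e).
  { assert (Cmod z * Cmod (1 - Cconj (rho * Q 0) * (rho * Q z))%C <= Cmod z * (d + 2 * e))
      by (apply Rmult_le_compat_l; lra). nra. }
  apply Rmult_le_reg_r with (1 - Cmod z); [lra|].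
  replace (5 / (1 - Cmod z) * e * (1 - Cmod z)) with (5 * e) by (field; lra). exact A.
Qed.

(* A holomorphic section of a self-map of the disc forces equality in Schwarz's
   lemma. *)
Lemma Schwarz_section (f k : C -> C) :
  self_map f -> self_map k -> f 0 = 0 -> k 0 = 0 ->
  (forall w, Cmod w < 1 -> f (k w) = w) ->
  exists u, Cmod u = 1 /\ forall z, Cmod z < 1 -> f z = (u * z)%C.
Proof.
  intros [F1 F2] [K1 K2] F0 K0 Efk.
  (* Schwarz's lemma twice: [|k w| <= |w| = |f (k w)| <= |k w|]. *)
  assert (Ek : forall w, Cmod w < 1 -> Cmod (k w) = Cmod w).
  { intros w Hw. apply Rle_antisym.
    - pose proof (Schwarz_lemma k 1 1 w K1 (fun w Hw => Rlt_le _ _ (K2 w Hw)) K0 Hw). lra.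
    - pose proof (Schwarz_lemma f 1 1 (k w) F1 (fun w Hw => Rlt_le _ _ (F2 w Hw)) F0 (K2 w Hw)) as H.
      rewrite Efk in H by exact Hw. lra. }
  destruct (divide_zero k 1 Rlt_0_1 K1) as [q [Eq Dq]].
  assert (Uq0 : forall w, w <> RtoC 0 -> Cmod w < 1 -> Cmod (q w) = 1).
  { intros w N Hw. pose proof (Ek w Hw) as E. rewrite (Eq w), K0, Cplus_0_l, Cmod_mult in E.
    pose proof (proj1 (Cmod_gt_0 w) N). apply Rmult_eq_reg_r with (Cmod w); lra. }
  assert (Uq : forall w, Cmod w < 1 -> Cmod (q w) = 1).
  { intros w Hw. destruct (excluded_middle_informative (w = 0)) as [->|N]; [|auto].
    pose proof (cdiff_ccont _ _ (Dq 0 Hw)) as Cq.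
    destruct (Req_dec (Cmod (q 0)) 1) as [E|N]; [exact E|exfalso].
    destruct (Cq (Rabs (Cmod (q 0) - 1))) as [d [Hd H]].
    { apply Rabs_pos_lt. lra. }
    set (m := Rmin d 1 / 2).
    assert (0 < Rmin d 1) by (apply Rmin_pos; lra).
    pose proof (Rmin_l d 1). pose proof (Rmin_r d 1).
    assert (Em : Cmod m = m) by (rewrite Cmod_R, Rabs_pos_eq; unfold m; lra).
    specialize (H m). replace (m - 0)%C with (RtoC m) in H by ring. rewrite Em in H.
    assert (Um : Cmod (q m) = 1).
    { apply Uq0; [|rewrite Em; unfold m; lra]. apply Cmod_gt_0. rewrite Em. unfold m; lra. }
    assert (H' : Cmod (q m - q 0)%C < Rabs (Cmod (q 0) - 1)) by (apply H; unfold m; lra).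
    pose proof (Cmod_rev_triangle (q m) (q 0)) as T1.
    pose proof (Cmod_rev_triangle (q 0) (q m)) as T2. rewrite Cmod_minus_sym in T2.
    revert H'. apply Rle_not_lt. apply Rabs_le. lra. }
  assert (Eku : forall w, Cmod w < 1 -> k w = (q 0 * w)%C).
  { intros w Hw. rewrite (Eq w), K0, (unimodular_constant q w Dq Uq Hw). ring. }
  assert (U0 : Cmod (q 0) = 1) by (apply Uq; rewrite Cmod_0; lra).
  assert (N0 : q 0 <> 0) by (apply Cmod_gt_0; lra).
  exists (/ q 0)%C. split.
  - rewrite Cmod_inv, U0 by exact N0. apply Rinv_1.
  (* As [k] is a rotation, it attains every [z] of the disc, so the section identity determines [f]
     everywhere. *)
  - intros z Hz.
    assert (Hw : Cmod (/ q 0 * z)%C < 1).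
    { rewrite Cmod_mult, Cmod_inv, U0, Rinv_1 by exact N0. lra. }
    rewrite <- (Efk _ Hw), (Eku _ Hw). f_equal. field. exact N0.
Qed.

Lemma rcont_Cmod_continuity (g : R -> C) (t : R) :
  rcont g t -> continuity_pt (fun t => Cmod (g t)) t.
Proof.
  intros H e He. destruct (H e He) as [d [Hd H']]. exists d. split; [exact Hd|].
  intros u [_ Hu]. specialize (H' u Hu). unfold R_dist, dist; simpl.
  eapply Rle_lt_trans; [|exact H'].
  pose proof (Cmod_rev_triangle (g u) (g t)). pose proof (Cmod_rev_triangle (g t) (g u)) as T.
  rewrite Cmod_minus_sym in T. unfold R_dist. apply Rabs_le. lra.
Qed.

(* Minimum modulus argument: otherwise [1 / (f - w)] would violate the maximum
   principle on the circle of radius [r]. *)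
Lemma locally_open (f : C -> C) (r r0 : R) :
  0 < r < r0 -> (forall z, Cmod z < r0 -> cdiff f z) ->
  (forall z, Cmod z = r -> f z <> f 0) ->
  exists d, 0 < d /\ forall w, Cmod (w - f 0)%C < d -> exists z, Cmod z < r0 /\ f z = w.
Proof.
  intros Hr Hf Hinj. pose proof PI_RGT_0.
  destruct (continuity_ab_min (fun t => Cmod (f (circ r t) - f 0)%C) (- PI) PI) as [tm [Hm _]].
  { lra. }
  { intros t _. apply (rcont_Cmod_continuity (fun t => f (circ r t) - f 0)%C).
    apply (rcont_on_circ (fun z => f z - f 0)%C); [lra|].
    intros z Hz. apply ccont_minus; [|apply ccont_const]. apply cdiff_ccont, Hf. lra. }
  set (m := Cmod (f (circ r tm) - f 0)%C) in *.
  assert (Pm : 0 < m).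
  { apply Cmod_gt_0, Cminus_neq_0, Hinj, Cmod_circ. lra. }
  assert (Hmin : forall z, Cmod z = r -> m <= Cmod (f z - f 0)%C).
  { intros z Hz. destruct (polar z) as [a [Ha Ez]]. rewrite Ez, Hz. now apply Hm. }
  (* For such [w], [|f - w|] is at least [m / 2] on the circle but smaller at the centre. *)
  exists (m / 2). split; [lra|]. intros w Hw.
  apply NNPP. intros Hno.
  assert (Nfw : forall z, Cmod z < r0 -> (f z - w)%C <> 0).
  { intros z Hz E. apply Hno. exists z. split; [exact Hz|now apply Cminus_eq_0]. }
  assert (N0 : (f 0 - w)%C <> 0) by (apply Nfw; rewrite Cmod_0; lra).
  assert (B : Cmod (/ (f 0 - w))%C <= 2 / m).
  { apply (max_principle (fun z => / (f z - w))%C r0 r); [|rewrite Cmod_0; lra|lra|].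
    - intros z Hz. apply cdiff_inv; [now apply Nfw|].
      apply cdiff_minus; [now apply Hf|apply cdiff_const].
    - intros z Hz. rewrite Cmod_inv by (apply Nfw; lra).
      pose proof (Cmod_tri_minus (f z) w (f 0)). specialize (Hmin z Hz).
      replace (2 / m) with (/ (m / 2)) by (field; lra).
      apply Rinv_le_contravar; lra. }
  rewrite Cmod_inv in B by exact N0. rewrite Cmod_minus_sym in Hw.
  pose proof (proj1 (Cmod_gt_0 _) N0) as P0.
  assert (/ (m / 2) < / Cmod (f 0 - w)%C).
  { apply Rinv_lt_contravar; [|exact Hw]. apply Rmult_lt_0_compat; lra. }
  replace (/ (m / 2)) with (2 / m) in * by (field; lra). lra.
Qed.

(** [S a] is the derivative [n a^(n-1)]; multiplying by [a] avoids the exponent [n - 1]. *)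
Lemma pow_quotient (a : C) (n : nat) :
  exists S, (forall z, z ^ n = a ^ n + S z * (z - a))%C /\ (forall b, ccont S b) /\
            (S a * a = INR n * a ^ n)%C.
Proof.
  induction n as [|n (S & E & HS & Sa)].
  - exists (fun _ => 0). split; [intros; simpl; ring|]. split.
    + intros. apply ccont_const.
    + simpl. ring.
  - exists (fun z => S z * z + a ^ n)%C. split; [|split].
    + intros z. replace (z ^ Datatypes.S n)%C with (z ^ n * z)%C by (simpl; ring).
      rewrite E. simpl. ring.
    + intros b. apply ccont_plus; [|apply ccont_const].
      apply ccont_mult; [apply HS|apply ccont_id].
    + rewrite S_INR, RtoC_plus. simpl.
      replace ((S a * a + a ^ n) * a)%C with (S a * a * a + a * a ^ n)%C by ring.
      rewrite Sa. ring.
Qed.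

(** * Holomorphy of the inverse of an injective holomorphic function *)

Section Inverse.

Variables (h k : C -> C) (W : C -> Prop).
Hypothesis W_open : forall z, W z -> exists r, 0 < r /\ forall w, Cmod (w - z)%C < r -> W w.
Hypothesis h_cdiff : forall z, W z -> cdiff h z.
Hypothesis h_inj : forall z w, W z -> W w -> h z = h w -> z = w.
Hypothesis k_inv : forall z, W z -> k (h z) = z.

Lemma image_open (z0 : C) (rho : R) :
  W z0 -> 0 < rho -> exists d, 0 < d /\ forall w, Cmod (w - h z0)%C < d ->
    exists z, W z /\ Cmod (z - z0)%C < rho /\ h z = w.
Proof.
  intros H0 Hrho. destruct (W_open z0 H0) as [r [Hr HW]].
  set (r0 := Rmin r rho). assert (Hr0 : 0 < r0) by (apply Rmin_pos; lra).
  assert (Hr1 : r0 <= r) by apply Rmin_l. assert (Hr2 : r0 <= rho) by apply Rmin_r.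
  assert (HW' : forall z, Cmod z < r0 -> W (z0 + z)%C).
  { intros z Hz. apply HW. replace (z0 + z - z0)%C with z by ring. lra. }
  destruct (locally_open (fun z => h (z0 + z)%C) (r0 / 2) r0) as [d [Hd H]].
  - lra.
  - intros z Hz. apply cdiff_translate, h_cdiff, HW', Hz.
  - intros z Hz E. apply h_inj in E; [|apply HW'; lra|apply HW'; rewrite Cmod_0; lra].
    assert (z = 0).
    { replace z with (z0 + z - z0)%C by ring. rewrite E. ring. }
    subst z. rewrite Cmod_0 in Hz. lra.
  - exists d. split; [exact Hd|]. intros w Hw.
    replace (z0 + 0)%C with z0 in H by ring. destruct (H w Hw) as [z [Hz Ez]].
    exists (z0 + z)%C. split; [now apply HW'|]. split; [|exact Ez].
    replace (z0 + z - z0)%C with z by ring. lra.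
Qed.

Lemma inverse_ccont (z0 : C) : W z0 -> ccont k (h z0).
Proof.
  intros H0 e He. destruct (image_open z0 e H0 He) as [d [Hd H]].
  exists d. split; [exact Hd|]. intros w Hw. destruct (H w Hw) as (z & Wz & Hz & <-).
  now rewrite !k_inv.
Qed.

(** The Carathéodory quotient of [k] is the reciprocal of that of [h], composed with [k], which is
    already known to be continuous. *)
Lemma inverse_cdiff_regular (z0 : C) (q : C -> C) :
  W z0 -> (forall z, h z = h z0 + q z * (z - z0))%C -> ccont q z0 -> q z0 <> 0 ->
  cdiff k (h z0).
Proof.
  intros H0 E Cq Nq.
  assert (Cqk : ccont (fun w => q (k w)) (h z0)).
  { apply ccont_comp; [now apply inverse_ccont|]. now rewrite k_inv. }
  destruct (image_open z0 1 H0 Rlt_0_1) as [d [Hd Him]].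
  assert (Nqk : q (k (h z0)) <> 0) by now rewrite k_inv.
  destruct (ccont_neq_0 _ _ Cqk Nqk) as [d' [Hd' Hne]].
  apply cdiff_of_quotient with (q := fun w => (/ q (k w))%C) (r := Rmin d d').
  - now apply Rmin_pos.
  - now apply ccont_inv.
  - intros w Hw.
    assert (H1 : Cmod (w - h z0)%C < d) by (eapply Rlt_le_trans; [exact Hw|apply Rmin_l]).
    assert (H2 : Cmod (w - h z0)%C < d') by (eapply Rlt_le_trans; [exact Hw|apply Rmin_r]).
    specialize (Hne w H2). destruct (Him w H1) as (z & Wz & _ & <-).
    rewrite !k_inv in * by assumption. rewrite (E z). field. exact Hne.
Qed.

(* Near a zero of order [n] of [h - h z0] the derivative of [h] has no other zero,
   so [k] is holomorphic off [h z0] and continuous there. *)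
Lemma inverse_cdiff (z0 : C) : W z0 -> cdiff k (h z0).
Proof.
  intros H0. destruct (W_open z0 H0) as [r [Hr HW]].
  assert (HW' : forall z, Cmod z < r -> W (z0 + z)%C).
  { intros z Hz. apply HW. now replace (z0 + z - z0)%C with z by ring. }
  set (f := fun z => (h (z0 + z) - h z0)%C).
  assert (Df : forall z, Cmod z < r -> cdiff f z).
  { intros z Hz. apply cdiff_minus; [|apply cdiff_const].
    apply cdiff_translate, h_cdiff, HW', Hz. }
  assert (F0 : f 0 = 0) by (unfold f; rewrite Cplus_0_r; ring).
  assert (C0 : ccont f 0) by (apply cdiff_ccont, Df; rewrite Cmod_0; exact Hr).
  destruct (ccont_bounded f 0 C0) as [d [Hd Hb]].
  set (r1 := Rmin r d). assert (Hr1 : 0 < r1) by (apply Rmin_pos; lra).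
  assert (r1 <= r) by apply Rmin_l. assert (r1 <= d) by apply Rmin_r.
  destruct (order_of_zero f r1 (Cmod (f 0) + 1)) as [(n & q & E & Dq & Nq)|Z].
  { exact Hr1. } { intros w Hw. apply Df. lra. }
  { intros w Hw. apply Hb. replace (w - 0)%C with w by ring. lra. }
  2:{ exfalso. set (m := RtoC (r1 / 2)).
      assert (Em : Cmod m = r1 / 2) by (unfold m; rewrite Cmod_R, Rabs_pos_eq; lra).
      assert (Fm : f m = 0) by (apply Z; lra). unfold f in Fm. apply Cminus_eq_0 in Fm.
      apply h_inj in Fm; [|apply HW'; lra|exact H0].
      assert (m = 0).
      { replace m with (z0 + m - z0)%C by ring. rewrite Fm. ring. }
      rewrite H2, Cmod_0 in Em. lra. }
  assert (Pn : (n <> 0)%nat).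
  { intros ->. specialize (E 0). rewrite F0 in E. simpl in E. rewrite Cmult_1_l in E.
    now apply Nq. }
  assert (Cq0 : ccont q 0) by (apply cdiff_ccont, Dq; rewrite Cmod_0; exact Hr1).
  pose proof (proj1 (Cmod_gt_0 _) Nq) as Pq.
  destruct (Cq0 (Cmod (q 0) / 2)) as [d2 [Hd2 Hq2]]; [lra|].
  set (r2 := Rmin r1 d2). assert (Hr2 : 0 < r2) by (apply Rmin_pos; lra).
  assert (Lr1 : r2 <= r1) by apply Rmin_l. assert (Lr2 : r2 <= d2) by apply Rmin_r.
  assert (Bq : forall z, Cmod z < r2 -> Cmod (q 0) / 2 <= Cmod (q z) <= 2 * Cmod (q 0)).
  { intros z Hz. specialize (Hq2 z). replace (z - 0)%C with z in Hq2 by ring.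
    assert (Hq3 : Cmod (q z - q 0)%C < Cmod (q 0) / 2) by (apply Hq2; lra).
    pose proof (Cmod_rev_triangle (q z) (q 0)).
    pose proof (Cmod_rev_triangle (q 0) (q z)) as T. rewrite Cmod_minus_sym in T. lra. }
  (* For [|a| < r2 / 32] the bound [Bp] gives [|a * p a| <= |q 0| / 4], less than
     [|q 0| / 2 <= |INR n * q a|], so the two terms of the derivative of [z ^ n * q z] at [a] cannot
     cancel. *)
  set (r3 := r2 / 32).
  assert (Reg : forall a, a <> RtoC 0 -> Cmod a < r3 -> cdiff k (h (z0 + a)%C)).
  { intros a Na Ha. pose proof (proj1 (Cmod_gt_0 _) Na) as Pa. unfold r3 in Ha.
    destruct (pow_quotient a n) as (S & ES & CS & Sa).
    destruct (Dq a ltac:(lra)) as [p [Ep Cp]].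
    (* The Carathéodory quotient of [z ^ n * q z] at [a], by the product rule. *)
    set (T := fun z => (S z * q z + a ^ n * p z)%C).
    assert (Cqa : ccont q a) by (apply cdiff_ccont, Dq; lra).
    assert (CT : ccont T a).
    { apply ccont_plus; apply ccont_mult; auto using ccont_const. }
    assert (ET : forall z, (f z = f a + T z * (z - a))%C).
    { intros z. rewrite (E z), (E a). unfold T. rewrite (ES z) at 1.
      replace (a ^ n * q a)%C with (a ^ n * (q z - p z * (z - a)))%C.
      - ring.
      - rewrite (Ep z). ring. }
    (* [p a] is the derivative of [q] at [a]. Schwarz's lemma bounds [p] at nearby points [a + m],
       and continuity of [p] carries the bound to [a]. *)
    assert (Bp : Cmod (p a) <= 8 * Cmod (q 0) / r2).
    { apply Rnot_lt_le. intros L.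
      destruct (Cp (Cmod (p a) - 8 * Cmod (q 0) / r2)) as [d4 [Hd4 Hp4]]; [lra|].
      set (m := Rmin d4 (r2 / 4) / 2).
      assert (0 < Rmin d4 (r2 / 4)) by (apply Rmin_pos; lra).
      pose proof (Rmin_l d4 (r2 / 4)). pose proof (Rmin_r d4 (r2 / 4)).
      assert (Hm : 0 < m) by (unfold m; lra).
      assert (Em : Cmod (a + m - a)%C = m).
      { replace (a + m - a)%C with (RtoC m) by ring. rewrite Cmod_R, Rabs_pos_eq; lra. }
      specialize (Hp4 (a + m)%C). rewrite Em in Hp4.
      assert (Hp5 := Hp4 ltac:(unfold m; lra)).
      assert (Lip : Cmod (q (a + m)%C - q a)%C * (r2 / 2) <= 2 * (2 * Cmod (q 0)) * m).
      { rewrite <- Em at 2. apply Schwarz_lipschitz.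
        - intros w Hw. assert (Cmod w < r2).
          { pose proof (Cmod_rev_triangle w a). lra. }
          split; [apply Dq; lra|now apply Bq].
        - rewrite Em. unfold m; lra. }
      rewrite (Ep (a + m)%C) in Lip.
      replace (q a + p (a + m)%C * (a + m - a) - q a)%C with (p (a + m)%C * (a + m - a))%C in Lip by ring.
      rewrite Cmod_mult, Em in Lip.
      assert (Bpm : Cmod (p (a + m)%C) <= 8 * Cmod (q 0) / r2).
      { apply Rmult_le_reg_r with (r2 / 2 * m); [apply Rmult_lt_0_compat; lra|].
        replace (8 * Cmod (q 0) / r2 * (r2 / 2 * m)) with (2 * (2 * Cmod (q 0)) * m) by (field; lra).
        lra. }
      pose proof (Cmod_rev_triangle (p a) (p (a + m)%C)) as T'.
      rewrite Cmod_minus_sym in T'. lra. }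
    assert (NT : T a <> 0).
    { intros E0. assert (E1 : (a ^ n * (INR n * q a + a * p a))%C = 0).
      { replace (a ^ n * (INR n * q a + a * p a))%C
          with ((INR n * a ^ n) * q a + a ^ n * p a * a)%C by ring.
        rewrite <- Sa. replace (S a * a * q a + a ^ n * p a * a)%C with (T a * a)%C by (unfold T; ring).
        rewrite E0. ring. }
      destruct (excluded_middle_informative ((INR n * q a + a * p a)%C = 0)) as [E3|N3];
        [|now apply (Cmult_neq_0 _ _ (Cpow_nz a n Na) N3)]. clear E1.
      assert (E2 : (INR n * q a)%C = (- (a * p a))%C).
      { replace (INR n * q a)%C with (INR n * q a + a * p a - a * p a)%C by ring. rewrite E3. ring. }
      apply (f_equal Cmod) in E2. rewrite Cmod_opp, !Cmod_mult, Cmod_R, Rabs_pos_eq in E2 by apply pos_INR.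
      assert (1 <= INR n).
      { change 1 with (INR 1). apply le_INR. lia. }
      pose proof (Bq a ltac:(lra)) as [B1 _].
      assert (Cmod a * Cmod (p a) <= r2 / 32 * (8 * Cmod (q 0) / r2)).
      { apply Rmult_le_compat; try apply Cmod_ge_0; lra. }
      replace (r2 / 32 * (8 * Cmod (q 0) / r2)) with (Cmod (q 0) / 4) in * by (field; lra).
      nra. }
    apply inverse_cdiff_regular with (q := fun z => T (- z0 + z)%C).
    - apply HW'. lra.
    - intros z. specialize (ET (- z0 + z)%C). unfold f in ET.
      replace (z0 + (- z0 + z))%C with z in ET by ring.
      replace (h z) with (h z - h z0 + h z0)%C by ring. rewrite ET. ring.
    - apply ccont_comp with (f := fun z => (- z0 + z)%C).
      + apply ccont_plus; [apply ccont_const|apply ccont_id].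
      + now replace (- z0 + (z0 + a))%C with a by ring.
    - now replace (- z0 + (z0 + a))%C with a by ring. }
  destruct (image_open z0 r3 H0) as [d3 [Hd3 Him]]; [unfold r3; lra|].
  apply removable_singularity with (r := d3); [exact Hd3|now apply inverse_ccont|].
  intros w Nw Hw. destruct (Him w Hw) as (z & Wz & Hz & <-).
  replace z with (z0 + (z - z0))%C by ring. apply Reg; [|exact Hz].
  intros Ez. apply Nw. f_equal. now apply Cminus_eq_0.
Qed.

End Inverse.

(** * Julia's lemma and rigidity at the Denjoy-Wolff point *)

Lemma iterate_add (f : C -> C) (n m : nat) (z : C) :
  iterate f (n + m) z = iterate f n (iterate f m z).
Proof. induction n as [|n IH]; simpl; [reflexivity|]. now rewrite IH. Qed.

Lemma self_map_iterate (f : C -> C) (n : nat) : self_map f -> self_map (iterate f n).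
Proof.
  intros Hf. induction n as [|n IH]; [exact self_map_id|].
  exact (self_map_comp f (iterate f n) Hf IH).
Qed.

(* Horodiscs at [tau] are mapped into themselves. *)
Definition julia (tau : C) (f : C -> C) : Prop :=
  forall z, Cmod z < 1 ->
    (1 - Cmod z ^ 2) * Cmod (tau - f z)%C ^ 2 <= (1 - Cmod (f z) ^ 2) * Cmod (tau - z)%C ^ 2.

Lemma julia_id (tau : C) : julia tau (fun z => z).
Proof. intros z _. lra. Qed.

Lemma julia_comp (tau : C) (f g : C -> C) :
  self_map f -> self_map g -> julia tau f -> julia tau g -> julia tau (fun z => f (g z)).
Proof.
  intros [_ Sf] [_ Sg] Hf Hg z Hz. pose proof (Cmod_lt_1_pow _ (Sf _ (Sg z Hz))) as C0.
  specialize (Hf (g z) (Sg z Hz)). specialize (Hg z Hz).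
  pose proof (Cmod_lt_1_pow _ (Sg z Hz)) as B. pose proof (Cmod_lt_1_pow _ Hz) as A.
  apply Rmult_le_reg_l with (1 - Cmod (g z) ^ 2); [exact B|].
  apply Rmult_le_compat_l with (r := 1 - Cmod z ^ 2) in Hf; [|lra].
  apply Rmult_le_compat_l with (r := 1 - Cmod (f (g z)) ^ 2) in Hg; [|lra].
  lra.
Qed.

Lemma julia_iterate (tau : C) (f : C -> C) (n : nat) :
  self_map f -> julia tau f -> julia tau (iterate f n).
Proof.
  intros Sf Hf. induction n as [|n IH]; [exact (julia_id tau)|].
  exact (julia_comp tau f (iterate f n) Sf (self_map_iterate f n Sf) Hf IH).
Qed.

Lemma Cmod_unit_conj (tau z : C) : Cmod tau = 1 -> Cmod (1 - Cconj tau * z)%C = Cmod (tau - z)%C.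
Proof.
  intros Ht. replace (tau - z)%C with (tau * (1 - Cconj tau * z))%C.
  - rewrite Cmod_mult, Ht. ring.
  - replace (tau * (1 - Cconj tau * z))%C with (tau - (tau * Cconj tau) * z)%C by ring.
    rewrite <- Cmod2_conj, Ht. simpl. rewrite !Rmult_1_l. ring.
Qed.

(* Since [|f^n(0)| -> 1], infinitely often [|f^n(0)| <= |f^(n+1)(0)|]; along these
   [n] the Schwarz-Pick inequality at the base point [f^n(0)] tends to Julia's. *)
Lemma julia_of_orbit (f : C -> C) (tau : C) :
  self_map f -> Cmod tau = 1 ->
  (forall e, 0 < e -> exists N, forall n, (N <= n)%nat -> Cmod (iterate f n 0 - tau)%C < e) ->
  julia tau f.
Proof.
  intros Sf Ht Hcv z Hz. pose proof (proj2 Sf z Hz) as Hfz.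
  assert (Z1 : forall n, Cmod (iterate f n 0) < 1).
  { intros n. apply (self_map_iterate f n Sf). rewrite Cmod_0. lra. }
  assert (Hinf : forall N, exists n, (N <= n)%nat /\ Cmod (iterate f n 0) <= Cmod (iterate f (S n) 0)).
  { intros N. apply NNPP. intros Hno.
    assert (Dec : forall k, Cmod (iterate f (N + k) 0) <= Cmod (iterate f N 0)).
    { induction k as [|k IH]; [rewrite Nat.add_0_r; lra|].
      apply Rnot_lt_le. intros L. apply Hno. exists (N + k)%nat. split; [lia|].
      rewrite Nat.add_succ_r in L. lra. }
    destruct (Hcv (1 - Cmod (iterate f N 0))) as [N' HN']; [specialize (Z1 N); lra|].
    specialize (HN' (N + N')%nat ltac:(lia)). specialize (Dec N').
    pose proof (Cmod_rev_triangle tau (iterate f (N + N') 0)) as T.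
    rewrite Cmod_minus_sym in T. lra. }
  pose proof (Cmod_ge_0 z). pose proof (Cmod_ge_0 (f z)).
  apply le_small with (K := 12) (e0 := 1); [lra|]. intros e He.
  destruct (Hcv e (proj1 He)) as [N HN]. destruct (Hinf N) as [n [Hn Hmono]].
  pose proof (HN n Hn) as C1. pose proof (HN (S n) ltac:(lia)) as C2.
  set (a := iterate f n 0) in *. change (iterate f (S n) 0) with (f a) in *.
  pose proof (Schwarz_Pick_square f a z Sf (Z1 n) Hz) as SP.
  pose proof (Cmod_lt_1_pow a (Z1 n)) as Pa. pose proof (Cmod_lt_1_pow z Hz) as Pz.
  pose proof (Cmod_lt_1_pow (f z) Hfz) as Pfz.
  assert (Ha : 1 - Cmod (f a) ^ 2 <= 1 - Cmod a ^ 2).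
  { pose proof (Cmod_ge_0 a). nra. }
  assert (Lim : forall p w, Cmod (p - tau)%C < e -> Cmod w < 1 ->
            Cmod (tau - w)%C - e <= Cmod (1 - Cconj p * w)%C <= Cmod (tau - w)%C + e).
  { intros p w Hp Hw. rewrite <- (Cmod_unit_conj tau w Ht).
    assert (D : Cmod ((1 - Cconj p * w) - (1 - Cconj tau * w))%C <= e).
    { replace ((1 - Cconj p * w) - (1 - Cconj tau * w))%C with (Cconj (tau - p) * w)%C.
      - rewrite Cmod_mult, Cmod_conj, Cmod_minus_sym. pose proof (Cmod_ge_0 w).
        pose proof (Cmod_ge_0 (p - tau)%C). nra.
      - rewrite Cminus_conj. ring. }
    pose proof (Cmod_rev_triangle (1 - Cconj p * w)%C (1 - Cconj tau * w)%C).
    pose proof (Cmod_rev_triangle (1 - Cconj tau * w)%C (1 - Cconj p * w)%C) as T.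
    rewrite (Cmod_minus_sym (1 - Cconj tau * w)) in T. lra. }
  pose proof (Lim a z C1 Hz) as L1. pose proof (Lim (f a) (f z) C2 Hfz) as L2.
  set (Y := Cmod (1 - Cconj a * z)%C) in *. set (X := Cmod (1 - Cconj (f a) * f z)%C) in *.
  assert (D2 : forall w, Cmod w < 1 -> 0 <= Cmod (tau - w)%C <= 2).
  { intros w Hw. split; [apply Cmod_ge_0|]. eapply Rle_trans; [apply Cmod_triangle|].
    rewrite Cmod_opp. lra. }
  pose proof (D2 z Hz) as Dz. pose proof (D2 (f z) Hfz) as Dfz.
  set (x := Cmod (tau - f z)%C) in *. set (y := Cmod (tau - z)%C) in *.
  assert (X0 : 0 <= X) by apply Cmod_ge_0. assert (Y0 : 0 <= Y) by apply Cmod_ge_0.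
  set (A := 1 - Cmod z ^ 2) in *. set (B := 1 - Cmod (f z) ^ 2) in *.
  assert (A1 : A <= 1) by (unfold A; nra). assert (B1 : B <= 1) by (unfold B; nra).
  (* The choice of [n] with [|a| <= |f a|] allows [1 - |f a|^2] to be replaced by [1 - |a|^2], which
     then cancels. *)
  assert (S1 : A * X ^ 2 <= B * Y ^ 2).
  { apply Rmult_le_reg_l with (1 - Cmod a ^ 2); [exact Pa|].
    rewrite <- Rmult_assoc. eapply Rle_trans; [exact SP|].
    rewrite <- Rmult_assoc. apply Rmult_le_compat_r; [nra|].
    apply Rmult_le_compat_r; lra. }
  (* From [x <= X + e] with [X <= 3], and then [Y <= y + e] with [y <= 2]; the two errors add up to
     [12 e]. *)
  assert (X2 : x ^ 2 <= X ^ 2 + 7 * e) by nra.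
  assert (Y2 : Y ^ 2 <= y ^ 2 + 5 * e) by nra.
  assert (A * x ^ 2 <= A * X ^ 2 + 7 * e) by nra.
  assert (B * Y ^ 2 <= B * y ^ 2 + 5 * e) by nra.
  lra.
Qed.

Definition stolz (tau : C) (M : R) (z : C) : Prop :=
  Cmod z < 1 /\ Cmod (z - tau)%C < M * (1 - Cmod z).

(* For a map with angular limit [tau] at [tau] this says that the angular
   derivative at [tau] is [1]. *)
Definition ang_id (tau : C) (f : C -> C) : Prop :=
  forall M e, 1 < M -> 0 < e -> exists d, 0 < d /\ forall z,
    stolz tau M z -> Cmod (z - tau)%C < d -> Cmod (f z - z)%C <= e * Cmod (z - tau)%C.

(** With [x = |z - tau|] and [y = |f z - tau|], Julia's inequality gives [y^2 < 2 M x (1 - |f z|)],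
    and the displacement bound gives [x <= 2 y]; hence the aperture grows at most by the factor
    [4]. *)
Lemma stolz_image (tau : C) (f : C -> C) (M : R) (z : C) :
  self_map f -> julia tau f -> Cmod tau = 1 -> stolz tau M z ->
  Cmod (f z - z)%C <= / 2 * Cmod (z - tau)%C -> stolz tau (4 * M) (f z).
Proof.
  intros Sf Jf Ht [Hz HM] H. pose proof (proj2 Sf z Hz) as Hfz. split; [exact Hfz|].
  specialize (Jf z Hz). rewrite (Cmod_minus_sym tau (f z)), (Cmod_minus_sym tau z) in Jf.
  assert (x0 : 0 < Cmod (z - tau)%C).
  { apply Cmod_gt_0, Cminus_neq_0. intros ->. lra. }
  pose proof (Cmod_tri_minus z (f z) tau) as T. rewrite (Cmod_minus_sym z (f z)) in T.
  pose proof (Cmod_ge_0 z). pose proof (Cmod_ge_0 (f z)).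
  set (x := Cmod (z - tau)%C) in *. set (y := Cmod (f z - tau)%C) in *.
  set (s := 1 - Cmod z) in *. set (t := 1 - Cmod (f z)) in *.
  assert (s0 : 0 < s) by (unfold s; lra). assert (t0 : 0 < t) by (unfold t; lra).
  assert (y0 : x / 2 <= y) by lra.
  assert (M0 : 0 < M) by nra.
  assert (J : s * y ^ 2 <= 2 * t * x ^ 2).
  { apply Rle_trans with ((1 - Cmod z ^ 2) * y ^ 2).
    - apply Rmult_le_compat_r; [nra|]. unfold s. nra.
    - eapply Rle_trans; [exact Jf|]. apply Rmult_le_compat_r; [nra|]. unfold t. nra. }
  apply Rmult_lt_reg_r with (x * y); [nra|].
  assert (E1 : x * y ^ 2 < M * (s * y ^ 2)) by (assert (0 < y ^ 2) by nra; nra).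
  assert (E2 : M * (s * y ^ 2) <= M * (2 * t * x ^ 2)) by (apply Rmult_le_compat_l; lra).
  assert (E3 : x ^ 2 <= 2 * (x * y)) by nra.
  assert (E4 : M * (2 * t * x ^ 2) <= M * (2 * t * (2 * (x * y)))).
  { apply Rmult_le_compat_l; [lra|]. apply Rmult_le_compat_l; lra. }
  replace (y * (x * y)) with (x * y ^ 2) by ring.
  replace (4 * M * t * (x * y)) with (M * (2 * t * (2 * (x * y)))) by ring. lra.
Qed.

(** [g] may widen the Stolz region, so [f] is used with aperture [4 M]; this is why [ang_id]
    quantifies over all apertures. *)
Lemma ang_id_comp (tau : C) (f g : C -> C) :
  self_map g -> julia tau g -> Cmod tau = 1 -> ang_id tau f -> ang_id tau g ->
  ang_id tau (fun z => f (g z)).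
Proof.
  intros Sg Jg Ht Hf Hg M e HM He.
  destruct (Hf (4 * M) (e / 3)) as [d1 [Hd1 H1]]; [lra|lra|].
  destruct (Hg M (Rmin (e / 3) (/ 2))) as [d2 [Hd2 H2]]; [lra|apply Rmin_pos; lra|].
  exists (Rmin (d1 / 2) d2). split; [apply Rmin_pos; lra|]. intros z Hz Hd.
  assert (L1 : Cmod (z - tau)%C < d1 / 2) by (eapply Rlt_le_trans; [exact Hd|apply Rmin_l]).
  assert (L2 : Cmod (z - tau)%C < d2) by (eapply Rlt_le_trans; [exact Hd|apply Rmin_r]).
  specialize (H2 z Hz L2). pose proof (Cmod_ge_0 (z - tau)%C).
  pose proof (Rmin_l (e / 3) (/ 2)). pose proof (Rmin_r (e / 3) (/ 2)).
  assert (G1 : Cmod (g z - z)%C <= e / 3 * Cmod (z - tau)%C) by nra.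
  assert (G2 : Cmod (g z - z)%C <= / 2 * Cmod (z - tau)%C) by nra.
  pose proof (Cmod_tri_minus (g z) z tau) as T1.
  assert (F1 : Cmod (f (g z) - g z)%C <= e / 3 * Cmod (g z - tau)%C).
  { apply H1; [|lra]. now apply stolz_image. }
  pose proof (Cmod_tri_minus (f (g z)) (g z) z) as T2. nra.
Qed.

Lemma ang_id_iterate (tau : C) (f : C -> C) (n : nat) :
  self_map f -> julia tau f -> Cmod tau = 1 -> ang_id tau f -> ang_id tau (iterate f n).
Proof.
  intros Sf Jf Ht Hf. induction n as [|n IH].
  - intros M e _ He. exists 1. split; [lra|]. intros z _ _. simpl.
    rewrite Cmod_self_minus. pose proof (Cmod_ge_0 (z - tau)%C). nra.
  - apply (ang_id_comp tau f (iterate f n)); auto.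
    + now apply self_map_iterate.
    + now apply julia_iterate.
Qed.

(* On a disc of radius comparable to [|z - tau|] around [z] the map [f z - z] has
   small Lipschitz constant by Schwarz's lemma. *)
Lemma ang_id_injective (tau : C) (f : C -> C) (M : R) :
  self_map f -> Cmod tau = 1 -> ang_id tau f -> 1 < M ->
  exists d, 0 < d /\ forall z z', stolz tau M z -> stolz tau M z' ->
    Cmod (z - tau)%C < d -> Cmod (z' - tau)%C < d -> f z = f z' -> z = z'.
Proof.
  (* On the disc of radius [|z - tau| / (4 M)] about [z], the map [f w - w] is bounded by
     [2 e |z - tau|]. Its increments from [z] are therefore at most [16 e M = 1 / 4] times
     [|w - z|], whereas [f z = f z'] would require the factor [1]. *)
  intros Sf Ht Hf HM. set (e := / (64 * M)).
  assert (He : 0 < e) by (apply Rinv_0_lt_compat; lra).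
  assert (EM : e * M = / 64) by (unfold e; field; lra).
  (* That disc leaves the Stolz region of aperture [M] but stays in the one of aperture [3 M]. *)
  destruct (Hf (3 * M) e) as [d [Hd H]]; [lra|exact He|].
  exists (d / 2). split; [lra|]. intros z z' [Hz Sz] [Hz' Sz'] Dz Dz' E.
  assert (x0 : 0 < Cmod (z - tau)%C).
  { apply Cmod_gt_0, Cminus_neq_0. intros ->. lra. }
  assert (Near : forall w, Cmod (w - z)%C < / (4 * M) * Cmod (z - tau)%C ->
            Cmod w < 1 /\ Cmod (f w - w)%C <= 2 * e * Cmod (z - tau)%C).
  { intros w Hw.
    assert (I4 : / (4 * M) <= / 4) by (apply Rinv_le_contravar; lra).
    assert (IM : / (4 * M) * M = / 4) by (field; lra).
    pose proof (Cmod_tri_minus w z tau). pose proof (Cmod_rev_triangle w z).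
    set (x := Cmod (z - tau)%C) in *. set (i := / (4 * M)) in *.
    assert (S1 : x * (3 / 4) < M * (1 - Cmod w)) by nra.
    assert (Hw1 : Cmod w < 1) by nra.
    split; [exact Hw1|].
    assert (T2 : Cmod (w - tau)%C <= 5 / 4 * x) by nra.
    eapply Rle_trans; [apply H|].
    - split; [exact Hw1|]. nra.
    - nra.
    - nra. }
  assert (Hzz : Cmod (z' - z)%C < / (4 * M) * Cmod (z - tau)%C).
  { assert (H1 : Cmod (f z - z)%C <= e * Cmod (z - tau)%C).
    { apply H; [split; [exact Hz|nra]|lra]. }
    assert (H2 : Cmod (f z' - z')%C <= e * Cmod (z' - tau)%C).
    { apply H; [split; [exact Hz'|nra]|lra]. }
    replace (z' - z)%C with ((f z - z) - (f z' - z'))%C by (rewrite E; ring).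
    assert (T : Cmod ((f z - z) - (f z' - z'))%C <= e * Cmod (z - tau)%C + e * Cmod (z' - tau)%C).
    { unfold Cminus at 1. eapply Rle_trans; [apply Cmod_triangle|]. rewrite Cmod_opp. lra. }
    pose proof (Cmod_tri_minus z' z tau) as T'.
    replace (z' - z)%C with ((f z - z) - (f z' - z'))%C in T' by (rewrite E; ring).
    set (x := Cmod (z - tau)%C) in *. set (x' := Cmod (z' - tau)%C) in *.
    set (u := Cmod ((f z - z) - (f z' - z'))%C) in *.
    assert (I : / (4 * M) = 16 * e) by (unfold e; field; lra). rewrite I.
    assert (e <= / 64) by (unfold e; apply Rinv_le_contravar; lra).
    assert (u <= e * x + e * (u + x)) by nra. nra. }
  pose proof (Schwarz_lipschitz (fun w => f w - w)%C z z' (/ (4 * M) * Cmod (z - tau)%C)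
    (2 * e * Cmod (z - tau)%C)) as L. cbv beta in L.
  assert (L' : Cmod (f z' - z' - (f z - z))%C * (/ (4 * M) * Cmod (z - tau)%C)
               <= 2 * (2 * e * Cmod (z - tau)%C) * Cmod (z' - z)%C).
  { apply L; [|exact Hzz]. intros w Hw. destruct (Near w Hw) as [W1 W2]. split; [|exact W2].
    apply cdiff_minus; [now apply Sf|apply cdiff_id]. }
  replace (f z' - z' - (f z - z))%C with (- (z' - z))%C in L' by (rewrite E; ring).
  rewrite Cmod_opp in L'.
  assert (I : / (4 * M) = 16 * e) by (unfold e; field; lra). rewrite I in L'.
  pose proof (Cmod_ge_0 (z' - z)%C).
  assert (U0 : Cmod (z' - z)%C = 0).
  { assert (0 < e * Cmod (z - tau)%C) by nra. nra. }
  symmetry. apply Cminus_eq_0. now apply Cmod_eq_0.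
Qed.

(** Write [t = 1 - |f (r tau)|], [y = |f (r tau) - tau|] and [c = 1 - |f 0|]. Julia's inequality
    gives [y^2 <= 2 t (1 - r)], Schwarz-Pick at [0] gives [(1 - r) c^2 <= 2 t]; together
    [y c <= 2 t]. *)
Lemma radial_stolz (tau : C) (f : C -> C) :
  self_map f -> julia tau f -> Cmod tau = 1 ->
  exists M, 1 < M /\ forall r, 0 <= r < 1 ->
    stolz tau M (f (r * tau)%C) /\ Cmod (f (r * tau)%C - tau)%C ^ 2 <= 2 * (1 - r).
Proof.
  intros Sf Jf Ht. assert (D0 : Cmod 0 < 1) by (rewrite Cmod_0; lra).
  pose proof (proj2 Sf 0 D0) as A0. pose proof (Cmod_ge_0 (f 0)).
  set (c := 1 - Cmod (f 0)) in *. assert (c0 : 0 < c) by (unfold c; lra).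
  assert (I : 1 <= / c).
  { rewrite <- Rinv_1. apply Rinv_le_contravar; unfold c; lra. }
  exists (3 / c). split; [unfold Rdiv; lra|]. intros r Hr.
  assert (Cr : Cmod (r * tau)%C = r) by (rewrite Cmod_mult, Ht, Cmod_R, Rabs_pos_eq; lra).
  assert (Dr : Cmod (r * tau)%C < 1) by lra.
  pose proof (proj2 Sf _ Dr) as Af. pose proof (Jf _ Dr) as J.
  pose proof (Schwarz_Pick_square f 0 _ Sf D0 Dr) as SP.
  replace (tau - r * tau)%C with (RtoC (1 - r) * tau)%C in J by (rewrite RtoC_minus; ring).
  rewrite (Cmod_mult (RtoC (1 - r))), Ht, Cmod_R, Rabs_pos_eq in J by lra.
  rewrite Cr in *. rewrite Cmod_0 in SP.
  replace (1 - Cconj 0 * (r * tau))%C with (RtoC 1) in SP.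
  2:{ replace (Cconj 0) with (RtoC 0); [ring|]. unfold Cconj, RtoC; simpl. f_equal; ring. }
  rewrite Cmod_1 in SP.
  assert (X : c <= Cmod (1 - Cconj (f 0) * f (r * tau))%C).
  { pose proof (Cmod_rev_triangle 1 (Cconj (f 0) * f (r * tau))%C) as T.
    rewrite Cmod_1, Cmod_mult, Cmod_conj in T. pose proof (Cmod_ge_0 (f (r * tau)%C)).
    unfold c. nra. }
  rewrite (Cmod_minus_sym tau) in J.
  pose proof (Cmod_ge_0 (f (r * tau)%C)) as F0. pose proof (Cmod_ge_0 (f (r * tau)%C - tau)%C) as y0.
  set (y := Cmod (f (r * tau)%C - tau)%C) in *.
  set (G := Cmod (1 - Cconj (f 0) * f (r * tau))%C) in *.
  assert (J2 : y ^ 2 <= 2 * (1 - Cmod (f (r * tau)%C)) * (1 - r)).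
  { apply Rmult_le_reg_l with (1 - r ^ 2); [nra|]. eapply Rle_trans; [exact J|].
    set (a := Cmod (f (r * tau)%C)) in *.
    assert (U1 : 0 <= (1 - a) * (1 - a) * (1 - r) ^ 2).
    { apply Rmult_le_pos; [nra|apply pow2_ge_0]. }
    assert (U2 : 0 <= r * ((1 - a) * (1 - r) ^ 2)).
    { apply Rmult_le_pos; [lra|]. apply Rmult_le_pos; [lra|apply pow2_ge_0]. }
    lra. }
  set (t := 1 - Cmod (f (r * tau)%C)) in *. assert (t0 : 0 < t) by (unfold t; lra).
  assert (S2 : (1 - r) * c ^ 2 <= 2 * t).
  { apply Rle_trans with ((1 - r ^ 2) * G ^ 2).
    - apply Rmult_le_compat; [lra|nra|nra|]. apply pow_incr. lra.
    - apply Rle_trans with ((1 - Cmod (f 0) ^ 2) * (1 - Cmod (f (r * tau)%C) ^ 2)); [lra|].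
      apply Rle_trans with (1 * (2 * t)); [|lra].
      pose proof (pow2_ge_0 (Cmod (f 0))). unfold t in *.
      apply Rmult_le_compat; [unfold c in *; nra|nra|lra|nra]. }
  assert (t1 : t <= 1) by (unfold t; lra).
  split; [|assert (0 <= (1 - t) * (1 - r)) by nra; lra].
  split; [exact Af|]. fold t y.
  apply Rmult_lt_reg_r with c; [exact c0|].
  replace (3 / c * t * c) with (3 * t) by (field; lra).
  assert (Y2 : (y * c) ^ 2 <= (2 * t) ^ 2).
  { replace ((y * c) ^ 2) with (y ^ 2 * c ^ 2) by ring.
    apply Rle_trans with (2 * t * (1 - r) * c ^ 2).
    - apply Rmult_le_compat_r; [nra|lra].
    - apply Rmult_le_compat_l with (r := 2 * t) in S2; lra. }
  assert (0 <= y * c) by nra. nra.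
Qed.

Section Rigidity.

Variables (phi h : C -> C) (W : C -> Prop) (tau : C).
Hypothesis phi_self : self_map phi.
Hypothesis tau_unit : Cmod tau = 1.
Hypothesis phi_julia : julia tau phi.
Hypothesis phi_ang : ang_id tau phi.
Hypothesis W_open : forall z, W z -> exists r, 0 < r /\ forall w, Cmod (w - z)%C < r -> W w.
Hypothesis W_phi : forall z, W z -> W (phi z).
Hypothesis W_absorbs : forall z, Cmod z < 1 -> exists n, W (iterate phi n z).
Hypothesis h_inj : forall z w, W z -> W w -> h z = h w -> z = w.
Hypothesis h_phi : forall z, Cmod z < 1 -> h (phi z) = (h z + 1)%C.

Lemma W_iterate (n m : nat) (z : C) :
  (n <= m)%nat -> W (iterate phi n z) -> W (iterate phi m z).
Proof.
  intros L. induction L as [|m L IH]; [auto|]. intros H. now apply W_phi, IH.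
Qed.

Lemma h_iterate (n : nat) (z : C) :
  Cmod z < 1 -> h (iterate phi n z) = (h z + INR n)%C.
Proof.
  intros Hz. induction n as [|n IH]; [simpl; ring|].
  rewrite S_INR, RtoC_plus. simpl.
  rewrite h_phi by now apply (self_map_iterate phi n). rewrite IH. ring.
Qed.

(* [h A = h B] makes [phi^N A] and [phi^N B] agree near [0], hence everywhere; on
   the radius ending at [tau] both [A] and [B] stay in a Stolz region, where
   [phi^N] is injective near [tau]. *)
Lemma rigidity (A B : C -> C) :
  self_map A -> self_map B -> julia tau A -> julia tau B ->
  (forall z, Cmod z < 1 -> h (A z) = h (B z)) ->
  forall z, Cmod z < 1 -> A z = B z.
Proof.
  intros SA SB JA JB E.
  assert (D0 : Cmod 0 < 1) by (rewrite Cmod_0; lra).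
  destruct (W_absorbs (A 0) (proj2 SA 0 D0)) as [n1 N1].
  destruct (W_absorbs (B 0) (proj2 SB 0 D0)) as [n2 N2].
  set (N := (n1 + n2)%nat).
  apply (W_iterate n1 N) in N1; [|unfold N; lia]. apply (W_iterate n2 N) in N2; [|unfold N; lia].
  pose proof (self_map_iterate phi N phi_self) as SN.
  pose proof (self_map_comp (iterate phi N) A SN SA) as SNA.
  pose proof (self_map_comp (iterate phi N) B SN SB) as SNB.
  assert (EN : forall z, Cmod z < 1 -> iterate phi N (A z) = iterate phi N (B z)).
  { destruct (W_open _ N1) as [e1 [He1 O1]]. destruct (W_open _ N2) as [e2 [He2 O2]].
    destruct (cdiff_ccont _ _ (proj1 SNA 0 D0) e1 He1) as [d1 [Hd1 C1]].
    destruct (cdiff_ccont _ _ (proj1 SNB 0 D0) e2 He2) as [d2 [Hd2 C2]].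
    intros z Hz. apply Cminus_eq_0. revert z Hz.
    apply (identity_theorem (fun z => iterate phi N (A z) - iterate phi N (B z))%C 2 0).
    - intros z Hz. apply cdiff_minus; [now apply SNA|now apply SNB].
    - intros z Hz. unfold Cminus. eapply Rle_trans; [apply Cmod_triangle|]. rewrite Cmod_opp.
      pose proof (proj2 SNA z Hz). pose proof (proj2 SNB z Hz). cbv beta in *. lra.
    - exact D0.
    - intros e He. set (m := Rmin (Rmin e 1) (Rmin d1 d2)).
      assert (Hm : 0 < m) by (unfold m; repeat apply Rmin_pos; lra).
      assert (m <= e /\ m <= 1 /\ m <= d1 /\ m <= d2).
      { unfold m. repeat split.
        - eapply Rle_trans; apply Rmin_l.
        - eapply Rle_trans; [apply Rmin_l|apply Rmin_r].
        - eapply Rle_trans; [apply Rmin_r|apply Rmin_l].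
        - eapply Rle_trans; [apply Rmin_r|apply Rmin_r]. }
      assert (Em : Cmod (RtoC (m / 2)) = m / 2) by (rewrite Cmod_R, Rabs_pos_eq; lra).
      exists (RtoC (m / 2)). replace (RtoC (m / 2) - 0)%C with (RtoC (m / 2)) by ring.
      rewrite Em. split; [apply Cmod_gt_0; lra|]. split; [lra|]. split; [lra|].
      assert (Dm : Cmod (RtoC (m / 2)) < 1) by lra.
      replace (iterate phi N (A (m / 2))) with (iterate phi N (B (m / 2))); [ring|].
      symmetry. apply h_inj.
      + apply O1, C1. replace (RtoC (m / 2) - 0)%C with (RtoC (m / 2)) by ring. lra.
      + apply O2, C2. replace (RtoC (m / 2) - 0)%C with (RtoC (m / 2)) by ring. lra.
      + rewrite !h_iterate by (now apply SA || now apply SB). now rewrite E. }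
  destruct (radial_stolz tau A SA JA tau_unit) as [MA [HMA RA]].
  destruct (radial_stolz tau B SB JB tau_unit) as [MB [HMB RB]].
  destruct (ang_id_injective tau (iterate phi N) (MA + MB) SN tau_unit) as [d [Hd Inj]].
  { now apply ang_id_iterate. } { lra. }
  assert (Er : forall r, 0 <= r < 1 -> 2 * (1 - r) < d ^ 2 -> A (r * tau)%C = B (r * tau)%C).
  { intros r Hr Hrd. destruct (RA r Hr) as [[A1 A2] A3]. destruct (RB r Hr) as [[B1 B2] B3].
    pose proof (Cmod_ge_0 (A (r * tau)%C - tau)%C). pose proof (Cmod_ge_0 (B (r * tau)%C - tau)%C).
    apply Inj.
    - split; [exact A1|]. nra.
    - split; [exact B1|]. nra.
    - nra.
    - nra.
    - apply EN. rewrite Cmod_mult, tau_unit, Cmod_R, Rabs_pos_eq; lra. }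
  (* The zeros of [A - B] must accumulate inside the disc: [(1 - s) tau] is such a point, and from
     it outwards the whole radius satisfies the condition of [Er]. *)
  set (s := Rmin 1 (d ^ 2) / 4).
  assert (Ps : 0 < Rmin 1 (d ^ 2)) by (apply Rmin_pos; nra).
  pose proof (Rmin_l 1 (d ^ 2)). pose proof (Rmin_r 1 (d ^ 2)).
  assert (Hs : 0 < s /\ s <= / 4 /\ s <= d ^ 2 / 4) by (unfold s; lra).
  intros z Hz. apply Cminus_eq_0. revert z Hz.
  apply (identity_theorem (fun z => A z - B z)%C 2 (RtoC (1 - s) * tau)%C).
  - intros z Hz. apply cdiff_minus; [now apply SA|now apply SB].
  - intros z Hz. unfold Cminus. eapply Rle_trans; [apply Cmod_triangle|]. rewrite Cmod_opp.
    pose proof (proj2 SA z Hz). pose proof (proj2 SB z Hz). lra.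
  - rewrite Cmod_mult, tau_unit, Cmod_R, Rabs_pos_eq; lra.
  - intros e He. set (u := Rmin e s / 2).
    assert (0 < Rmin e s) by (apply Rmin_pos; lra).
    pose proof (Rmin_l e s). pose proof (Rmin_r e s).
    assert (Hu : 0 < u /\ u < e /\ u < s) by (unfold u; lra).
    assert (Eu : (RtoC (1 - s + u) * tau - RtoC (1 - s) * tau)%C = (RtoC u * tau)%C).
    { rewrite RtoC_plus. ring. }
    assert (Cu : Cmod (RtoC u * tau)%C = u).
    { rewrite Cmod_mult, tau_unit, Cmod_R, Rabs_pos_eq; lra. }
    exists (RtoC (1 - s + u) * tau)%C. split; [|split; [|split]].
    + intros Eq. rewrite Eq in Eu. apply (f_equal Cmod) in Eu.
      rewrite Cu, Cmod_self_minus in Eu. lra.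
    + rewrite Eu, Cu. lra.
    + rewrite Cmod_mult, tau_unit, Cmod_R, Rabs_pos_eq; lra.
    + rewrite Er by lra. ring.
Qed.

End Rigidity.

(** * Negative translations *)

Lemma h_iterate_shift (f h : C -> C) (c : R) (n : nat) (z : C) :
  self_map f -> (forall z, Cmod z < 1 -> h (f z) = (h z + c)%C) -> Cmod z < 1 ->
  h (iterate f n z) = (h z + INR n * c)%C.
Proof.
  intros Sf Hh Hz. induction n as [|n IH]; [simpl; ring|].
  rewrite S_INR, RtoC_plus. simpl.
  rewrite Hh by now apply (self_map_iterate f n). rewrite IH. ring.
Qed.

Section Backward.

Variables (phi psi h : C -> C) (W S : C -> Prop) (c : R).
Hypothesis phi_self : self_map phi.
Hypothesis psi_self : self_map psi.
Hypothesis comm : forall z, Cmod z < 1 -> psi (phi z) = phi (psi z).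
Hypothesis W_disc : forall z, W z -> Cmod z < 1.
Hypothesis W_open : forall z, W z -> exists r, 0 < r /\ forall w, Cmod (w - z)%C < r -> W w.
Hypothesis W_phi : forall z, W z -> W (phi z).
Hypothesis W_absorbs : forall z, Cmod z < 1 -> exists n, W (iterate phi n z).
Hypothesis h_inj : forall z w, W z -> W w -> h z = h w -> z = w.
Hypothesis h_cdiff : forall z, Cmod z < 1 -> cdiff h z.
Hypothesis h_phi : forall z, Cmod z < 1 -> h (phi z) = (h z + RtoC 1)%C.
Hypothesis h_psi : forall z, Cmod z < 1 -> h (psi z) = (h z + c)%C.
Hypothesis c_neg : c < 0.
Hypothesis S_union : forall w, S w -> exists n z, Cmod z < 1 /\ w = (h z - INR n)%C.
Hypothesis S_shift : forall w (t : R), S w -> S (w + t)%C.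

Lemma comm_iterate (n : nat) (z : C) :
  Cmod z < 1 -> psi (iterate phi n z) = iterate phi n (psi z).
Proof.
  intros Hz. induction n as [|n IH]; [reflexivity|]. simpl. rewrite comm, IH; [reflexivity|].
  now apply (self_map_iterate phi n).
Qed.

(** Once [z] and [psi z] have both been absorbed, [h] is open at [v = phi^N z] and further iterates
    of [phi] add integers to [h]. The clause [W (psi v)] is what later makes the pulled-back value
    independent of the number of steps. *)
Lemma far_right_local (w : C) :
  S w -> exists (j : nat) d, 0 < d /\ forall w' j', Cmod (w' - w)%C < d -> (j <= j')%nat ->
    exists v, W v /\ W (psi v) /\ h v = (w' + INR j')%C.
Proof.
  intros Hw. destruct (S_union w Hw) as (n & z & Hz & Ew).
  destruct (W_absorbs z Hz) as [n1 N1]. destruct (W_absorbs (psi z) (proj2 psi_self z Hz)) as [n2 N2].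
  set (N := (n1 + n2)%nat).
  apply (W_iterate phi W W_phi n1 N) in N1; [|unfold N; lia].
  apply (W_iterate phi W W_phi n2 N) in N2; [|unfold N; lia].
  rewrite <- comm_iterate in N2 by exact Hz.
  set (v := iterate phi N z) in *.
  assert (Hv : h v = (w + INR (n + N))%C).
  { unfold v. rewrite (h_iterate_shift phi h 1) by auto. rewrite Ew, plus_INR, RtoC_plus. ring. }
  destruct (W_open _ N2) as [e [He Oe]].
  destruct (cdiff_ccont _ _ (proj1 psi_self v (W_disc _ N1)) e He) as [rho [Hrho Crho]].
  destruct (image_open h W W_open (fun z Wz => h_cdiff z (W_disc z Wz)) h_inj v rho N1 Hrho)
    as [d [Hd Him]].
  exists (n + N)%nat, d. split; [exact Hd|]. intros w' j' Hw' Hj.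
  destruct (Him (w' + INR (n + N))%C) as (u & Wu & Hu & Eu).
  { rewrite Hv. replace (w' + INR (n + N) - (w + INR (n + N)))%C with (w' - w)%C by ring. exact Hw'. }
  exists (iterate phi (j' - (n + N)) u). split; [|split].
  - apply (W_iterate phi W W_phi 0); [lia|exact Wu].
  - rewrite comm_iterate by now apply W_disc.
    apply (W_iterate phi W W_phi 0); [lia|]. apply Oe, Crho, Hu.
  - rewrite (h_iterate_shift phi h 1) by auto. rewrite Eu, minus_INR, RtoC_minus by exact Hj. ring.
Qed.

(* Integer translations come from [phi]; compactness of [0, 1] handles the
   fractional part. *)
Lemma far_right (w0 : C) :
  S w0 -> exists d T, 0 < d /\ forall w t, Cmod (w - w0)%C < d -> T <= t ->
    exists v, W v /\ W (psi v) /\ h v = (w + RtoC t)%C.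
Proof.
  intros H0.
  set (P := fun (s : R) (jd : nat * R) => 0 < snd jd /\ forall w' j',
    Cmod (w' - (w0 + s))%C < snd jd -> (fst jd <= j')%nat ->
    exists v, W v /\ W (psi v) /\ h v = (w' + INR j')%C).
  assert (Ex : forall s, exists jd, P s jd).
  { intros s. destruct (far_right_local (w0 + s)%C (S_shift w0 s H0)) as (j & d & H).
    now exists (j, d). }
  set (sel := fun s => epsilon (inhabits (O, 0)) (P s)).
  assert (Hsel : forall s, P s (sel s)) by (intros s; apply epsilon_spec, Ex).
  (* The gauge encodes the index as well as the radius: a common positive lower bound [d] yields one
     radius and, through [INR j + 1 <= / d], one bound for all indices [j]. *)
  assert (Pg : forall s, 0 < Rmin (snd (sel s) / 2) (/ (INR (fst (sel s)) + 1))).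
  { intros s. destruct (Hsel s) as [Hp _]. pose proof (pos_INR (fst (sel s))).
    apply Rmin_pos; [lra|]. apply Rinv_0_lt_compat. lra. }
  destruct (compactness_value_1d 0 1 (fun s => mkposreal _ (Pg s))) as [d Hd].
  pose proof (cond_pos d) as d0.
  destruct (nfloor_ex (/ d)) as [J0 HJ0].
  { apply Rlt_le, Rinv_0_lt_compat, d0. }
  exists d, (INR J0 + 1). split; [exact d0|]. intros w t Hw Ht.
  pose proof (pos_INR J0).
  destruct (nfloor_ex t) as [J HJ]; [lra|].
  apply NNPP. intros Hno. apply (Hd (t - INR J)); [lra|].
  intros (s & Hs & Hds & Hg). simpl in Hds, Hg. apply Hno.
  destruct (Hsel s) as [Hp Hv]. set (j := fst (sel s)) in *. set (e := snd (sel s)) in *.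
  pose proof (Rmin_l (e / 2) (/ (INR j + 1))). pose proof (Rmin_r (e / 2) (/ (INR j + 1))).
  pose proof (pos_INR j) as j0.
  assert (Hj : INR j + 1 <= / d).
  { rewrite <- (Rinv_inv (INR j + 1)). apply Rinv_le_contravar; lra. }
  assert (Hjj : (j <= J)%nat).
  { apply Nat.lt_le_incl, INR_lt. lra. }
  destruct (Hv (w + RtoC (t - INR J))%C J) as (v & V1 & V2 & V3); [|exact Hjj|].
  - replace (w + RtoC (t - INR J) - (w0 + s))%C with ((w - w0) + RtoC (t - INR J - s))%C.
    2:{ rewrite (RtoC_minus (t - INR J)). ring. }
    eapply Rle_lt_trans; [apply Cmod_triangle|]. rewrite Cmod_R. lra.
  - exists v. split; [exact V1|]. split; [exact V2|]. rewrite V3, RtoC_minus. ring.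
Qed.

(* As [c < 0], the points [w - n c] move to the right, where [h] is inverted on
   [W]; pulling back by [psi^n] extends this inverse to all of [S]. *)
Lemma global_section :
  exists K, forall w, S w -> cdiff K w /\ Cmod (K w) < 1 /\ h (K w) = w.
Proof.
  set (k := fun w => epsilon (inhabits (RtoC 0)) (fun z => W z /\ h z = w)).
  assert (k_inv : forall z, W z -> k (h z) = z).
  { intros z Wz. destruct (epsilon_spec (inhabits (RtoC 0)) (fun z' => W z' /\ h z' = h z)) as [E1 E2].
    - now exists z.
    - now apply h_inj. }
  (* The eventual value does not single out an [n], so it is well defined although the required [n]
     varies with [w]. *)
  set (Rel := fun w z => exists n0, forall n, (n0 <= n)%nat -> exists v,
    W v /\ h v = (w - INR n * c)%C /\ iterate psi n v = z).
  assert (Uniq : forall w z z', Rel w z -> Rel w z' -> z = z').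
  { intros w z z' [n1 H1] [n2 H2].
    destruct (H1 (n1 + n2)%nat ltac:(lia)) as (v & V1 & V2 & <-).
    destruct (H2 (n1 + n2)%nat ltac:(lia)) as (v' & V1' & V2' & <-).
    f_equal. apply h_inj; auto. now rewrite V2, V2'. }
  set (K := fun w => epsilon (inhabits (RtoC 0)) (Rel w)).
  assert (Loc : forall w0, S w0 -> exists d n, 0 < d /\ forall w, Cmod (w - w0)%C < d ->
    exists v, W v /\ h v = (w - INR n * c)%C /\ K w = iterate psi n v).
  { intros w0 H0. destruct (far_right w0 H0) as (d & T & Hd & HT).
    destruct (nfloor_ex (Rmax 0 (T / - c))) as [m Hm]; [apply Rmax_l|].
    exists d, (Datatypes.S m). split; [exact Hd|]. intros w Hw.
    assert (Hn : forall n, (Datatypes.S m <= n)%nat ->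
              exists v, W v /\ W (psi v) /\ h v = (w - INR n * c)%C).
    { intros n Hmn. destruct (HT w (INR n * - c) Hw) as (v & V1 & V2 & V3).
      - apply le_INR in Hmn. rewrite S_INR in Hmn. pose proof (Rmax_r 0 (T / - c)).
        assert (L : T / - c <= INR n) by lra.
        apply Rmult_le_compat_r with (r := - c) in L; [|lra].
        replace (T / - c * - c) with T in L by (field; lra). exact L.
      - exists v. split; [exact V1|]. split; [exact V2|].
        rewrite V3, RtoC_mult, RtoC_opp. ring. }
    (* If [v] in [W] lies over [w - (n + 1) c], then [psi v] is in [W] and lies over [w - n c];
       injectivity on [W] identifies it with the point used at stage [n]. *)
    assert (Step : forall n, (Datatypes.S m <= n)%nat -> forall v v',
      W v -> W v' -> h v = (w - INR n * c)%C -> h v' = (w - INR (Datatypes.S m) * c)%C ->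
      iterate psi n v = iterate psi (Datatypes.S m) v').
    { intros n Hmn. induction Hmn as [|n Hmn IH]; intros v v' Wv Wv' Hv Hv'.
      - f_equal. apply h_inj; auto. now rewrite Hv, Hv'.
      - destruct (Hn (Datatypes.S n)) as (u & U1 & U2 & U3); [lia|].
        assert (v = u) as -> by (apply h_inj; auto; now rewrite Hv, U3).
        replace (Datatypes.S n) with (n + 1)%nat by lia. rewrite iterate_add.
        apply IH; auto. change (iterate psi 1 u) with (psi u).
        rewrite h_psi by now apply W_disc. rewrite U3, S_INR, RtoC_plus. ring. }
    destruct (Hn (Datatypes.S m) (le_n _)) as (v & V1 & _ & V3).
    exists v. split; [exact V1|]. split; [exact V3|].
    assert (Rw : Rel w (iterate psi (Datatypes.S m) v)).
    { exists (Datatypes.S m). intros n Hmn. destruct (Hn n Hmn) as (u & U1 & _ & U3).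
      exists u. split; [exact U1|]. split; [exact U3|]. now apply Step. }
    apply (Uniq w); [|exact Rw]. apply epsilon_spec. now exists (iterate psi (Datatypes.S m) v). }
  exists K. intros w0 H0. destruct (Loc w0 H0) as (d & n & Hd & Hloc).
  destruct (Hloc w0) as (v0 & W0 & Hv0 & EK).
  { rewrite Cmod_self_minus. exact Hd. }
  pose proof (self_map_iterate psi n psi_self) as Sn.
  split; [|split].
  - apply cdiff_local with (f := fun w => iterate psi n (k (w - INR n * c)%C)) (r := d); [exact Hd| |].
    + intros w Hw. destruct (Hloc w Hw) as (v & Wv & Hv & ->). now rewrite <- Hv, k_inv.
    + apply (cdiff_comp (fun w => k (w - INR n * c)%C) (iterate psi n)).
      * apply (cdiff_comp (fun w => w - INR n * c)%C k).
        -- apply cdiff_minus; [apply cdiff_id|apply cdiff_const].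
        -- rewrite <- Hv0. apply (inverse_cdiff h k W W_open); auto.
      * rewrite <- Hv0, k_inv by exact W0. now apply Sn, W_disc.
  - rewrite EK. now apply Sn, W_disc.
  - rewrite EK, (h_iterate_shift psi h c) by auto. rewrite Hv0. ring.
Qed.

End Backward.

(** * Liouville's theorem and the Cayley transform of a half-plane *)

Lemma Liouville (K : C -> C) (M : R) (z : C) :
  (forall w, cdiff K w) -> (forall w, Cmod (K w) <= M) -> K z = K 0.
Proof.
  intros HK HM. apply Cminus_eq_0. pose proof (Cmod_ge_0 z).
  apply small_eq_0 with (K := 2 * M * Cmod z) (e0 := / (Cmod z + 1)).
  { apply Rinv_0_lt_compat. lra. }
  intros e He.
  assert (Ie : Cmod z + 1 < / e).
  { rewrite <- (Rinv_inv (Cmod z + 1)). apply Rinv_lt_contravar; [|lra].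
    apply Rmult_lt_0_compat; [lra|]. apply Rinv_0_lt_compat; lra. }
  pose proof (Schwarz_lipschitz K 0 z (/ e) M) as L.
  replace (z - 0)%C with z in L by ring.
  specialize (L (fun w _ => conj (HK w) (HM w)) ltac:(lra)).
  apply Rmult_le_compat_r with (r := e) in L; [|lra].
  rewrite Rmult_assoc, Rinv_l, Rmult_1_r in L by lra. exact L.
Qed.

(* [s = 1] and [s = -1] give the upper and the lower half-plane. *)
Definition half_plane (s : R) (w : C) : Prop := 0 < s * Im w.

Lemma cayley_into_disc (s : R) (w : C) :
  half_plane s w -> (w + s * Ci)%C <> 0 /\ Cmod ((w - s * Ci) / (w + s * Ci))%C < 1.
Proof.
  intros Hw.
  assert (E : Cmod (w + s * Ci)%C ^ 2 - Cmod (w - s * Ci)%C ^ 2 = 4 * (s * Im w)).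
  { rewrite !Cmod2_alt. destruct w. simpl. ring. }
  unfold half_plane in Hw.
  pose proof (Cmod_ge_0 (w + s * Ci)%C). pose proof (Cmod_ge_0 (w - s * Ci)%C).
  assert (P : 0 < Cmod (w + s * Ci)%C) by nra.
  assert (N : (w + s * Ci)%C <> 0) by now apply Cmod_gt_0.
  split; [exact N|]. rewrite Cmod_div by exact N.
  apply Rmult_lt_reg_r with (Cmod (w + s * Ci)%C); [exact P|].
  unfold Rdiv. rewrite Rmult_assoc, Rinv_l by lra. nra.
Qed.

Lemma disc_minus_neq_0 (u : C) : Cmod u < 1 -> (1 - u)%C <> 0.
Proof. intros H. apply Cminus_neq_0. intros <-. rewrite Cmod_1 in H. lra. Qed.

Lemma cayley_inv_half_plane (s : R) (u : C) :
  s * s = 1 -> Cmod u < 1 -> half_plane s (s * Ci * ((1 + u) / (1 - u)))%C.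
Proof.
  intros Hs Hu. unfold half_plane. pose proof (disc_minus_neq_0 u Hu) as N.
  pose proof (proj1 (Cmod_gt_0 _) N) as P. pose proof (Cmod_lt_1_pow u Hu) as Q.
  (* The left side is the real part of [(1 + u) * Cconj (1 - u)]. *)
  assert (E : s * Im (s * Ci * ((1 + u) / (1 - u)))%C * Cmod (1 - u)%C ^ 2 = 1 - Cmod u ^ 2).
  { set (q := ((1 + u) / (1 - u))%C).
    assert (Eq : (q * (1 - u))%C = (1 + u)%C) by (unfold q; field; exact N).
    replace (s * Im (s * Ci * q)%C) with ((s * s) * Re q) by (destruct q; simpl; ring).
    rewrite Hs, Rmult_1_l.
    replace (Re q * Cmod (1 - u)%C ^ 2) with (Re (q * (1 - u) * Cconj (1 - u))%C).
    - rewrite Eq, Cmod2_alt. destruct u. simpl. ring.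
    - replace (q * (1 - u) * Cconj (1 - u))%C with (q * ((1 - u) * Cconj (1 - u)))%C by ring.
      rewrite <- Cmod2_conj. rewrite re_scal_r. reflexivity. }
  assert (0 < Cmod (1 - u)%C ^ 2) by nra.
  apply Rmult_lt_reg_r with (Cmod (1 - u)%C ^ 2); [assumption|]. rewrite E. lra.
Qed.

(** The Cayley transform turns [h] and [K] into self-maps of the disc. With [p = K (s i)], the value
    at the point sent to [0], composing with Möbius transformations makes both fix [0], and
    [Schwarz_section] applies. *)
Lemma mobius_of_section (s : R) (h K : C -> C) :
  s * s = 1 ->
  (forall z, Cmod z < 1 -> cdiff h z /\ half_plane s (h z)) ->
  (forall w, half_plane s w -> cdiff K w /\ Cmod (K w) < 1 /\ h (K w) = w) ->
  exists u p, Cmod u = 1 /\ Cmod p < 1 /\ forall z, Cmod z < 1 ->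
    ((h z - s * Ci) / (h z + s * Ci))%C = (u * mobius (- p) z)%C.
Proof.
  intros Hs Hh HK.
  set (cay := fun w => ((w - s * Ci) / (w + s * Ci))%C).
  set (cayi := fun u => (s * Ci * ((1 + u) / (1 - u)))%C).
  assert (D0 : Cmod 0 < 1) by (rewrite Cmod_0; lra).
  assert (Ns : RtoC s <> 0).
  { intros E. apply RtoC_inj in E. rewrite E in Hs. lra. }
  assert (cay_cayi : forall u, Cmod u < 1 -> cay (cayi u) = u).
  { intros u Hu. unfold cay, cayi. pose proof (disc_minus_neq_0 u Hu) as N. field.
    split; [exact N|].
    match goal with |- ?X <> _ => replace X with (RtoC 2 * (s * Ci))%C by ring end.
    repeat apply Cmult_neq_0; [|exact Ns|exact Ci_nz].
    intros E. apply RtoC_inj in E. lra. }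
  assert (S0 : self_map (fun z => cay (h z))).
  { split; intros z Hz; destruct (Hh z Hz) as [Dh Ph]; destruct (cayley_into_disc s _ Ph) as [N L].
    - apply cdiff_div; [exact N| |].
      + apply cdiff_minus; [exact Dh|apply cdiff_const].
      + apply cdiff_plus; [exact Dh|apply cdiff_const].
    - exact L. }
  assert (K0 : self_map (fun u => K (cayi u))).
  { split; intros u Hu; destruct (HK _ (cayley_inv_half_plane s u Hs Hu)) as (D & L & _).
    - apply (cdiff_comp cayi K); [|exact D]. apply cdiff_mult; [apply cdiff_const|].
      apply cdiff_div; [now apply disc_minus_neq_0| |].
      + apply cdiff_plus; [apply cdiff_const|apply cdiff_id].
      + apply cdiff_minus; [apply cdiff_const|apply cdiff_id].
    - exact L. }
  set (p := K (cayi 0)). assert (Hp : Cmod p < 1) by now apply (proj2 K0 0).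
  assert (Op : Cmod (- p)%C < 1) by now rewrite Cmod_opp.
  assert (Ehk : forall u, Cmod u < 1 -> cay (h (K (cayi u))) = u).
  { intros u Hu. destruct (HK _ (cayley_inv_half_plane s u Hs Hu)) as (_ & _ & E).
    unfold cayi at 1. rewrite E. now apply cay_cayi. }
  destruct (Schwarz_section (fun z => cay (h (mobius p z))) (fun u => mobius (- p) (K (cayi u))))
    as (u & Hu & Eu).
  - apply (self_map_comp (fun z => cay (h z)) (mobius p)); [exact S0|now apply self_map_mobius].
  - apply (self_map_comp (mobius (- p)) (fun u => K (cayi u))); [now apply self_map_mobius|exact K0].
  - rewrite mobius_0. now apply Ehk.
  - now apply mobius_opp_self.
  - intros w Hw. rewrite mobius_opp_l; [now apply Ehk|exact Hp|now apply (proj2 K0)].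
  - exists u, p. split; [exact Hu|]. split; [exact Hp|]. intros z Hz.
    rewrite <- Eu by now apply self_map_mobius. now rewrite mobius_opp_l.
Qed.

(** * Denjoy-Wolff points and angular derivatives in terms of moduli *)

Lemma holo_self_map (f : C -> C) : holo_selfmap f -> self_map f.
Proof. intros [H1 H2]. split; [intros z Hz; apply ex_derive_cdiff; now apply H1|exact H2]. Qed.

Lemma open_Cmod (W : C -> Prop) (z : C) :
  open W -> W z -> exists r, 0 < r /\ forall w, Cmod (w - z)%C < r -> W w.
Proof. intros HW Wz. apply locally_Cmod. exact (HW z Wz). Qed.

Lemma orbit_cv (f : C -> C) (tau : C) :
  iterates_cv_loc_unif f tau ->
  forall e, 0 < e -> exists N, forall n, (N <= n)%nat -> Cmod (iterate f n 0 - tau)%C < e.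
Proof.
  intros H e He. assert (D0 : Disc 0) by (unfold Disc; rewrite Cmod_0; lra).
  destruct (H 0 D0) as (d & Hd & Hcv). destruct (Hcv e He) as [N HN]. exists N.
  intros n Hn. apply HN; [exact Hn|exact D0|]. now rewrite Cmod_self_minus.
Qed.

Lemma DW_point_unique (f : C -> C) (a b : C) :
  iterates_cv_loc_unif f a -> iterates_cv_loc_unif f b -> a = b.
Proof.
  intros Ha Hb. apply Cminus_eq_0, Cmod_pos_le_0. intros e He.
  destruct (orbit_cv f a Ha (e / 2)) as [N1 H1]; [lra|].
  destruct (orbit_cv f b Hb (e / 2)) as [N2 H2]; [lra|].
  specialize (H1 (N1 + N2)%nat ltac:(lia)). specialize (H2 (N1 + N2)%nat ltac:(lia)).
  pose proof (Cmod_tri_minus a (iterate f (N1 + N2) 0) b) as T.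
  rewrite (Cmod_minus_sym a (iterate f (N1 + N2) 0)) in T. lra.
Qed.

Lemma Hol_tau_julia (tau : C) (f : C -> C) :
  Cmod tau = 1 -> Hol_tau tau f -> julia tau f.
Proof.
  intros Ht [Sf [Hid|(_ & _ & _ & _ & Hcv)]].
  - intros z Hz. rewrite (Hid z Hz). lra.
  - apply julia_of_orbit; [now apply holo_self_map|exact Ht|now apply orbit_cv].
Qed.

Lemma angular_limit_eps (f : C -> C) (tau l : C) (M e : R) :
  is_angular_limit f tau l -> 1 < M -> 0 < e ->
  exists d, 0 < d /\ forall z, stolz tau M z -> Cmod (z - tau)%C < d -> Cmod (f z - l)%C < e.
Proof.
  intros H HM He. specialize (H M HM (fun w => Cmod (w - l)%C < e)).
  assert (L : locally (T := C_UniformSpace) l (fun w => Cmod (w - l)%C < e)).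
  { apply locally_Cmod. exists e. auto. }
  apply H in L. apply locally_Cmod in L. destruct L as [d [Hd L]].
  exists d. split; [exact Hd|]. intros z Hz Hzt. now apply L.
Qed.

Lemma angular_limit_of_ccont (f g : C -> C) (tau : C) :
  ccont g tau -> (forall z, Cmod z < 1 -> f z = g z) -> is_angular_limit f tau (g tau).
Proof.
  intros Hg E M HM P HP. apply (locally_Cmod (g tau) P) in HP. destruct HP as [e [He HP]].
  apply locally_Cmod. destruct (Hg e He) as [d [Hd H]]. exists d. split; [exact Hd|].
  intros z Hz [Dz _]. apply HP. rewrite E by exact Dz. now apply H.
Qed.

(** The definition of the angular derivative leaves the angular limit [l] open; Julia's inequality
    along the radius forces [l = tau]. *)
Lemma ang_id_of_derivative (tau : C) (f : C -> C) :
  self_map f -> julia tau f -> Cmod tau = 1 -> is_angular_derivative f tau (RtoC 1) ->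
  ang_id tau f.
Proof.
  intros Sf Jf Ht (l & Hl & Hd).
  assert (El : l = tau).
  { apply Cminus_eq_0, Cmod_pos_le_0. intros e He.
    destruct (angular_limit_eps f tau l 2 (e / 2) Hl) as [d [Hd0 H]]; [lra|lra|].
    (* At distance [s] from [tau] on the radius, Julia's inequality gives
       [(2 - s) * |tau - f z|^2 <= s]. *)
    set (s := Rmin d (Rmin 1 ((e / 2) * (e / 2))) / 2).
    assert (P : 0 < Rmin d (Rmin 1 ((e / 2) * (e / 2)))) by (repeat apply Rmin_pos; nra).
    assert (L1 : Rmin d (Rmin 1 ((e / 2) * (e / 2))) <= d) by apply Rmin_l.
    assert (L2 : Rmin d (Rmin 1 ((e / 2) * (e / 2))) <= 1) by (eapply Rle_trans; [apply Rmin_r|apply Rmin_l]).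
    assert (L3 : Rmin d (Rmin 1 ((e / 2) * (e / 2))) <= (e / 2) * (e / 2)) by (eapply Rle_trans; [apply Rmin_r|apply Rmin_r]).
    assert (Hs : 0 < s /\ s < d /\ s <= / 2 /\ s <= (e / 2) * (e / 2)) by (unfold s; lra).
    set (z := (RtoC (1 - s) * tau)%C).
    assert (Cz : Cmod z = 1 - s) by (unfold z; rewrite Cmod_mult, Ht, Cmod_R, Rabs_pos_eq; lra).
    assert (Czt : Cmod (tau - z)%C = s).
    { replace (tau - z)%C with (RtoC s * tau)%C by (unfold z; rewrite RtoC_minus; ring).
      rewrite Cmod_mult, Ht, Cmod_R, Rabs_pos_eq; lra. }
    assert (Dz : Cmod z < 1) by lra.
    assert (H1 : Cmod (f z - l)%C < e / 2).
    { apply H; [split; [exact Dz|]|]; rewrite Cmod_minus_sym, Czt; lra. }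
    pose proof (Jf z Dz) as J. rewrite Cz, Czt in J.
    pose proof (Cmod_ge_0 (tau - f z)%C) as y0. set (y := Cmod (tau - f z)%C) in *.
    assert (J2 : s * (2 - s) * y ^ 2 <= s * s).
    { assert (0 <= Cmod (f z) ^ 2) by apply pow2_ge_0. nra. }
    assert (Y2 : (2 - s) * y ^ 2 <= s).
    { apply Rmult_le_reg_l with s; [lra|]. lra. }
    assert (Y3 : y ^ 2 <= (e / 2) ^ 2) by nra.
    assert (Y4 : y <= e / 2) by nra.
    pose proof (Cmod_tri_minus l (f z) tau) as T.
    rewrite (Cmod_minus_sym l (f z)), (Cmod_minus_sym (f z) tau) in T. fold y in T. lra. }
  subst l. intros M e HM He.
  destruct (angular_limit_eps _ tau 1 M e Hd HM He) as [d [Hd0 H]].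
  exists d. split; [exact Hd0|]. intros z Hz Hzt. specialize (H z Hz Hzt).
  assert (N : (z - tau)%C <> 0).
  { apply Cminus_neq_0. intros ->. destruct Hz. lra. }
  replace (f z - z)%C with (((f z - tau) / (z - tau) - 1) * (z - tau))%C by (field; exact N).
  rewrite Cmod_mult. apply Rmult_le_compat_r; [apply Cmod_ge_0|]. now apply Rlt_le.
Qed.

(* Along the orbit of [0] the function [h] tends to infinity, so the pole of the
   Möbius transformation [h] is [tau]. *)
Lemma translation_quotient (s : R) (psi h : C -> C) (tau u p : C) (c : R) :
  self_map psi -> Cmod tau = 1 -> c <> 0 -> s * s = 1 -> Cmod u = 1 -> Cmod p < 1 ->
  (forall e, 0 < e -> exists N, forall n, (N <= n)%nat -> Cmod (iterate psi n 0 - tau)%C < e) ->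
  (forall z, Cmod z < 1 -> h (psi z) = (h z + c)%C) ->
  (forall z, Cmod z < 1 -> half_plane s (h z)) ->
  (forall z, Cmod z < 1 -> ((h z - s * Ci) / (h z + s * Ci))%C = (u * mobius (- p) z)%C) ->
  exists a b : C, a <> 0 /\ forall z, Cmod z < 1 ->
    (a * (z - tau) = (psi z - tau) * (a + b * (z - tau)))%C.
Proof.
  intros Sp Ht Hc Hs Hu Hp Hcv Hpsi Hhp Hmob.
  assert (D0 : Cmod 0 < 1) by (rewrite Cmod_0; lra).
  assert (Op : Cmod (- p)%C < 1) by now rewrite Cmod_opp.
  set (w0 := (s * Ci)%C) in *.
  assert (Cw0 : Cmod w0 = 1).
  { unfold w0. rewrite Cmod_mult, Cmod_Ci, Cmod_R, Rmult_1_r.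
    pose proof (Rabs_pos s). pose proof (pow2_abs s). nra. }
  (* Solving the Möbius relation for [h z] gives [w0 * (ga + de * z) / (al + be * z)]. *)
  set (al := (1 + u * p)%C). set (be := (- (Cconj p + u))%C).
  set (ga := (1 - u * p)%C). set (de := (u - Cconj p)%C).
  assert (E : forall z, Cmod z < 1 -> (h z * (al + be * z) = w0 * (ga + de * z))%C).
  { intros z Hz. pose proof (Hmob z Hz) as M.
    destruct (cayley_into_disc s _ (Hhp z Hz)) as [N _]. fold w0 in N.
    pose proof (mobius_denom (- p) z Op Hz) as N2. unfold mobius in M.
    rewrite Copp_conj in M, N2.
    assert (M' : ((h z - w0) * (1 + - Cconj p * z) = u * (z + - p) * (h z + w0))%C).
    { replace (h z - w0)%C with ((h z - w0) / (h z + w0) * (h z + w0))%C by (field; exact N).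
      rewrite M. field. exact N2. }
    unfold al, be, ga, de. apply Cminus_eq_0.
    replace (h z * (1 + u * p + - (Cconj p + u) * z) - w0 * (1 - u * p + (u - Cconj p) * z))%C
      with ((h z - w0) * (1 + - Cconj p * z) - u * (z + - p) * (h z + w0))%C by ring.
    rewrite M'. ring. }
  assert (Pole : (al + be * tau)%C = 0).
  { apply Cmod_pos_le_0. intros e He.
    pose proof (Cmod_ge_0 be) as be0.
    destruct (Hcv (e / (2 * (Cmod be + 1)))) as [N HN].
    { apply Rdiv_lt_0_compat; lra. }
    set (B := Cmod ga + Cmod de). set (q := Cmod (h 0)).
    assert (B0 : 0 <= B) by (unfold B; pose proof (Cmod_ge_0 ga); pose proof (Cmod_ge_0 de); lra).
    assert (Ac : 0 < Rabs c) by now apply Rabs_pos_lt.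
    destruct (nfloor_ex (Rmax 0 ((q + 2 * (B + 1) / e) / Rabs c))) as [m Hm]; [apply Rmax_l|].
    set (n := (N + Datatypes.S m)%nat).
    specialize (HN n ltac:(unfold n; lia)). set (z := iterate psi n 0) in *.
    assert (Hz : Cmod z < 1) by now apply (self_map_iterate psi n Sp).
    assert (Hh : h z = (h 0 + INR n * c)%C) by now apply (h_iterate_shift psi h c).
    assert (Big : 2 * (B + 1) / e <= Cmod (h z)).
    { pose proof (Rmax_r 0 ((q + 2 * (B + 1) / e) / Rabs c)) as L.
      assert (Ln : (q + 2 * (B + 1) / e) / Rabs c <= INR n).
      { unfold n. rewrite plus_INR, S_INR. pose proof (pos_INR N). lra. }
      apply Rmult_le_compat_r with (r := Rabs c) in Ln; [|lra].
      replace ((q + 2 * (B + 1) / e) / Rabs c * Rabs c) with (q + 2 * (B + 1) / e) in Ln by (field; lra).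
      pose proof (Cmod_rev_triangle (INR n * c)%C (- h 0)%C) as T.
      rewrite Cmod_opp, Cmod_mult, !Cmod_R, (Rabs_pos_eq (INR n)) in T by apply pos_INR.
      rewrite Hh. replace (h 0 + INR n * c)%C with (INR n * c - - h 0)%C by ring.
      fold q in T. lra. }
    assert (Small : Cmod (al + be * z)%C <= e / 2).
    { pose proof (f_equal Cmod (E z Hz)) as EC. rewrite !Cmod_mult, Cw0, Rmult_1_l in EC.
      assert (R : Cmod (ga + de * z)%C <= B).
      { eapply Rle_trans; [apply Cmod_triangle|]. rewrite Cmod_mult. unfold B.
        pose proof (Cmod_ge_0 de). nra. }
      rewrite <- EC in R. pose proof (Cmod_ge_0 (al + be * z)%C).
      assert (R2 : 2 * (B + 1) / e * Cmod (al + be * z)%C <= B).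
      { eapply Rle_trans; [|exact R]. now apply Rmult_le_compat_r. }
      apply Rmult_le_reg_l with (2 * (B + 1) / e).
      - apply Rdiv_lt_0_compat; lra.
      - replace (2 * (B + 1) / e * (e / 2)) with (B + 1) by (field; lra). lra. }
    replace (al + be * tau)%C with ((al + be * z) + be * (- (z - tau)))%C by ring.
    eapply Rle_trans; [apply Cmod_triangle|]. rewrite Cmod_mult, Cmod_opp.
    assert (Cmod be * Cmod (z - tau)%C <= (Cmod be + 1) * (e / (2 * (Cmod be + 1)))).
    { apply Rmult_le_compat; try apply Cmod_ge_0; lra. }
    replace ((Cmod be + 1) * (e / (2 * (Cmod be + 1)))) with (e / 2) in * by (field; lra). lra. }
  (* The relation means [a / (psi z - tau) = a / (z - tau) + b]: in the coordinate [/ (z - tau)] the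
     map [psi] is a translation. Here [a] is the numerator of [h] at its pole, nonzero because
     [ga + de * tau] equals [2 (1 - Cconj p * tau)] there and [|p| < 1]. *)
  exists (w0 * (ga + de * tau))%C, (c * be)%C. split.
  - apply Cmult_neq_0; [apply Cmod_gt_0; lra|].
    replace (ga + de * tau)%C with (2 * (1 + - Cconj p * tau) - (al + be * tau))%C
      by (unfold al, be, ga, de; ring).
    rewrite Pole. replace (2 * (1 + - Cconj p * tau) - 0)%C with (2 * (1 - Cconj p * tau))%C by ring.
    apply Cmult_neq_0; [intros H; apply RtoC_inj in H; lra|].
    apply Cminus_neq_0. intros H. apply (f_equal Cmod) in H.
    rewrite Cmod_mult, Cmod_conj, Ht, Cmod_1 in H. lra.
  - intros z Hz. pose proof (E z Hz) as E1. pose proof (E (psi z) (proj2 Sp z Hz)) as E2.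
    rewrite Hpsi in E2 by exact Hz.
    assert (Eal : al = (- (be * tau))%C).
    { replace al with ((al + be * tau) - be * tau)%C by ring. rewrite Pole. ring. }
    rewrite Eal in E1, E2. apply Cminus_eq_0.
    replace (w0 * (ga + de * tau) * (z - tau)
             - (psi z - tau) * (w0 * (ga + de * tau) + c * be * (z - tau)))%C
      with ((w0 * (ga + de * psi z)) * (z - tau) - (w0 * (ga + de * z)) * (psi z - tau)
            - c * be * (z - tau) * (psi z - tau))%C by ring.
    rewrite <- E1, <- E2. ring.
Qed.

(** The quotient [(f z - tau) / (z - tau)] equals [a / (a + b (z - tau))], which extends
    continuously to [tau] with value [1]. *)
Lemma parabolic_of_quotient (f : C -> C) (tau a b : C) :
  is_DW_point f tau -> Cmod tau = 1 -> a <> 0 ->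
  (forall z, Cmod z < 1 -> (a * (z - tau) = (f z - tau) * (a + b * (z - tau)))%C) ->
  parabolic f.
Proof.
  intros HDW Ht Na E. exists tau. split; [exact HDW|]. split; [exact Ht|].
  assert (Nt : forall z, Cmod z < 1 -> (z - tau)%C <> 0).
  { intros z Hz. apply Cminus_neq_0. intros ->. lra. }
  set (g := fun z => (a / (a + b * (z - tau)))%C).
  assert (Na' : (a + b * (tau - tau))%C <> 0).
  { now replace (a + b * (tau - tau))%C with a by ring. }
  assert (Cg : ccont g tau).
  { apply ccont_div; [exact Na'|apply ccont_const|].
    apply ccont_plus; [apply ccont_const|]. apply ccont_mult; [apply ccont_const|].
    apply ccont_minus; [apply ccont_id|apply ccont_const]. }
  assert (Gt : g tau = 1).
  { unfold g. replace (a + b * (tau - tau))%C with a by ring. field. exact Na. }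
  assert (Eg : forall z, Cmod z < 1 -> ((f z - tau) / (z - tau))%C = g z).
  { intros z Hz. pose proof (Nt z Hz) as N. specialize (E z Hz).
    assert (Nd : (a + b * (z - tau))%C <> 0).
    { intros E0. rewrite E0, Cmult_0_r in E. now apply (Cmult_neq_0 a (z - tau)). }
    unfold g. replace a with (a * (z - tau) / (z - tau))%C at 1 by (field; exact N).
    rewrite E. field. split; [exact N|exact Nd]. }
  exists tau. split.
  - pose proof (angular_limit_of_ccont f (fun z => tau + g z * (z - tau))%C tau) as L.
    cbv beta in L. replace (tau + g tau * (tau - tau))%C with tau in L by ring. apply L.
    + apply ccont_plus; [apply ccont_const|]. apply ccont_mult; [exact Cg|].
      apply ccont_minus; [apply ccont_id|apply ccont_const].
    + intros z Hz. rewrite <- Eg by exact Hz. field. now apply Nt.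
  - rewrite <- Gt. now apply angular_limit_of_ccont.
Qed.

(** In the coordinate [h] the map is a translation of [S], and the preimage of [w] is
    [K (h w - c)]. *)
Lemma automorphism_of_translation (f h K : C -> C) (S : C -> Prop) (c : R) :
  holo_selfmap f -> (forall z, Cmod z < 1 -> h (f z) = (h z + c)%C) ->
  (forall z, Cmod z < 1 -> S (h z)) -> (forall w (t : R), S w -> S (w + t)%C) ->
  (forall z w, Cmod z < 1 -> Cmod w < 1 -> h z = h w -> z = w) ->
  (forall w, S w -> Cmod (K w) < 1 /\ h (K w) = w) ->
  disc_automorphism f.
Proof.
  intros Sf Hf HS Sh Hinj HK. split; [exact Sf|]. split.
  - intros z w Hz Hw E. apply Hinj; [exact Hz|exact Hw|].
    replace (h z) with (h z + c - c)%C by ring. rewrite <- Hf, E, Hf by assumption. ring.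
  - intros w Hw. destruct (HK _ (Sh _ (- c) (HS w Hw))) as [HK1 HK2].
    exists (K (h w + RtoC (- c))%C). split; [exact HK1|].
    apply Hinj; [now apply Sf|exact Hw|]. rewrite Hf, HK2 by exact HK1. rewrite RtoC_opp. ring.
Qed.

Lemma disc_inverse_spec (f : C -> C) (w : C) :
  disc_automorphism f -> Cmod w < 1 -> Cmod (disc_inverse f w) < 1 /\ f (disc_inverse f w) = w.
Proof.
  intros (_ & _ & Hs) Hw. unfold disc_inverse.
  apply (epsilon_spec (inhabits (RtoC 0)) (fun z => Disc z /\ f z = w)). now apply Hs.
Qed.

Lemma h_iterate_disc_inverse (f h : C -> C) (m : nat) (z : C) :
  disc_automorphism f -> (forall z, Cmod z < 1 -> h (f z) = (h z + RtoC 1)%C) -> Cmod z < 1 ->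
  Cmod (iterate (disc_inverse f) m z) < 1 /\
  h (iterate (disc_inverse f) m z) = (h z - INR m)%C.
Proof.
  intros Hf Hh Hz. induction m as [|m [I1 I2]].
  - simpl. split; [exact Hz|ring].
  - simpl iterate. change (Nat.iter m (disc_inverse f) z) with (iterate (disc_inverse f) m z).
    destruct (disc_inverse_spec f _ Hf I1) as [D1 D2]. split; [exact D1|].
    replace (h (disc_inverse f (iterate (disc_inverse f) m z)))
      with (h (f (disc_inverse f (iterate (disc_inverse f) m z))) - 1)%C.
    + rewrite D2, I2, S_INR, RtoC_plus. ring.
    + rewrite Hh by exact D1. ring.
Qed.

Lemma koenigs_cases (f h : C -> C) :
  is_koenigs_function f h -> exists S, koenigs_model f h S /\
    ((forall w, S w) \/ exists s, s * s = 1 /\ forall w, S w <-> half_plane s w).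
Proof.
  intros [(_ & H & _)|(_ & [H|H] & _)]; eexists; (split; [exact H|]).
  - left. intros w. exact I.
  - right. exists 1. split; [ring|]. intros w. unfold UpperHalfPlane, half_plane.
    rewrite Rmult_1_l. tauto.
  - right. exists (-1). split; [ring|]. intros w. unfold LowerHalfPlane, half_plane.
    split; intros; lra.
Qed.

Theorem proposition3p5 :
  forall (phi psi h : C -> C) (tau : C) (c : R),
    parabolic phi ->
    is_koenigs_function phi h ->
    is_DW_point phi tau ->
    Cmod tau = 1 ->
    Hol_tau tau psi ->
    (forall z, Disc z -> h (psi z) = (h z + RtoC c)%C) ->
    (c = 0 <-> id_on_disc psi) /\
    (forall m n : nat, (1 <= m)%nat -> (1 <= n)%nat ->
       c = INR m / INR n ->
       eq_on Disc (iterate psi n) (iterate phi m)) /\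
    (c < 0 ->
       (disc_automorphism phi /\ parabolic phi) /\
       (disc_automorphism psi /\ parabolic psi) /\
       (forall m n : nat, (1 <= m)%nat -> (1 <= n)%nat ->
          c = - (INR m / INR n) ->
          eq_on Disc (iterate psi n) (iterate (disc_inverse phi) m))).
Proof.
  intros phi psi h tau c Hpar HK HDW Ht Hpsi Hh.
  assert (D0 : Disc 0) by (unfold Disc; rewrite Cmod_0; lra).
  assert (Sphi : self_map phi) by (apply holo_self_map, HDW).
  assert (Spsi : self_map psi) by (apply holo_self_map, Hpsi).
  assert (Jpsi : julia tau psi) by now apply Hol_tau_julia.
  assert (Jphi : julia tau phi).
  { apply Hol_tau_julia; [exact Ht|]. split; [apply HDW|now right]. }
  assert (Aphi : ang_id tau phi).
  (* Parabolicity brings its own boundary point, which equals [tau] because the orbit of [0] has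
     only one limit. *)
  { destruct Hpar as (tau' & HDW' & _ & Hd).
    apply ang_id_of_derivative; auto.
    replace tau with tau'; [exact Hd|].
    apply (DW_point_unique phi); [apply HDW'|apply HDW]. }
  destruct (koenigs_cases phi h HK) as (S & (Hol & HS & Hphi & Hun & W & HW & Hinj) & Hcase).
  destruct HW as ((Wopen & _) & Wdisc & Wphi & Wabs).
  assert (Wopen' : forall z, W z -> exists r, 0 < r /\ forall w, Cmod (w - z)%C < r -> W w)
    by (intros z; now apply open_Cmod).
  assert (Wabs' : forall z, Cmod z < 1 -> exists n, W (iterate phi n z)).
  { intros z Hz. destruct (Wabs z Hz) as (n & _ & Hn). now exists n. }
  assert (Rig : forall A B : C -> C, self_map A -> self_map B -> julia tau A -> julia tau B ->
     (forall z, Cmod z < 1 -> h (A z) = h (B z)) -> forall z, Cmod z < 1 -> A z = B z)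
    by exact (rigidity phi h W tau Sphi Ht Jphi Aphi Wopen' Wphi Wabs' Hinj Hphi).
  split; [split|split].
  - intros -> z Hz. apply (Rig psi (fun z => z)); auto using self_map_id, julia_id.
    intros w Hw. rewrite Hh by exact Hw. ring.
  - intros Hid. pose proof (Hh 0 D0) as E. rewrite (Hid 0 D0) in E.
    apply RtoC_inj. replace (RtoC c) with (h 0 + c - h 0)%C by ring. rewrite <- E. ring.
  - intros m n Hm Hn Hc z Hz. revert z Hz. apply (Rig (iterate psi n) (iterate phi m));
      auto using self_map_iterate, julia_iterate.
    intros z Hz. rewrite (h_iterate_shift psi h c), (h_iterate_shift phi h 1) by auto.
    rewrite <- !RtoC_mult. do 2 f_equal. rewrite Hc. field. apply not_0_INR. lia.
  - intros Hc.
    assert (Comm : forall z, Cmod z < 1 -> psi (phi z) = phi (psi z)).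
    { apply (Rig (fun z => psi (phi z)) (fun z => phi (psi z)));
        auto using self_map_comp, julia_comp.
      intros z Hz. rewrite Hh, !Hphi, Hh; auto; try now apply Sphi. 2: now apply Spsi. ring. }
    assert (Hder : forall z, Cmod z < 1 -> cdiff h z).
    { intros z Hz. now apply ex_derive_cdiff, Hol. }
    assert (Sshift : forall w (t : R), S w -> S (w + t)%C).
    { intros w t Hw. destruct Hcase as [Hall|(s & _ & Hs)]; [apply Hall|].
      apply Hs. apply Hs in Hw. unfold half_plane in *.
      rewrite im_plus. simpl. now rewrite Rplus_0_r. }
    destruct (global_section phi psi h W S c Sphi Spsi Comm Wdisc Wopen' Wphi Wabs' Hinj Hder
      Hphi Hh Hc (fun w Hw => proj1 (Hun w) Hw) Sshift) as [K HKs].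
    destruct Hcase as [Hall|(s & Hs & HSs)].
    { exfalso. assert (E : K 1 = K 0).
      { apply (Liouville K 1).
        - intros w. apply HKs, Hall.
        - intros w. apply Rlt_le, HKs, Hall. }
      destruct (HKs 1 (Hall 1)) as (_ & _ & E1). destruct (HKs 0 (Hall 0)) as (_ & _ & E0).
      rewrite E, E0 in E1. apply RtoC_inj in E1. lra. }
    assert (Hhp : forall z, Cmod z < 1 -> half_plane s (h z)) by (intros z Hz; now apply HSs, HS).
    destruct (mobius_of_section s h K Hs) as (u & p & Hu & Hp & Hmob).
    { intros z Hz. auto. } { intros w Hw. now apply HKs, HSs. }
    assert (Inj : forall z w, Cmod z < 1 -> Cmod w < 1 -> h z = h w -> z = w).
    { intros z w Hz Hw E.
      assert (Op : Cmod (- p)%C < 1) by now rewrite Cmod_opp.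
      assert (Nu : u <> 0) by (apply Cmod_gt_0; lra).
      assert (E2 : mobius (- p) z = mobius (- p) w).
      { replace (mobius (- p) z) with (/ u * (u * mobius (- p) z))%C by (field; exact Nu).
        rewrite <- Hmob, E, Hmob by assumption. field. exact Nu. }
      rewrite <- (mobius_opp_l p z Hp Hz), E2. now apply mobius_opp_l. }
    assert (Aut : forall f d, holo_selfmap f -> (forall z, Cmod z < 1 -> h (f z) = (h z + RtoC d)%C) ->
              disc_automorphism f).
    { intros f d Sf Hf. apply (automorphism_of_translation f h K S d); auto.
      intros w Hw. now apply HKs. }
    assert (Autphi : disc_automorphism phi) by (apply (Aut phi 1); [apply HDW|exact Hphi]).
    assert (DWpsi : is_DW_point psi tau).
    { destruct Hpsi as [_ [Hid|H]]; [exfalso|exact H].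
      pose proof (Hh 0 D0) as E. rewrite (Hid 0 D0) in E.
      assert (c = 0); [|lra]. apply RtoC_inj.
      replace (RtoC c) with (h 0 + c - h 0)%C by ring. rewrite <- E. ring. }
    split; [split; [exact Autphi|exact Hpar]|]. split; [split|].
    + apply (Aut psi c); [apply Hpsi|exact Hh].
    + destruct (translation_quotient s psi h tau u p c) as (a & b & Na & Eab); auto.
      { lra. } { apply orbit_cv, DWpsi. }
      now apply (parabolic_of_quotient psi tau a b).
    + intros m n Hm Hn Ec z Hz.
      destruct (h_iterate_disc_inverse phi h m z Autphi Hphi Hz) as [I1 I2].
      apply Inj; [now apply (self_map_iterate psi n)|exact I1|].
      rewrite (h_iterate_shift psi h c), I2 by auto. rewrite <- RtoC_mult.
      replace (INR n * c) with (- INR m); [rewrite RtoC_opp; ring|].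
      rewrite Ec. field. apply not_0_INR. lia.
Qed.
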